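(* Let $r\ge 2$ be an integer and let $\gamma=(\gamma_1,\dots,\gamma_{r-1})\in\mathbb{R}^{r-1}$ satisfy $\gamma_k\ge -1+\frac{k}{r}$ for all $k\in\{1,\dots,r-1\}$. If $\mathcal{L}$ is a convolution operator associated with the hyper-Bessel operator $B_r$ on $\mathcal{H}_r(\mathbb{C})$, and if $\mathcal{L}$ is not a scalar multiple of the identity, then $\mathcal{L}$ is a chaotic operator on $\mathcal{H}_r(\mathbb{C})$.
   Context: A function $u:\mathbb{C}\to\mathbb{C}$ is $r$-even if $u(\omega^k z)=u(z)$ for all $z\in\mathbb{C}$ and $k\in\{1,\dots,r-1\}$, where $\omega=e^{2i\pi/r}$. $\mathcal{H}_r(\mathbb{C})$ is the Fréchet space of all $r$-even entire functions with the topology of uniform convergence on compact subsets of $\mathbb{C}$; $\mathcal{H}'_r(\mathbb{C})$ is its dual. $\mathrm{Exp}_r(\mathbb{C})$ is the set of $u\in\mathcal{H}_r(\mathbb{C})$ such that $\sup_{z}|u(z)|e^{-a|z|}<\infty$ for some $a>0$. The hyper-Bessel operator is $B_r=\frac{1}{z^{r-1}}\prod_{i=1}^{r-1}\big(z\frac{d}{dz}+(r\gamma_i+1)\big)\frac{d}{dz}$. For $u\in\mathcal{H}_r(\mathbb{C})$, $B_ru$, defined for $z\ne0$, extends to an entire function, and $B_ru$ denotes this extension, which lies in $\mathcal{H}_r(\mathbb{C})$. Let $\alpha_{rn}(\gamma)=r^{rn}\,n!\prod_{i=1}^{r-1}\frac{\Gamma(\gamma_i+n+1)}{\Gamma(\gamma_i+1)}$,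 $n\in\mathbb{N}=\{0,1,\dots\}$. The generalized translations are $(T^\gamma_zu)(w)=\sum_{n=0}^{\infty}\frac{w^{rn}}{\alpha_{rn}(\gamma)}B_r^nu(z)$ for $z,w\in\mathbb{C}$, $u\in\mathcal{H}_r(\mathbb{C})$; they are continuous linear operators on $\mathcal{H}_r(\mathbb{C})$. For $T\in\mathcal{H}'_r(\mathbb{C})$ and $u\in\mathcal{H}_r(\mathbb{C})$, $(T\star_\gamma u)(z)=\langle T,T^\gamma_zu\rangle$. A convolution operator associated with $B_r$ is a continuous linear map $\mathcal{L}:\mathcal{H}_r(\mathbb{C})\to\mathcal{H}_r(\mathbb{C})$ satisfying the following equivalent conditions: (i) $\mathcal{L}$ commutes with $B_r$; (ii) $\mathcal{L}$ commutes with $T^\gamma_z$ for all $z\in\mathbb{C}$; (iii) there is a unique $T\in\mathcal{H}'_r(\mathbb{C})$ with $\mathcal{L}u=T\star_\gamma u$ for all $u$; (iv) there is $\Phi(z)=\sum_{n\ge0}\frac{b_n}{\alpha_{rn}(\gamma)}z^{rn}\in\mathrm{Exp}_r(\mathbb{C})$ with $\mathcal{L}u=\sum_{n\ge0}\frac{b_n}{\alpha_{rn}(\gamma)}B_r^nu$ for all $u$, with convergence in $\mathcal{H}_r(\mathbb{C})$. A continuous linear operator $L$ from a Fréchet space $X$ into itself is chaotic (in the sense of Devaney) if (a) $L$ is hypercyclic, i.e. there is $x\in X$ whose orbit $\{x,Lx,L^2x,\dots\}$ is dense in $X$; and (b) the set $\{x\in X: L^nx=x\text{ for some integer }n\ge1\}$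 of periodic points of $L$ is dense in $X$. *)

(* Defs.v *)
From Stdlib Require Import Reals List Lia ClassicalEpsilon.
From Stdlib Require Import FunctionalExtensionality ProofIrrelevance.
From Coquelicot Require Import Coquelicot.

Open Scope R_scope.

Definition compact_set {U : UniformSpace} (K : U -> Prop) : Prop :=
  forall (I : Type) (O : I -> U -> Prop),
    (forall i, open (O i)) ->
    (forall x, K x -> exists i, O i x) ->
    exists l : list I, forall x, K x -> exists i, In i l /\ O i x.

(** In the next four definitions a topology on [X] is given by its
    neighbourhood filters: [nbhs x P] says that [P] is a neighbourhood of [x]. *)

Definition continuous_op {X : Type} (nbhs : X -> (X -> Prop) -> Prop)
  (L : X -> X) : Prop :=
  forall x, filterlim L (nbhs x) (nbhs (L x)).

Definition dense_set {X : Type} (nbhs : X -> (X -> Prop) -> Prop)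
  (D : X -> Prop) : Prop :=
  forall x P, nbhs x P -> exists y, D y /\ P y.

Definition hypercyclic {X : Type} (nbhs : X -> (X -> Prop) -> Prop)
  (L : X -> X) : Prop :=
  exists x, dense_set nbhs (fun y => exists n : nat, y = Nat.iter n L x).

Definition chaotic {X : Type} (nbhs : X -> (X -> Prop) -> Prop)
  (L : X -> X) : Prop :=
  hypercyclic nbhs L /\
  dense_set nbhs (fun x => exists n : nat, (1 <= n)%nat /\ Nat.iter n L x = x).

Definition entire (u : C -> C) : Prop :=
  forall z : C, ex_derive (K := C_AbsRing) (V := C_NormedModule) u z.

(** [exp (2 i pi / r)] *)
Definition omega (r : nat) : C := (cos (2 * PI / INR r), sin (2 * PI / INR r)).

Definition r_even (r : nat) (u : C -> C) : Prop :=
  forall (z : C) (k : nat), (1 <= k <= r - 1)%nat ->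
    u (omega r ^ k * z)%C = u z.

Record Hr (r : nat) : Type := mkHr {
  Hr_fun :> C -> C;
  Hr_entire : entire Hr_fun;
  Hr_even : r_even r Hr_fun
}.

Arguments mkHr {r}.
Arguments Hr_fun {r}.

Lemma Hr_ext (r : nat) (u v : Hr r) : (forall z, u z = v z) -> u = v.
Proof.
destruct u as [u eu ru], v as [v ev rv]; simpl; intros H.
assert (E : u = v) by (apply functional_extensionality; exact H).
subst v; f_equal; apply proof_irrelevance.
Qed.

Definition Hr_zero (r : nat) : Hr r.
Proof.
exists (fun _ => RtoC 0).
- intros z; apply (ex_derive_const (K := C_AbsRing) (V := C_NormedModule)).
- intros z k _; reflexivity.
Defined.

Definition Hr_plus {r : nat} (u v : Hr r) : Hr r.
Proof.
exists (fun z => u z + v z)%C.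
- intros z.
  apply (ex_derive_plus (K := C_AbsRing) (V := C_NormedModule));
    apply Hr_entire.
- intros z k Hk; rewrite !(Hr_even _ _ z k Hk); reflexivity.
Defined.

Definition Hr_scal {r : nat} (c : C) (u : Hr r) : Hr r.
Proof.
exists (fun z => c * u z)%C.
- intros z; destruct (Hr_entire _ u z) as [l Hl].
  exists (scal (V := C_NormedModule) c l).
  apply (filterdiff_ext_lin (K := C_AbsRing) (U := AbsRing_NormedModule C_AbsRing)
           (V := C_NormedModule) _
           (fun y => scal (V := C_NormedModule) c (scal (V := C_NormedModule) y l))).
  + apply (filterdiff_scal_r_fct (K := C_AbsRing)
             (U := AbsRing_NormedModule C_AbsRing) (V := C_NormedModule)).
    * exact Cmult_comm.
    * exact Hl.
  + intros y; change (c * (y * l) = y * (c * l))%C; ring.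
- intros z k Hk; rewrite (Hr_even _ _ z k Hk); reflexivity.
Defined.

Definition Hr_AbelianMonoid_mixin (r : nat) : AbelianMonoid.mixin_of (Hr r).
Proof.
apply (AbelianMonoid.Mixin (Hr r) Hr_plus (Hr_zero r));
  intros; apply Hr_ext; intros w; simpl; ring.
Defined.

Canonical Hr_AbelianMonoid (r : nat) : AbelianMonoid :=
  AbelianMonoid.Pack (Hr r) (Hr_AbelianMonoid_mixin r) (Hr r).

Definition Hr_AbelianGroup_mixin (r : nat) :
  AbelianGroup.mixin_of (Hr_AbelianMonoid r).
Proof.
apply (AbelianGroup.Mixin (Hr_AbelianMonoid r) (Hr_scal (- (1))%C));
  intros x; apply Hr_ext; intros w; simpl; ring.
Defined.

Canonical Hr_AbelianGroup (r : nat) : AbelianGroup :=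
  AbelianGroup.Pack (Hr r)
    (AbelianGroup.Class (Hr r) _ (Hr_AbelianGroup_mixin r)) (Hr r).

Definition Hr_ModuleSpace_mixin (r : nat) :
  ModuleSpace.mixin_of C_Ring (Hr_AbelianGroup r).
Proof.
apply (ModuleSpace.Mixin C_Ring (Hr_AbelianGroup r) Hr_scal);
  intros; apply Hr_ext; intros w; cbn -[Cmult Cplus]; ring.
Defined.

Canonical Hr_ModuleSpace (r : nat) : ModuleSpace C_Ring :=
  ModuleSpace.Pack C_Ring (Hr r)
    (ModuleSpace.Class C_Ring (Hr r) _ (Hr_ModuleSpace_mixin r)) (Hr r).

(** Topology of uniform convergence on the compact subsets of [C]. *)
Definition nbhs_Hr {r : nat} (u : Hr r) (P : Hr r -> Prop) : Prop :=
  exists K : C -> Prop, compact_set (U := C_UniformSpace) K /\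
  exists eps : posreal,
    forall v : Hr r, (forall z, K z -> Cmod (v z - u z)%C < eps) -> P v.

(** Formula defining [B_r u] away from [0].  Only the entries
    [gamma 1, ..., gamma (r - 1)] of the parameter are used.  The first-order
    factors [z d/dz + (r gamma_i + 1)] commute, so the order of composition
    is immaterial. *)
Definition hyper_Bessel_formula (r : nat) (gamma : nat -> R) (u : C -> C)
  (z : C) : C :=
  (/ z ^ (r - 1) *
   fold_right
     (fun (i : nat) (f : C -> C) (w : C) =>
        w * C_derive f w + RtoC (INR r * gamma i + 1) * f w)
     (C_derive u) (seq 1 (r - 1)) z)%C.

(** [B_r u] is the [r]-even entire extension of the formula above.  It exists
    and is unique for every [u] when [r >= 1]; [epsilon] only serves to name it. *)
Definition hyper_Bessel (r : nat) (gamma : nat -> R) (u : Hr r) : Hr r :=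
  epsilon (inhabits (Hr_zero r))
    (fun v : Hr r =>
       forall z : C, z <> RtoC 0 -> v z = hyper_Bessel_formula r gamma u z).

Record convolution_operator (r : nat) (gamma : nat -> R) (L : Hr r -> Hr r) :
  Prop := {
  conv_plus : forall u v : Hr r, L (plus u v) = plus (L u) (L v);
  conv_scal : forall (c : C) (u : Hr r), L (scal c u) = scal c (L u);
  conv_continuous : continuous_op nbhs_Hr L;
  conv_commute : forall u : Hr r,
    L (hyper_Bessel r gamma u) = hyper_Bessel r gamma (L u)
}.

(* Main.v *)
(** Write [B] for [B_r].  Expanding [u] in powers of [z ^ r] turns [B] into a weighted
    backward shift whose weights grow at least linearly, so every [mu] is an eigenvalue
    of [B], with a one-dimensional eigenspace spanned by a vector [jvec mu].  Since [L]
    commutes with [B], [L (jvec mu) = symbol mu * jvec mu], and [symbol] is an entire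
    function, nonconstant unless [L] is scalar.  The span of the [jvec mu], [mu] in a set
    with an accumulation point, is dense: its closure contains all the derivatives of
    [jvec] at that point.  Liouville's theorem gives such sets on which [symbol] has
    modulus [< 1], respectively [> 1], and the open mapping theorem one on which [symbol]
    is a root of unity.  The first two give topological transitivity and, by Birkhoff's
    argument, hypercyclicity; the third gives the dense set of periodic points. *)

Require Import Defs.
From Stdlib Require Import Reals Lra Lia List ClassicalEpsilon Cantor ZArith.
From Coquelicot Require Import Coquelicot.

Open Scope R_scope.

(** * Complex differentiability *)

(** The complex analysis rests on one fact: the mean of a holomorphic function over a circle about 0
    does not depend on the radius. Goursat's lemma is proved on a rectangle and carried to annuli by
    the exponential; Cauchy's formula, Taylor series, Liouville and the open mapping theorem are
    then statements about means. On the function space everything is done with coefficients.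
    Cauchy's estimates turn uniform convergence on compact sets into smallness of the seminorms
    [sup |c_n| rho ^ n], so continuity, density and completeness become inequalities between
    sequences. [L] enters only through linearity, continuity and commutation with [B]. Derivatives
    of [jvec] in the eigenvalue are encoded algebraically, by the coefficients of [d ^ m] in
    [(mu + d) ^ n], together with the remainders of that expansion. The remainders have bounds
    independent of the order, so density follows from explicit approximation instead of duality.
    Accumulation points are the right notion of a large set of eigenvalues: where a nonconstant
    symbol is a root of unity, the set has empty interior. *)

Definition cdiff (f : C -> C) (z l : C) : Prop :=
  forall eps, 0 < eps -> exists delta, 0 < delta /\
    forall w, Cmod (w - z) < delta ->
      Cmod (f w - f z - l * (w - z)) <= eps * Cmod (w - z).

Definition ccont (f : C -> C) (z : C) : Prop :=
  forall eps, 0 < eps -> exists delta, 0 < delta /\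
    forall w, Cmod (w - z) < delta -> Cmod (f w - f z) < eps.

Lemma is_derive_cdiff (f : C -> C) (z l : C) :
  is_derive (K := C_AbsRing) (V := C_NormedModule) f z l <-> cdiff f z l.
Proof.
split.
- intros [_ H] eps He.
  destruct (H z (fun P HP => HP) (mkposreal eps He)) as [d Hd].
  exists d; split; [apply cond_pos|].
  intros w Hw.
  generalize (Hd w Hw).
  change (Cmod (f w - f z - (w - z) * l) <= eps * Cmod (w - z) ->
          Cmod (f w - f z - l * (w - z)) <= eps * Cmod (w - z)).
  now rewrite (Cmult_comm l).
- intros H; split.
  + apply is_linear_scal_l.
  + intros x Hx eps.
    (* [filterdiff] quantifies over all limits [x] of the filter; uniqueness of limits leaves only
       [z]. *)
    assert (E : z = x)
      by exact (is_filter_lim_locally_unique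
        (V := AbsRing_NormedModule C_AbsRing) z x Hx).
    subst x.
    destruct (H eps (cond_pos eps)) as [d [Hd Hw]].
    exists (mkposreal d Hd); intros w Bw.
    generalize (Hw w Bw).
    change (Cmod (f w - f z - l * (w - z)) <= eps * Cmod (w - z) ->
            Cmod (f w - f z - (w - z) * l) <= eps * Cmod (w - z)).
    now rewrite (Cmult_comm l).
Qed.

Lemma Cmod_sub_sym (x y : C) : Cmod (x - y) = Cmod (y - x).
Proof. rewrite <- Cmod_opp; f_equal; ring. Qed.

Lemma Cmod_sub_tri (x y z : C) : Cmod (x - z) <= Cmod (x - y) + Cmod (y - z).
Proof. replace (x - z)%C with ((x - y) + (y - z))%C by ring; apply Cmod_triangle. Qed.

Lemma Cmod_sub_le (x y : C) : Cmod (x - y) <= Cmod x + Cmod y.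
Proof. unfold Cminus; rewrite <- (Cmod_opp y); apply Cmod_triangle. Qed.

Lemma Cmod_le_sub (x y : C) : Cmod x <= Cmod y + Cmod (x - y).
Proof. replace x with (y + (x - y))%C at 1 by ring; apply Cmod_triangle. Qed.

Lemma Cmod_self (x : C) : Cmod (x - x) = 0.
Proof. replace (x - x)%C with (RtoC 0) by ring; apply Cmod_0. Qed.

Lemma Cmod_small_0 (x : C) : (forall eps, 0 < eps -> Cmod x <= eps) -> x = 0%C.
Proof.
intros H; apply Cmod_eq_0.
destruct (Rle_lt_or_eq_dec 0 (Cmod x) (Cmod_ge_0 x)) as [P|P]; [|easy].
specialize (H (Cmod x / 2)); lra.
Qed.

Lemma cdiff_ccont (f : C -> C) (z l : C) : cdiff f z l -> ccont f z.
Proof.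
intros H eps He.
destruct (H 1 Rlt_0_1) as [d [Hd Hw]].
assert (P := Cmod_ge_0 l).
set (k := 1 + Cmod l).
exists (Rmin d (eps / k)); split.
- apply Rmin_pos; [easy|apply Rdiv_lt_0_compat; unfold k; lra].
- intros w Hm.
  assert (H1 := Hw w (Rlt_le_trans _ _ _ Hm (Rmin_l _ _))).
  assert (H2 := Rlt_le_trans _ _ _ Hm (Rmin_r _ _)).
  assert (T := Cmod_le_sub (f w - f z) (l * (w - z))).
  rewrite Cmod_mult in T.
  apply (Rmult_lt_compat_r k) in H2; [|unfold k; lra].
  unfold Rdiv in H2; rewrite Rmult_assoc, Rinv_l, Rmult_1_r in H2; [|unfold k; lra].
  unfold k in H2; nra.
Qed.

Lemma ccont_const (c z : C) : ccont (fun _ => c) z.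
Proof. intros eps He; exists 1; split; [lra|]; intros; rewrite Cmod_self; lra. Qed.

Lemma ccont_id (z : C) : ccont (fun w => w) z.
Proof. intros eps He; exists eps; auto. Qed.

Lemma ccont_plus (f g : C -> C) (z : C) :
  ccont f z -> ccont g z -> ccont (fun w => f w + g w)%C z.
Proof.
intros Hf Hg eps He.
destruct (Hf (eps / 2) ltac:(lra)) as [d1 [P1 Q1]].
destruct (Hg (eps / 2) ltac:(lra)) as [d2 [P2 Q2]].
exists (Rmin d1 d2); split; [now apply Rmin_pos|].
intros w Hw.
specialize (Q1 w (Rlt_le_trans _ _ _ Hw (Rmin_l _ _))).
specialize (Q2 w (Rlt_le_trans _ _ _ Hw (Rmin_r _ _))).
replace (f w + g w - (f z + g z))%C with ((f w - f z) + (g w - g z))%C by ring.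
eapply Rle_lt_trans; [apply Cmod_triangle|lra].
Qed.

Lemma ccont_mult (f g : C -> C) (z : C) :
  ccont f z -> ccont g z -> ccont (fun w => f w * g w)%C z.
Proof.
intros Hf Hg eps He.
assert (A := Cmod_ge_0 (f z)); assert (B := Cmod_ge_0 (g z)).
set (k := 1 + Cmod (f z) + Cmod (g z)).
assert (Hk : 0 < k) by (unfold k; lra).
assert (E : 0 < Rmin 1 (eps / k)) by (apply Rmin_pos; [lra|now apply Rdiv_lt_0_compat]).
destruct (Hf _ E) as [d1 [P1 Q1]].
destruct (Hg _ E) as [d2 [P2 Q2]].
exists (Rmin d1 d2); split; [now apply Rmin_pos|].
intros w Hw.
specialize (Q1 w (Rlt_le_trans _ _ _ Hw (Rmin_l _ _))).
specialize (Q2 w (Rlt_le_trans _ _ _ Hw (Rmin_r _ _))).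
(* Each of the three terms has a small factor; in the quadratic one the bound 1 of
   [Rmin 1 (eps / k)] serves for the other factor. *)
replace (f w * g w - f z * g z)%C
  with ((f w - f z) * (g w - g z) + (f z * (g w - g z) + (f w - f z) * g z))%C by ring.
eapply Rle_lt_trans; [apply Cmod_triangle|].
eapply Rle_lt_trans; [apply Rplus_le_compat_l, Cmod_triangle|].
rewrite !Cmod_mult.
assert (X := Cmod_ge_0 (f w - f z)); assert (Y := Cmod_ge_0 (g w - g z)).
assert (M1 := Rmin_l 1 (eps / k)).
assert (M2 : k * Rmin 1 (eps / k) <= eps).
{ replace eps with (k * (eps / k)) at 2 by (field; lra).
  apply Rmult_le_compat_l; [lra|apply Rmin_r]. }
set (m := Rmin 1 (eps / k)) in *; unfold k in M2.
assert (Cmod (f w - f z) * Cmod (g w - g z) <= Cmod (f w - f z) * 1)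
  by (apply Rmult_le_compat_l; lra).
assert (Cmod (f z) * Cmod (g w - g z) <= Cmod (f z) * m)
  by (apply Rmult_le_compat_l; lra).
assert (Cmod (f w - f z) * Cmod (g z) <= m * Cmod (g z))
  by (apply Rmult_le_compat_r; lra).
lra.
Qed.

Lemma ccont_inv (f : C -> C) (z : C) :
  ccont f z -> f z <> 0%C -> ccont (fun w => / f w)%C z.
Proof.
intros Hf Hz eps He.
assert (P : 0 < Cmod (f z)) by now apply Cmod_gt_0.
set (a := Cmod (f z)) in *.
assert (Pe : 0 < eps * a * a) by (repeat apply Rmult_lt_0_compat; lra).
assert (E : 0 < Rmin (a / 2) (eps * a * a / 4)) by (apply Rmin_pos; lra).
destruct (Hf _ E) as [d [Hd Q]].
exists d; split; [easy|]; intros w Hw.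
specialize (Q w Hw).
assert (M1 := Rmin_l (a / 2) (eps * a * a / 4)).
assert (M2 := Rmin_r (a / 2) (eps * a * a / 4)).
assert (T := Cmod_le_sub (f z) (f w)); rewrite (Cmod_sub_sym (f z)) in T.
fold a in T.
assert (Nw : f w <> 0%C) by (apply Cmod_gt_0; lra).
replace (/ f w - / f z)%C with ((f z - f w) * / (f w * f z))%C by (field; now split).
rewrite Cmod_mult, Cmod_inv, Cmod_mult, (Cmod_sub_sym (f z)); [|now apply Cmult_neq_0].
fold a; set (b := Cmod (f w)) in *; set (x := Cmod (f w - f z)) in *.
apply (Rmult_lt_reg_r (b * a)); [nra|].
rewrite Rmult_assoc, Rinv_l; [|nra].
assert (eps * a * (a / 2) <= eps * a * b) by (apply Rmult_le_compat_l; nra).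
lra.
Qed.

Lemma cdiff_ext_loc (f g : C -> C) (z l : C) (d : R) : 0 < d ->
  (forall w, Cmod (w - z) < d -> f w = g w) -> cdiff f z l -> cdiff g z l.
Proof.
intros Hd E H eps He; destruct (H eps He) as [d' [P Q]].
exists (Rmin d d'); split; [now apply Rmin_pos|]; intros w Hw.
rewrite <- (E w), <- (E z).
- apply Q; eapply Rlt_le_trans; [apply Hw|apply Rmin_r].
- now rewrite Cmod_self.
- eapply Rlt_le_trans; [apply Hw|apply Rmin_l].
Qed.

Lemma cdiff_ext (f g : C -> C) (z l : C) :
  (forall w, f w = g w) -> cdiff f z l -> cdiff g z l.
Proof. intros E; apply (cdiff_ext_loc _ _ _ _ 1 Rlt_0_1); auto. Qed.

Lemma cdiff_const (c z : C) : cdiff (fun _ => c) z 0.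
Proof.
intros eps He; exists 1; split; [lra|]; intros w _.
replace (c - c - 0 * (w - z))%C with (RtoC 0) by ring.
rewrite Cmod_0; apply Rmult_le_pos; [lra|apply Cmod_ge_0].
Qed.

Lemma cdiff_id (z : C) : cdiff (fun w => w) z 1.
Proof.
intros eps He; exists 1; split; [lra|]; intros w _.
replace (w - z - 1 * (w - z))%C with (RtoC 0) by ring.
rewrite Cmod_0; apply Rmult_le_pos; [lra|apply Cmod_ge_0].
Qed.

Lemma cdiff_plus (f g : C -> C) (z a b : C) :
  cdiff f z a -> cdiff g z b -> cdiff (fun w => f w + g w)%C z (a + b).
Proof.
intros Hf Hg eps He.
destruct (Hf (eps / 2) ltac:(lra)) as [d1 [P1 Q1]].
destruct (Hg (eps / 2) ltac:(lra)) as [d2 [P2 Q2]].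
exists (Rmin d1 d2); split; [now apply Rmin_pos|].
intros w Hw.
specialize (Q1 w (Rlt_le_trans _ _ _ Hw (Rmin_l _ _))).
specialize (Q2 w (Rlt_le_trans _ _ _ Hw (Rmin_r _ _))).
replace (f w + g w - (f z + g z) - (a + b) * (w - z))%C
  with ((f w - f z - a * (w - z)) + (g w - g z - b * (w - z)))%C by ring.
eapply Rle_trans; [apply Cmod_triangle|lra].
Qed.

(* Caratheodory's form of differentiability reduces the product, quotient and
   chain rules to continuity of products and inverses. *)
Lemma cdiff_caratheodory (f h : C -> C) (z l : C) (d : R) :
  0 < d -> (forall w, Cmod (w - z) < d -> (f w - f z = h w * (w - z))%C) ->
  h z = l -> ccont h z -> cdiff f z l.
Proof.
intros Hd E <- Hh eps He; destruct (Hh eps He) as [d' [P Q]].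
exists (Rmin d d'); split; [now apply Rmin_pos|]; intros w Hw.
rewrite (E w).
- replace (h w * (w - z) - h z * (w - z))%C with ((h w - h z) * (w - z))%C by ring.
  rewrite Cmod_mult; apply Rmult_le_compat_r; [apply Cmod_ge_0|].
  apply Rlt_le, Q; eapply Rlt_le_trans; [apply Hw|apply Rmin_r].
- eapply Rlt_le_trans; [apply Hw|apply Rmin_l].
Qed.

(** The default [l] at [w = z] makes the difference quotient continuous there when [l] is the
    derivative. The same function later removes the singularity in Cauchy's formula. *)
Definition slope (f : C -> C) (z l w : C) : C :=
  if Ceq_dec w z then l else ((f w - f z) / (w - z))%C.

Lemma slope_at (f : C -> C) (z l : C) : slope f z l z = l.
Proof. unfold slope; now destruct (Ceq_dec z z). Qed.

Lemma slope_eq (f : C -> C) (z l w : C) : (f w - f z = slope f z l w * (w - z))%C.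
Proof.
unfold slope; destruct (Ceq_dec w z) as [->|N]; [ring|].
field; now apply Cminus_eq_contra.
Qed.

Lemma slope_ccont (f : C -> C) (z l : C) : cdiff f z l -> ccont (slope f z l) z.
Proof.
intros H eps He.
destruct (H (eps / 2) ltac:(lra)) as [d [P Q]].
exists d; split; [easy|]; intros w Hw.
rewrite slope_at; unfold slope; destruct (Ceq_dec w z) as [->|N].
- rewrite Cmod_self; lra.
- specialize (Q w Hw).
  assert (Nz := Cminus_eq_contra _ _ N).
  assert (0 < Cmod (w - z)) by now apply Cmod_gt_0.
  replace ((f w - f z) / (w - z) - l)%C
    with ((f w - f z - l * (w - z)) / (w - z))%C by (now field).
  rewrite Cmod_div; [|easy].
  apply (Rmult_lt_reg_r (Cmod (w - z))); [easy|].
  unfold Rdiv; rewrite Rmult_assoc, Rinv_l; [|lra].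
  nra.
Qed.

Lemma cdiff_mult (f g : C -> C) (z a b : C) :
  cdiff f z a -> cdiff g z b -> cdiff (fun w => f w * g w)%C z (a * g z + f z * b).
Proof.
intros Hf Hg.
apply (cdiff_caratheodory _
  (fun w => slope f z a w * g w + f z * slope g z b w)%C _ _ 1 Rlt_0_1).
- intros w _; replace (f w * g w - f z * g z)%C
    with ((f w - f z) * g w + f z * (g w - g z))%C by ring.
  rewrite (slope_eq f z a w), (slope_eq g z b w); ring.
- now rewrite !slope_at.
- apply ccont_plus; apply ccont_mult.
  + now apply slope_ccont.
  + now apply (cdiff_ccont _ _ b).
  + apply ccont_const.
  + now apply slope_ccont.
Qed.

Lemma cdiff_inv (f : C -> C) (z a : C) :
  cdiff f z a -> f z <> 0%C -> cdiff (fun w => / f w)%C z (- a / (f z * f z)).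
Proof.
intros Hf Nz.
assert (Cf := cdiff_ccont _ _ _ Hf).
destruct (Cf (Cmod (f z)) ltac:(now apply Cmod_gt_0)) as [d [Hd Q]].
assert (N : forall w, Cmod (w - z) < d -> f w <> 0%C).
{ intros w Hw E; specialize (Q w Hw); rewrite E in Q.
  replace (0 - f z)%C with (- f z)%C in Q by ring; rewrite Cmod_opp in Q; lra. }
apply (cdiff_caratheodory _
  (fun w => (- (1)) * slope f z a w * / (f w * f z))%C _ _ d Hd).
- intros w Hw; assert (Nw := N w Hw).
  replace (/ f w - / f z)%C with (- (f w - f z) * / (f w * f z))%C by (field; now split).
  rewrite (slope_eq f z a w); ring.
- rewrite slope_at; field; easy.
- apply ccont_mult.
  + apply ccont_mult; [apply ccont_const|now apply slope_ccont].
  + apply ccont_inv; [|now apply Cmult_neq_0].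
    apply ccont_mult; [easy|apply ccont_const].
Qed.

Lemma cdiff_pow (n : nat) (z : C) : exists l, cdiff (fun w => w ^ n)%C z l.
Proof.
induction n as [|n [l IH]]; [exists 0%C; exact (cdiff_const 1%C z)|].
eexists; apply cdiff_ext with (fun w => w * w ^ n)%C; [easy|].
apply cdiff_mult; [apply cdiff_id|apply IH].
Qed.

Lemma cdiff_shift (f : C -> C) (c z l : C) :
  cdiff f (c + z)%C l -> cdiff (fun w => f (c + w)%C) z l.
Proof.
intros H eps He; destruct (H eps He) as [d [P Q]].
exists d; split; [easy|]; intros w.
replace (w - z)%C with (c + w - (c + z))%C by ring; apply Q.
Qed.

(** Carrying the proof of [P n x] along with [x] in a subset type lets plain recursion make the
    successive choices. It produces the shrinking rectangles of Goursat and the shrinking balls of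
    Birkhoff. *)
Lemma dependent_choice {X : Type} (P : nat -> X -> Prop) (Q : nat -> X -> X -> Prop) :
  (exists x, P 0%nat x) ->
  (forall n x, P n x -> exists y, P (S n) y /\ Q n x y) ->
  exists u : nat -> X, forall n, P n (u n) /\ Q n (u n) (u (S n)).
Proof.
intros [x0 H0] H.
set (next := fun n (s : {x | P n x}) =>
  constructive_indefinite_description _ (H n (proj1_sig s) (proj2_sig s))).
set (st := fix st n : {x | P n x} :=
  match n with
  | O => exist _ x0 H0
  | S n => exist _ (proj1_sig (next n (st n))) (proj1 (proj2_sig (next n (st n))))
  end).
exists (fun n => proj1_sig (st n)); intros n; split.
- apply proj2_sig.
- simpl; apply (proj2 (proj2_sig (next n (st n)))).
Qed.

Lemma nested_intervals (a l : nat -> R) :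
  (forall n, a n <= a (S n)) -> (forall n, a (S n) + l (S n) <= a n + l n) ->
  (forall n, 0 <= l n) -> exists x, forall n, a n <= x <= a n + l n.
Proof.
intros Ha Hb Hl.
assert (Ma : forall n m, a n <= a (n + m)%nat).
{ intros n m; induction m as [|m IH]; [rewrite Nat.add_0_r; lra|].
  rewrite Nat.add_succ_r; specialize (Ha (n + m)%nat); lra. }
assert (Mb : forall n m, a (n + m)%nat + l (n + m)%nat <= a n + l n).
{ intros n m; induction m as [|m IH]; [rewrite Nat.add_0_r; lra|].
  rewrite Nat.add_succ_r; specialize (Hb (n + m)%nat); lra. }
(* Every left end lies below every right end: compare both with the interval of index [n + m]. The
   supremum of the left ends is then the common point. *)
assert (U : forall n m, a m <= a n + l n).
{ intros n m; generalize (Ma m n), (Mb n m), (Hl (n + m)%nat).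
  rewrite (Nat.add_comm m n); lra. }
destruct (completeness (fun x => exists n, x = a n)) as [x [Hx1 Hx2]].
- exists (a 0%nat + l 0%nat); intros x [n ->]; apply U.
- exists (a 0%nat); now exists 0%nat.
- exists x; intros n; split.
  + apply Hx1; now exists n.
  + apply Hx2; intros y [m ->]; apply U.
Qed.

(** * Riemann integrals of complex-valued functions of a real variable *)

Notation is_CRInt := (is_RInt (V := C_R_CompleteNormedModule)).
Notation ex_CRInt := (ex_RInt (V := C_R_CompleteNormedModule)).

Lemma Cmod_le_abs (x y : R) : Cmod (x, y) <= Rabs x + Rabs y.
Proof.
replace (x, y) with (RtoC x + Ci * RtoC y)%C
  by (unfold RtoC, Ci, Cmult, Cplus; simpl; f_equal; ring).
eapply Rle_trans; [apply Cmod_triangle|].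
rewrite Cmod_mult, Cmod_Ci, !Cmod_R; lra.
Qed.

Lemma C_ball_Cmod (z w : C) (e : R) :
  Cmod (w - z) < e -> ball (M := C_UniformSpace) z e w.
Proof.
intros H; assert (M := Rmax_Cmod (w - z)%C); split.
- change (Rabs (fst (w - z)%C) < e).
  eapply Rle_lt_trans; [eapply Rle_trans; [apply Rmax_l|apply M]|easy].
- change (Rabs (snd (w - z)%C) < e).
  eapply Rle_lt_trans; [eapply Rle_trans; [apply Rmax_r|apply M]|easy].
Qed.

(** Balls of [C_UniformSpace] are squares, so half the radius is kept for each coordinate. *)
Lemma Cmod_C_ball (z w : C) (e : R) :
  ball (M := C_UniformSpace) z (e / 2) w -> Cmod (w - z) < e.
Proof.
intros [H1 H2].
change (Rabs (fst (w - z)%C) < e / 2) in H1.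
change (Rabs (snd (w - z)%C) < e / 2) in H2.
destruct (w - z)%C as [x y]; simpl in *.
assert (M := Cmod_le_abs x y); lra.
Qed.

Definition rcont (F : R -> C) (t : R) : Prop :=
  forall eps, 0 < eps -> exists delta, 0 < delta /\
    forall x, Rabs (x - t) < delta -> Cmod (F x - F t) < eps.

Lemma rcont_continuous (F : R -> C) (t : R) :
  rcont F t -> continuous (U := C_R_CompleteNormedModule) F t.
Proof.
intros H P [e He].
destruct (H e (cond_pos e)) as [d [Hd Q]].
exists (mkposreal d Hd); intros x Bx; apply He.
apply C_ball_Cmod; now apply Q.
Qed.

Lemma ex_CRInt_rcont (F : R -> C) (a b : R) : a <= b ->
  (forall t, a <= t <= b -> rcont F t) -> ex_CRInt F a b.
Proof.
intros Hab H; apply ex_RInt_continuous; intros z.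
rewrite Rmin_left, Rmax_right by easy; intros Hz.
now apply rcont_continuous, H.
Qed.

Lemma norm_CR (z : C) : norm (V := C_R_CompleteNormedModule) z = Cmod z.
Proof.
destruct z as [x y]; unfold Cmod; simpl.
unfold norm; simpl; unfold prod_norm; simpl.
unfold norm; simpl; unfold abs; simpl.
rewrite !Rmult_1_r; f_equal; rewrite <- !Rabs_mult, !Rabs_right; nra.
Qed.

(** Integrate [G - k] and bound it by its supremum. In Goursat's estimate [k] is the contribution of
    the affine part of the integrand. *)
Lemma is_CRInt_near_const (G : R -> C) (a b m : R) (k v : C) : a <= b ->
  (forall t, a <= t <= b -> Cmod (G t - k) <= m) -> is_CRInt G a b v ->
  Cmod (v - RtoC (b - a) * k) <= (b - a) * m.
Proof.
intros Hab H Hv.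
assert (E : (v - RtoC (b - a) * k)%C
  = minus (G := C_R_CompleteNormedModule) v (scal (V := C_R_CompleteNormedModule) (b - a) k)).
{ destruct v as [v1 v2], k as [k1 k2].
  change ((v1, v2) - RtoC (b - a) * (k1, k2) = (v1, v2) - ((b - a) * k1, (b - a) * k2)%R)%C.
  apply injective_projections; simpl; ring. }
rewrite E, <- norm_CR.
apply (norm_RInt_le_const (V := C_R_CompleteNormedModule) (fun t => G t - k)%C a b); [easy| |].
- intros x Hx; rewrite norm_CR; auto.
- apply (is_RInt_minus (V := C_R_CompleteNormedModule) G (fun _ => k)); [easy|].
  apply (is_RInt_const (V := C_R_CompleteNormedModule)).
Qed.

Lemma is_CRInt_bound (G : R -> C) (a b m : R) (v : C) : a <= b ->
  (forall t, a <= t <= b -> Cmod (G t) <= m) -> is_CRInt G a b v ->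
  Cmod v <= (b - a) * m.
Proof.
intros Hab H Hv; replace v with (v - RtoC (b - a) * 0)%C by ring.
apply (is_CRInt_near_const G); auto.
intros t Ht; replace (G t - 0)%C with (G t) by ring; auto.
Qed.

(** The integral lives in a real normed module and is linear over the reals only; a complex factor
    has to be expanded on real and imaginary parts. *)
Lemma is_CRInt_mult (F : R -> C) (a b : R) (c v : C) :
  is_CRInt F a b v -> is_CRInt (fun t => c * F t)%C a b (c * v)%C.
Proof.
intros H.
assert (H1 := is_RInt_fct_extend_fst F a b v H).
assert (H2 := is_RInt_fct_extend_snd F a b v H).
destruct c as [x y].
apply (is_RInt_fct_extend_pair (U := R_NormedModule) (V := R_NormedModule)).
- apply (is_RInt_minus (V := R_NormedModule) (fun t => x * fst (F t)) (fun t => y * snd (F t)));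
    now apply (is_RInt_scal (V := R_NormedModule)).
- apply (is_RInt_plus (V := R_NormedModule) (fun t => x * snd (F t)) (fun t => y * fst (F t)));
    now apply (is_RInt_scal (V := R_NormedModule)).
Qed.

Lemma is_CRInt_plus (F G : R -> C) (a b : R) (v w : C) :
  is_CRInt F a b v -> is_CRInt G a b w -> is_CRInt (fun t => F t + G t)%C a b (v + w)%C.
Proof. intros; now apply (is_RInt_plus (V := C_R_CompleteNormedModule)). Qed.

Lemma is_CRInt_minus (F G : R -> C) (a b : R) (v w : C) :
  is_CRInt F a b v -> is_CRInt G a b w -> is_CRInt (fun t => F t - G t)%C a b (v - w)%C.
Proof. intros; now apply (is_RInt_minus (V := C_R_CompleteNormedModule)). Qed.

Lemma is_CRInt_Chasles (F : R -> C) (a b c : R) (v w : C) :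
  is_CRInt F a b v -> is_CRInt F b c w -> is_CRInt F a c (v + w)%C.
Proof. apply (is_RInt_Chasles (V := C_R_CompleteNormedModule)). Qed.

Lemma is_CRInt_unique (F : R -> C) (a b : R) (v w : C) :
  is_CRInt F a b v -> is_CRInt F a b w -> v = w.
Proof.
intros H1 H2.
rewrite <- (is_RInt_unique (V := C_R_CompleteNormedModule) F a b v H1).
now apply (is_RInt_unique (V := C_R_CompleteNormedModule)).
Qed.

(** * Goursat's lemma *)

(** Complex differentiability at [s0 + i t0] in real coordinates: the pair [(s - s0, t - t0)] is the
    complex increment, so the single number [l] contains the Cauchy-Riemann equations. *)
Definition diff2 (F : R -> R -> C) (s0 t0 : R) : Prop :=
  exists l : C, forall eps, 0 < eps -> exists delta, 0 < delta /\
    forall s t, Rabs (s - s0) < delta -> Rabs (t - t0) < delta ->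
      Cmod (F s t - F s0 t0 - l * (s - s0, t - t0))
        <= eps * (Rabs (s - s0) + Rabs (t - t0)).

Lemma diff2_cont (F : R -> R -> C) (s0 t0 : R) : diff2 F s0 t0 ->
  forall eps, 0 < eps -> exists delta, 0 < delta /\
    forall s t, Rabs (s - s0) < delta -> Rabs (t - t0) < delta ->
      Cmod (F s t - F s0 t0) < eps.
Proof.
intros [l H] eps He.
destruct (H 1 Rlt_0_1) as [d [Hd Q]].
assert (Pl := Cmod_ge_0 l); set (k := 2 * (1 + Cmod l)).
assert (Hk : 0 < k) by (unfold k; lra).
exists (Rmin d (eps / k)); split.
- apply Rmin_pos; [easy|now apply Rdiv_lt_0_compat].
- intros s t Hs Ht.
  assert (S1 := Q s t (Rlt_le_trans _ _ _ Hs (Rmin_l _ _)) (Rlt_le_trans _ _ _ Ht (Rmin_l _ _))).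
  assert (S2 := Rlt_le_trans _ _ _ Hs (Rmin_r _ _)).
  assert (S3 := Rlt_le_trans _ _ _ Ht (Rmin_r _ _)).
  assert (T := Cmod_le_sub (F s t - F s0 t0) (l * (s - s0, t - t0))).
  rewrite Cmod_mult in T.
  assert (A := Cmod_le_abs (s - s0) (t - t0)).
  apply (Rmult_lt_compat_r k) in S2; [|easy].
  apply (Rmult_lt_compat_r k) in S3; [|easy].
  unfold Rdiv in S2, S3; rewrite Rmult_assoc, Rinv_l, Rmult_1_r in S2, S3 by lra.
  apply (Rmult_le_compat_l (Cmod l)) in A; [|easy].
  unfold k in S2, S3; lra.
Qed.

Lemma diff2_rcont_l (F : R -> R -> C) (s t : R) : diff2 F s t -> rcont (fun x => F x t) s.
Proof.
intros H eps He; destruct (diff2_cont F s t H eps He) as [d [Hd Q]].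
exists d; split; [easy|]; intros x Hx; apply Q; [easy|].
now rewrite Rminus_diag, Rabs_R0.
Qed.

Lemma diff2_rcont_r (F : R -> R -> C) (s t : R) : diff2 F s t -> rcont (F s) t.
Proof.
intros H eps He; destruct (diff2_cont F s t H eps He) as [d [Hd Q]].
exists d; split; [easy|]; intros x Hx; apply Q; [|easy].
now rewrite Rminus_diag, Rabs_R0.
Qed.

Definition holo_on (F : R -> R -> C) (a b c d : R) : Prop :=
  forall s t, a <= s <= b -> c <= t <= d -> diff2 F s t.

Lemma holo_on_sub (F : R -> R -> C) (a b c d a' b' c' d' : R) :
  holo_on F a b c d -> a <= a' -> b' <= b -> c <= c' -> d' <= d ->
  holo_on F a' b' c' d'.
Proof. intros H A B D E s t Hs Ht; apply H; lra. Qed.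

(* [is_bd F a b c d v]: the integral of [F] along the boundary of
   [[a,b] x [c,d]], traversed counterclockwise, is [v]. *)
Definition is_bd (F : R -> R -> C) (a b c d : R) (v : C) : Prop :=
  exists v1 v2 : C, is_CRInt (fun t => F b t - F a t)%C c d v1 /\
    is_CRInt (fun s => F s d - F s c)%C a b v2 /\ v = (Ci * v1 - v2)%C.

Lemma rcont_minus (F G : R -> C) (t : R) :
  rcont F t -> rcont G t -> rcont (fun x => F x - G x)%C t.
Proof.
intros HF HG eps He.
destruct (HF (eps / 2) ltac:(lra)) as [d1 [P1 Q1]].
destruct (HG (eps / 2) ltac:(lra)) as [d2 [P2 Q2]].
exists (Rmin d1 d2); split; [now apply Rmin_pos|]; intros x Hx.
specialize (Q1 x (Rlt_le_trans _ _ _ Hx (Rmin_l _ _))).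
specialize (Q2 x (Rlt_le_trans _ _ _ Hx (Rmin_r _ _))).
replace (F x - G x - (F t - G t))%C with ((F x - F t) - (G x - G t))%C by ring.
eapply Rle_lt_trans; [apply Cmod_sub_le|lra].
Qed.

Lemma ex_bd (F : R -> R -> C) (a b c d : R) : a <= b -> c <= d ->
  holo_on F a b c d -> exists v, is_bd F a b c d v.
Proof.
intros Hab Hcd H.
destruct (ex_CRInt_rcont (fun t => F b t - F a t)%C c d Hcd) as [v1 H1].
{ intros t Ht; apply rcont_minus; apply diff2_rcont_r, H; lra. }
destruct (ex_CRInt_rcont (fun s => F s d - F s c)%C a b Hab) as [v2 H2].
{ intros s Hs; apply (rcont_minus (fun s => F s d) (fun s => F s c));
  apply diff2_rcont_l, H; lra. }
now exists (Ci * v1 - v2)%C, v1, v2.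
Qed.

(** The side common to both rectangles is traversed once in each direction and cancels. *)
Lemma is_bd_split_s (F : R -> R -> C) (a m b c d : R) (v w : C) :
  is_bd F a m c d v -> is_bd F m b c d w -> is_bd F a b c d (v + w).
Proof.
intros [v1 [v2 [A [B ->]]]] [w1 [w2 [A' [B' ->]]]].
exists (v1 + w1)%C, (v2 + w2)%C; split; [|split; [|ring]].
- apply (is_RInt_ext (V := C_R_CompleteNormedModule)
    (fun t => (F m t - F a t) + (F b t - F m t))%C).
  + intros t _; unfold plus; simpl; ring.
  + now apply is_CRInt_plus.
- now apply is_CRInt_Chasles with m.
Qed.

Lemma is_bd_split_t (F : R -> R -> C) (a b c m d : R) (v w : C) :
  is_bd F a b c m v -> is_bd F a b m d w -> is_bd F a b c d (v + w).
Proof.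
intros [v1 [v2 [A [B ->]]]] [w1 [w2 [A' [B' ->]]]].
exists (v1 + w1)%C, (v2 + w2)%C; split; [|split; [|ring]].
- now apply is_CRInt_Chasles with m.
- apply (is_RInt_ext (V := C_R_CompleteNormedModule)
    (fun s => (F s m - F s c) + (F s d - F s m))%C).
  + intros t _; unfold plus; simpl; ring.
  + now apply is_CRInt_plus.
Qed.

Lemma is_bd_unique (F : R -> R -> C) (a b c d : R) (v w : C) :
  is_bd F a b c d v -> is_bd F a b c d w -> v = w.
Proof.
intros [v1 [v2 [A [B ->]]]] [w1 [w2 [A' [B' ->]]]].
now rewrite (is_CRInt_unique _ _ _ _ _ A A'), (is_CRInt_unique _ _ _ _ _ B B').
Qed.

(** An affine function has zero integral along the boundary: both pairs of opposite sides contribute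
    [Ci * l * (b - a) * (d - c)], with opposite signs. Only the error [eps] of the affine
    approximation is left, over the perimeter. *)
Lemma is_bd_small (F : R -> R -> C) (a b c d s0 t0 eps : R) (k l v : C) :
  a <= s0 <= b -> c <= t0 <= d -> 0 <= eps ->
  (forall s t, a <= s <= b -> c <= t <= d ->
     Cmod (F s t - k - l * (s - s0, t - t0)) <= eps) ->
  is_bd F a b c d v ->
  Cmod v <= 2 * eps * ((b - a) + (d - c)).
Proof.
intros Hs Ht He H [v1 [v2 [A [B ->]]]].
assert (N1 : Cmod (v1 - RtoC (d - c) * (l * RtoC (b - a))) <= (d - c) * (2 * eps)).
{ apply (is_CRInt_near_const (fun t => F b t - F a t)%C); [lra| |easy].
  intros t Ht'.
  replace (F b t - F a t - l * RtoC (b - a))%C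
    with ((F b t - k - l * (b - s0, t - t0)%R) - (F a t - k - l * (a - s0, t - t0)%R))%C.
  - eapply Rle_trans; [apply Cmod_sub_le|].
    assert (X := H b t ltac:(lra) ltac:(lra)); assert (Y := H a t ltac:(lra) ltac:(lra)); lra.
  - unfold Cminus, Cplus, Cmult, Copp, RtoC; simpl; f_equal; ring. }
assert (N2 : Cmod (v2 - RtoC (b - a) * (l * (Ci * RtoC (d - c)))) <= (b - a) * (2 * eps)).
{ apply (is_CRInt_near_const (fun s => F s d - F s c)%C); [lra| |easy].
  intros s Hs'.
  replace (F s d - F s c - l * (Ci * RtoC (d - c)))%C
    with ((F s d - k - l * (s - s0, d - t0)%R) - (F s c - k - l * (s - s0, c - t0)%R))%C.
  - eapply Rle_trans; [apply Cmod_sub_le|].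
    assert (X := H s d ltac:(lra) ltac:(lra)); assert (Y := H s c ltac:(lra) ltac:(lra)); lra.
  - unfold Cminus, Cplus, Cmult, Copp, RtoC, Ci; simpl; f_equal; ring. }
replace (Ci * v1 - v2)%C
  with (Ci * (v1 - RtoC (d - c) * (l * RtoC (b - a)))
        - (v2 - RtoC (b - a) * (l * (Ci * RtoC (d - c)))))%C by ring.
eapply Rle_trans; [apply Cmod_sub_le|].
rewrite Cmod_mult, Cmod_Ci; lra.
Qed.

Lemma pow_two_gt_0 (n : nat) : 0 < 2 ^ n.
Proof. apply pow_lt; lra. Qed.

(** If [v] were nonzero, repeated quartering would give nested rectangles whose integrals are at
    least [Cmod v / 4 ^ n]. Differentiability at their common point bounds these integrals by an
    arbitrarily small multiple of the squared side length, which is of the same order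
    [1 / 4 ^ n]. *)
Lemma goursat (F : R -> R -> C) (a b c d : R) (v : C) : a < b -> c < d ->
  holo_on F a b c d -> is_bd F a b c d v -> v = 0%C.
Proof.
intros Hab Hcd H Hv.
destruct (Ceq_dec v 0) as [E|N]; [easy|exfalso].
assert (Pv : 0 < Cmod v) by now apply Cmod_gt_0.
set (p := b - a); set (q := d - c).
(* A state is the lower left corner of the [n]-th rectangle, of sides [p / 2 ^ n] and [q / 2 ^ n];
   [Q] expresses that the next rectangle lies inside it. *)
set (P := fun n (x : R * R) => a <= fst x /\ fst x + p / 2 ^ n <= b /\
  c <= snd x /\ snd x + q / 2 ^ n <= d /\
  exists w, is_bd F (fst x) (fst x + p / 2 ^ n) (snd x) (snd x + q / 2 ^ n) w /\
    Cmod v / 4 ^ n <= Cmod w).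
set (Q := fun n (x y : R * R) => fst x <= fst y /\ fst y + p / 2 ^ S n <= fst x + p / 2 ^ n /\
  snd x <= snd y /\ snd y + q / 2 ^ S n <= snd x + q / 2 ^ n).
assert (Half : forall r n, r / 2 ^ n = r / 2 ^ S n + r / 2 ^ S n).
{ intros r n; simpl; field; assert (X := pow_two_gt_0 n); lra. }
assert (Pp : forall n, 0 < p / 2 ^ n).
{ intros n; apply Rdiv_lt_0_compat; [unfold p; lra|apply pow_two_gt_0]. }
assert (Pq : forall n, 0 < q / 2 ^ n).
{ intros n; apply Rdiv_lt_0_compat; [unfold q; lra|apply pow_two_gt_0]. }
destruct (dependent_choice P Q) as [u Hu].
- exists (a, c); unfold P; simpl.
  replace (a + p / 1) with b by (unfold p; field).
  replace (c + q / 1) with d by (unfold q; field).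
  repeat split; try lra.
  exists v; split; [easy|lra].
- intros n [x y] [A [B [A' [B' [w [Hw Mw]]]]]]; simpl fst in *; simpl snd in *.
  rewrite (Half p n) in B, Hw; rewrite (Half q n) in B', Hw.
  rewrite <- Rplus_assoc in B, B', Hw; rewrite <- Rplus_assoc in Hw.
  specialize (Pp (S n)); specialize (Pq (S n)).
  set (p' := p / 2 ^ S n) in *; set (q' := q / 2 ^ S n) in *.
  destruct (ex_bd F x (x + p') y (y + q')) as [w1 H1]; try lra.
  { eapply holo_on_sub; [exact H|lra..]. }
  destruct (ex_bd F (x + p') (x + p' + p') y (y + q')) as [w2 H2]; try lra.
  { eapply holo_on_sub; [exact H|lra..]. }
  destruct (ex_bd F x (x + p') (y + q') (y + q' + q')) as [w3 H3]; try lra.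
  { eapply holo_on_sub; [exact H|lra..]. }
  destruct (ex_bd F (x + p') (x + p' + p') (y + q') (y + q' + q')) as [w4 H4]; try lra.
  { eapply holo_on_sub; [exact H|lra..]. }
  assert (E : w = ((w1 + w2) + (w3 + w4))%C).
  { eapply is_bd_unique; [exact Hw|].
    apply is_bd_split_t with (y + q'); now apply is_bd_split_s with (x + p'). }
  assert (T : Cmod w <= (Cmod w1 + Cmod w2) + (Cmod w3 + Cmod w4)).
  { rewrite E; eapply Rle_trans; [apply Cmod_triangle|].
    apply Rplus_le_compat; apply Cmod_triangle. }
  set (m := Cmod v / 4 ^ S n).
  assert (M4 : Cmod v / 4 ^ n = 4 * m).
  { unfold m; simpl; field; apply pow_nonzero; lra. }
  destruct (Rle_lt_dec m (Cmod w1)) as [L1|L1];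
  [|destruct (Rle_lt_dec m (Cmod w2)) as [L2|L2];
  [|destruct (Rle_lt_dec m (Cmod w3)) as [L3|L3];
  [|destruct (Rle_lt_dec m (Cmod w4)) as [L4|L4]; [|lra]]]].
  + exists (x, y); unfold P, Q; simpl fst; simpl snd; rewrite (Half p n), (Half q n).
    fold p' q'; repeat split; try lra; now exists w1.
  + exists (x + p', y); unfold P, Q; simpl fst; simpl snd; rewrite (Half p n), (Half q n).
    fold p' q'; repeat split; try lra; now exists w2.
  + exists (x, y + q'); unfold P, Q; simpl fst; simpl snd; rewrite (Half p n), (Half q n).
    fold p' q'; repeat split; try lra; now exists w3.
  + exists (x + p', y + q'); unfold P, Q; simpl fst; simpl snd; rewrite (Half p n), (Half q n).
    fold p' q'; repeat split; try lra; now exists w4.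
- destruct (nested_intervals (fun n => fst (u n)) (fun n => p / 2 ^ n)) as [s0 Hs];
    try (intros n; destruct (Hu n) as [_ X]; unfold Q in X; simpl in *; tauto).
  { intros n; now apply Rlt_le. }
  destruct (nested_intervals (fun n => snd (u n)) (fun n => q / 2 ^ n)) as [t0 Ht];
    try (intros n; destruct (Hu n) as [_ X]; unfold Q in X; simpl in *; tauto).
  { intros n; now apply Rlt_le. }
  assert (D : diff2 F s0 t0).
  { apply H.
    - destruct (Hu 0%nat) as [X _]; unfold P in X; specialize (Hs 0%nat); simpl in *; lra.
    - destruct (Hu 0%nat) as [X _]; unfold P in X; specialize (Ht 0%nat); simpl in *; lra. }
  destruct D as [l Hl].
  assert (Ppq : 0 < p + q) by (unfold p, q; lra).
  (* With this value the upper bound [2 * eps * (p + q) ^ 2 / 4 ^ n] is exactly half of the lower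
     bound [Cmod v / 4 ^ n]. *)
  set (eps := Cmod v / (4 * ((p + q) * (p + q)))).
  assert (Pe : 0 < eps) by (apply Rdiv_lt_0_compat; nra).
  destruct (Hl eps Pe) as [del [Pdel Hdel]].
  assert (Hn : exists n, (p + q) / 2 ^ n < del).
  { destruct (pow_lt_1_zero (/ 2) ltac:(rewrite Rabs_right; lra) (del / (p + q))
      ltac:(now apply Rdiv_lt_0_compat)) as [n Hn].
    exists n; specialize (Hn n (le_n n)).
    rewrite pow_inv, Rabs_right in Hn
      by (apply Rle_ge, Rlt_le, Rinv_0_lt_compat, pow_two_gt_0).
    apply (Rmult_lt_compat_l (p + q)) in Hn; [|easy].
    replace ((p + q) * (del / (p + q))) with del in Hn by (field; lra).
    exact Hn. }
  destruct Hn as [n Hn].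
  destruct (Hu n) as [[_ [_ [_ [_ [w [Hw Mw]]]]]] _].
  specialize (Hs n); specialize (Ht n); simpl in Hs, Ht.
  set (x := fst (u n)) in *; set (y := snd (u n)) in *.
  specialize (Pp n); specialize (Pq n).
  assert (Dpq : (p + q) / 2 ^ n = p / 2 ^ n + q / 2 ^ n) by (unfold Rdiv; ring).
  assert (X : Cmod w <= 2 * (eps * ((p + q) / 2 ^ n))
     * ((x + p / 2 ^ n - x) + (y + q / 2 ^ n - y))).
  { apply (is_bd_small F _ _ _ _ s0 t0 _ (F s0 t0) l); try easy.
    - apply Rmult_le_pos; lra.
    - intros s t Hs' Ht'.
      assert (As : Rabs (s - s0) <= p / 2 ^ n) by (apply Rabs_le; lra).
      assert (At : Rabs (t - t0) <= q / 2 ^ n) by (apply Rabs_le; lra).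
      eapply Rle_trans; [apply Hdel; lra|].
      apply Rmult_le_compat_l; lra. }
  replace ((x + p / 2 ^ n - x) + (y + q / 2 ^ n - y)) with ((p + q) / 2 ^ n) in X by lra.
  assert (Y : 2 * (eps * ((p + q) / 2 ^ n)) * ((p + q) / 2 ^ n) = Cmod v / 4 ^ n / 2).
  { unfold eps; replace 4 with (2 * 2) at 2 by lra; rewrite Rpow_mult_distr.
    field; split; [apply Rgt_not_eq, pow_two_gt_0|lra]. }
  assert (Z : 0 < Cmod v / 4 ^ n) by (apply Rdiv_lt_0_compat; [easy|apply pow_lt; lra]).
  lra.
Qed.

(** * Circle means and Taylor expansion *)

Definition cis (t : R) : C := (cos t, sin t).

(** The complex exponential of [s + i t]. Its real coordinates turn circles about 0 into vertical
    segments. *)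
Definition polar (s t : R) : C := (RtoC (exp s) * cis t)%C.

Lemma Cmod_cis (t : R) : Cmod (cis t) = 1.
Proof.
unfold Cmod, cis; simpl; rewrite !Rmult_1_r.
generalize (sin2_cos2 t); unfold Rsqr; intros E.
replace (cos t * cos t + sin t * sin t) with 1 by lra; apply sqrt_1.
Qed.

Lemma cis_plus (s t : R) : cis (s + t) = (cis s * cis t)%C.
Proof.
unfold cis; rewrite cos_plus, sin_plus; apply injective_projections; simpl; ring.
Qed.

Lemma polar_plus (s s' t t' : R) : polar (s + s') (t + t') = (polar s t * polar s' t')%C.
Proof. unfold polar; rewrite exp_plus, cis_plus, RtoC_mult; ring. Qed.

Lemma Cmod_polar (s t : R) : Cmod (polar s t) = exp s.
Proof.
unfold polar; rewrite Cmod_mult, Cmod_cis, Cmod_R, Rabs_right; [ring|].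
apply Rle_ge, Rlt_le, exp_pos.
Qed.

Lemma Cmod_real_cis (rho t : R) : 0 <= rho -> Cmod (RtoC rho * cis t) = rho.
Proof.
intros H; rewrite Cmod_mult, Cmod_cis, Cmod_R, Rabs_right; lra.
Qed.

Lemma exp_monotone (x y : R) : x <= y -> exp x <= exp y.
Proof. intros [H| ->]; [now apply Rlt_le, exp_increasing|lra]. Qed.

Lemma derivable_0_le (f : R -> R) (l : R) : derivable_pt_lim f 0 l ->
  forall eps, 0 < eps -> exists delta, 0 < delta /\
    forall h, Rabs h < delta -> Rabs (f h - f 0 - l * h) <= eps * Rabs h.
Proof.
intros H eps He; destruct (H eps He) as [[d Hd] Q]; exists d; split; [easy|].
intros h Hh; simpl in Q.
destruct (Req_dec h 0) as [->|N].
- rewrite Rmult_0_r, Rabs_R0, Rmult_0_r, Rminus_0_r, Rminus_diag, Rabs_R0; lra.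
- specialize (Q h N Hh); rewrite Rplus_0_l in Q.
  replace (f h - f 0 - l * h) with (((f h - f 0) / h - l) * h) by (field; easy).
  rewrite Rabs_mult; apply Rmult_le_compat_r; [apply Rabs_pos|lra].
Qed.

Lemma polar_diff_0 (eps : R) : 0 < eps -> exists delta, 0 < delta /\
  forall s t, Rabs s < delta -> Rabs t < delta ->
    Cmod (polar s t - 1 - (s, t)) <= eps * (Rabs s + Rabs t).
Proof.
intros He.
(* The three error terms below add up to at most [e * Rabs s + 5 * e * Rabs t]; the bound [e <= 1]
   keeps [exp s] below 2. *)
set (e := Rmin 1 (eps / 8)).
assert (Pe : 0 < e) by (apply Rmin_pos; lra).
assert (E1 : e <= 1) by apply Rmin_l.
assert (E2 : e <= eps / 8) by apply Rmin_r.
destruct (derivable_0_le exp 1) with (eps := e) as [d1 [P1 Q1]]; [|easy|].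
{ rewrite <- exp_0; apply derivable_pt_lim_exp. }
destruct (derivable_0_le cos 0) with (eps := e) as [d2 [P2 Q2]]; [|easy|].
{ replace 0 with (- sin 0) at 2 by (rewrite sin_0; ring); apply derivable_pt_lim_cos. }
destruct (derivable_0_le sin 1) with (eps := e) as [d3 [P3 Q3]]; [|easy|].
{ rewrite <- cos_0; apply derivable_pt_lim_sin. }
exists (Rmin (Rmin d1 (e / 2)) (Rmin d2 d3)); split.
- repeat apply Rmin_pos; lra.
- intros s t Hs Ht.
  assert (Hs1 : Rabs s < d1) by (eapply Rlt_le_trans; [apply Hs|];
    eapply Rle_trans; [apply Rmin_l|apply Rmin_l]).
  assert (Hs2 : Rabs s < e / 2) by (eapply Rlt_le_trans; [apply Hs|];
    eapply Rle_trans; [apply Rmin_l|apply Rmin_r]).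
  assert (Ht1 : Rabs t < d2) by (eapply Rlt_le_trans; [apply Ht|];
    eapply Rle_trans; [apply Rmin_r|apply Rmin_l]).
  assert (Ht2 : Rabs t < d3) by (eapply Rlt_le_trans; [apply Ht|];
    eapply Rle_trans; [apply Rmin_r|apply Rmin_r]).
  specialize (Q1 s Hs1); specialize (Q2 t Ht1); specialize (Q3 t Ht2).
  rewrite exp_0 in Q1; rewrite cos_0 in Q2; rewrite sin_0 in Q3.
  assert (As := Rabs_pos s); assert (At := Rabs_pos t).
  assert (X : Rabs (exp s - 1) <= e).
  { replace (exp s - 1) with ((exp s - 1 - 1 * s) + s) by ring.
    eapply Rle_trans; [apply Rabs_triang|]; nra. }
  assert (Y : Rabs (exp s) <= 2).
  { replace (exp s) with ((exp s - 1) + 1) by ring.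
    eapply Rle_trans; [apply Rabs_triang|]; rewrite Rabs_R1; lra. }
  replace (polar s t - 1 - (s, t)%R)%C with
    (RtoC (exp s - 1 - 1 * s) + (RtoC (exp s) * (cos t - 1 - 0 * t, sin t - 0 - 1 * t)%R
     + RtoC (exp s - 1) * (Ci * RtoC t)))%C
    by (unfold polar, cis; apply injective_projections; simpl; ring).
  eapply Rle_trans; [apply Cmod_triangle|].
  eapply Rle_trans; [apply Rplus_le_compat_l, Cmod_triangle|].
  rewrite !Cmod_mult, Cmod_Ci, !Cmod_R.
  assert (Z := Cmod_le_abs (cos t - 1 - 0 * t) (sin t - 0 - 1 * t)).
  assert (Z0 := Cmod_ge_0 (cos t - 1 - 0 * t, sin t - 0 - 1 * t)).
  assert (Z1 : Rabs (exp s) * Cmod (cos t - 1 - 0 * t, sin t - 0 - 1 * t)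
    <= 2 * (e * Rabs t + e * Rabs t)).
  { apply Rmult_le_compat; [apply Rabs_pos|easy|easy|lra]. }
  assert (Z2 : Rabs (exp s - 1) * (1 * Rabs t) <= e * Rabs t).
  { rewrite Rmult_1_l; apply Rmult_le_compat_r; lra. }
  assert (Z3 : e * Rabs t <= eps / 8 * Rabs t) by (apply Rmult_le_compat_r; lra).
  assert (Z4 : e * Rabs s <= eps / 8 * Rabs s) by (apply Rmult_le_compat_r; lra).
  nra.
Qed.

Lemma polar_diff (s0 t0 eps : R) : 0 < eps -> exists delta, 0 < delta /\
  forall s t, Rabs (s - s0) < delta -> Rabs (t - t0) < delta ->
    Cmod (polar s t - polar s0 t0 - polar s0 t0 * (s - s0, t - t0)%R)
      <= eps * (Rabs (s - s0) + Rabs (t - t0)).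
Proof.
intros He; assert (X := exp_pos s0).
destruct (polar_diff_0 (eps / exp s0)) as [d [P Q]]; [now apply Rdiv_lt_0_compat|].
exists d; split; [easy|]; intros s t Hs Ht.
replace (polar s t) with (polar s0 t0 * polar (s - s0) (t - t0))%C
  by (rewrite <- polar_plus; f_equal; ring).
replace (polar s0 t0 * polar (s - s0) (t - t0) - polar s0 t0
  - polar s0 t0 * (s - s0, t - t0)%R)%C
  with (polar s0 t0 * (polar (s - s0) (t - t0) - 1 - (s - s0, t - t0)%R))%C by ring.
rewrite Cmod_mult, Cmod_polar.
specialize (Q _ _ Hs Ht).
apply (Rmult_le_compat_l (exp s0)) in Q; [|lra].
replace (exp s0 * (eps / exp s0 * (Rabs (s - s0) + Rabs (t - t0))))
  with (eps * (Rabs (s - s0) + Rabs (t - t0))) in Q by (field; lra).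
exact Q.
Qed.

Lemma polar_lipschitz (s0 t0 : R) : exists k delta, 0 < k /\ 0 < delta /\
  forall s t, Rabs (s - s0) < delta -> Rabs (t - t0) < delta ->
    Cmod (polar s t - polar s0 t0) <= k * (Rabs (s - s0) + Rabs (t - t0)).
Proof.
destruct (polar_diff s0 t0 1 Rlt_0_1) as [d [P Q]].
exists (1 + exp s0), d; assert (X := exp_pos s0); split; [lra|split; [easy|]].
intros s t Hs Ht.
specialize (Q s t Hs Ht).
assert (T := Cmod_le_sub (polar s t - polar s0 t0) (polar s0 t0 * (s - s0, t - t0)%R)).
rewrite Cmod_mult, Cmod_polar in T.
assert (A := Cmod_le_abs (s - s0) (t - t0)).
apply (Rmult_le_compat_l (exp s0)) in A; lra.
Qed.

(** Chain rule: [polar] is its own derivative, so the composite has derivative [l * polar s0 t0]. *)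
Lemma diff2_polar (f : C -> C) (s0 t0 : R) (l : C) :
  cdiff f (polar s0 t0) l -> diff2 (fun s t => f (polar s t)) s0 t0.
Proof.
intros H; exists (l * polar s0 t0)%C; intros eps He.
destruct (polar_lipschitz s0 t0) as [k [d0 [Pk [P0 Q0]]]].
destruct (H (eps / (2 * k))) as [d1 [P1 Q1]]; [apply Rdiv_lt_0_compat; lra|].
assert (Pl := Cmod_ge_0 l).
destruct (polar_diff s0 t0 (eps / (2 * (1 + Cmod l)))) as [d2 [P2 Q2]];
  [apply Rdiv_lt_0_compat; lra|].
exists (Rmin (Rmin d0 d2) (d1 / (2 * k))); split.
- repeat apply Rmin_pos; try easy; apply Rdiv_lt_0_compat; lra.
- intros s t Hs Ht.
  assert (Hs0 : Rabs (s - s0) < d0) by (eapply Rlt_le_trans; [apply Hs|];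
    eapply Rle_trans; [apply Rmin_l|apply Rmin_l]).
  assert (Hs2 : Rabs (s - s0) < d2) by (eapply Rlt_le_trans; [apply Hs|];
    eapply Rle_trans; [apply Rmin_l|apply Rmin_r]).
  assert (Ht0 : Rabs (t - t0) < d0) by (eapply Rlt_le_trans; [apply Ht|];
    eapply Rle_trans; [apply Rmin_l|apply Rmin_l]).
  assert (Ht2 : Rabs (t - t0) < d2) by (eapply Rlt_le_trans; [apply Ht|];
    eapply Rle_trans; [apply Rmin_l|apply Rmin_r]).
  assert (Hs1 := Rlt_le_trans _ _ _ Hs (Rmin_r _ _)).
  assert (Ht1 := Rlt_le_trans _ _ _ Ht (Rmin_r _ _)).
  specialize (Q0 s t Hs0 Ht0); specialize (Q2 s t Hs2 Ht2).
  set (m := Rabs (s - s0) + Rabs (t - t0)) in *.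
  assert (Hm : k * m < d1).
  { apply Rlt_le_trans with (k * (d1 / (2 * k) + d1 / (2 * k))).
    - apply Rmult_lt_compat_l; unfold m; lra.
    - right; field; lra. }
  assert (Hm0 : 0 <= m) by (unfold m; generalize (Rabs_pos (s - s0)) (Rabs_pos (t - t0)); lra).
  specialize (Q1 (polar s t) ltac:(lra)).
  replace (f (polar s t) - f (polar s0 t0) - l * polar s0 t0 * (s - s0, t - t0)%R)%C
    with ((f (polar s t) - f (polar s0 t0) - l * (polar s t - polar s0 t0))
      + l * (polar s t - polar s0 t0 - polar s0 t0 * (s - s0, t - t0)%R))%C by ring.
  eapply Rle_trans; [apply Cmod_triangle|]; rewrite Cmod_mult.
  assert (A : eps / (2 * k) * Cmod (polar s t - polar s0 t0) <= eps / 2 * m).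
  { replace (eps / 2 * m) with (eps / (2 * k) * (k * m)) by (field; lra).
    apply Rmult_le_compat_l; [apply Rlt_le, Rdiv_lt_0_compat; lra|easy]. }
  assert (B : Cmod l * (eps / (2 * (1 + Cmod l)) * m) <= eps / 2 * m).
  { rewrite <- Rmult_assoc; apply Rmult_le_compat_r; [easy|].
    replace (eps / 2) with ((1 + Cmod l) * (eps / (2 * (1 + Cmod l)))) by (field; lra).
    apply Rmult_le_compat_r; [apply Rlt_le, Rdiv_lt_0_compat; lra|lra]. }
  apply (Rmult_le_compat_l (Cmod l)) in Q2; [|easy].
  lra.
Qed.

Lemma cis_cont (t eps : R) : 0 < eps -> exists delta, 0 < delta /\
  forall x, Rabs (x - t) < delta -> Cmod (cis x - cis t) < eps.
Proof.
intros He; destruct (polar_lipschitz 0 t) as [k [d [Pk [Pd Q]]]].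
exists (Rmin d (eps / k)); split; [apply Rmin_pos; [easy|now apply Rdiv_lt_0_compat]|].
intros x Hx.
assert (X1 := Rlt_le_trans _ _ _ Hx (Rmin_l _ _)).
assert (X2 := Rlt_le_trans _ _ _ Hx (Rmin_r _ _)).
specialize (Q 0 x); rewrite Rminus_diag, Rabs_R0, Rplus_0_l in Q; specialize (Q Pd X1).
unfold polar in Q; rewrite exp_0, !Cmult_1_l in Q.
eapply Rle_lt_trans; [apply Q|].
apply Rlt_le_trans with (k * (eps / k)); [now apply Rmult_lt_compat_l|].
right; field; lra.
Qed.

(** The mean over the circle of radius [rho] about 0, which is the contour integral of
    [f z / (2 i pi z)]. As a relation it keeps existence apart from computation. *)
Definition is_mean (f : C -> C) (rho : R) (v : C) : Prop :=
  is_CRInt (fun t => f (RtoC rho * cis t)%C) 0 (2 * PI) (RtoC (2 * PI) * v)%C.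

Lemma two_pi_pos : 0 < 2 * PI.
Proof. generalize PI_RGT_0; lra. Qed.

Lemma two_pi_nz : RtoC (2 * PI) <> 0%C.
Proof. intros E; apply RtoC_inj in E; generalize two_pi_pos; lra. Qed.

Lemma is_mean_unique (f : C -> C) (rho : R) (v w : C) :
  is_mean f rho v -> is_mean f rho w -> v = w.
Proof.
intros H1 H2; assert (E := is_CRInt_unique _ _ _ _ _ H1 H2).
replace v with (/ RtoC (2 * PI) * (RtoC (2 * PI) * v))%C by (field; apply two_pi_nz).
rewrite E; field; apply two_pi_nz.
Qed.

Lemma is_mean_bound (f : C -> C) (rho m : R) (v : C) : 0 <= rho ->
  (forall z, Cmod z = rho -> Cmod (f z) <= m) -> is_mean f rho v -> Cmod v <= m.
Proof.
intros Hr H Hv.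
assert (P := two_pi_pos).
apply (is_CRInt_bound _ _ _ m) in Hv; [|lra|].
- rewrite Cmod_mult, Cmod_R, Rabs_right in Hv by lra.
  apply (Rmult_le_reg_l (2 * PI)); lra.
- intros t _; apply H; now apply Cmod_real_cis.
Qed.

Lemma is_mean_plus (f g : C -> C) (rho : R) (v w : C) :
  is_mean f rho v -> is_mean g rho w -> is_mean (fun z => f z + g z)%C rho (v + w).
Proof.
intros; unfold is_mean; rewrite Cmult_plus_distr_l; now apply is_CRInt_plus.
Qed.

Lemma is_mean_mult (f : C -> C) (rho : R) (c v : C) :
  is_mean f rho v -> is_mean (fun z => c * f z)%C rho (c * v).
Proof.
intros H; unfold is_mean.
replace (RtoC (2 * PI) * (c * v))%C with (c * (RtoC (2 * PI) * v))%C by ring.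
now apply (is_CRInt_mult (fun t => f (RtoC rho * cis t)%C)).
Qed.

Lemma is_mean_minus (f g : C -> C) (rho : R) (v w : C) :
  is_mean f rho v -> is_mean g rho w -> is_mean (fun z => f z - g z)%C rho (v - w).
Proof.
intros; unfold is_mean.
replace (RtoC (2 * PI) * (v - w))%C with (RtoC (2 * PI) * v - RtoC (2 * PI) * w)%C by ring.
now apply is_CRInt_minus.
Qed.

Lemma is_mean_ext (f g : C -> C) (rho : R) (v : C) : 0 <= rho ->
  (forall z, Cmod z = rho -> f z = g z) -> is_mean f rho v -> is_mean g rho v.
Proof.
intros Hr H Hv; unfold is_mean.
apply (is_RInt_ext (V := C_R_CompleteNormedModule) (fun t => f (RtoC rho * cis t)%C)); [|easy].
intros t _; apply H; now apply Cmod_real_cis.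
Qed.

Lemma is_mean_const (c : C) (rho : R) : is_mean (fun _ => c) rho c.
Proof.
assert (E := is_RInt_const (V := C_R_CompleteNormedModule) 0 (2 * PI) c).
unfold is_mean.
replace (RtoC (2 * PI) * c)%C with (scal (V := C_R_CompleteNormedModule) (2 * PI - 0) c); [easy|].
destruct c as [x y].
change (((2 * PI - 0) * x, (2 * PI - 0) * y)%R = RtoC (2 * PI) * (x, y))%C.
apply injective_projections; simpl; ring.
Qed.

Lemma ex_mean (f : C -> C) (rho : R) : 0 <= rho ->
  (forall z, Cmod z = rho -> ccont f z) -> exists v, is_mean f rho v.
Proof.
intros Hr H; assert (P := two_pi_pos).
destruct (ex_CRInt_rcont (fun t => f (RtoC rho * cis t)%C) 0 (2 * PI)) as [v Hv]; [lra| |].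
- intros t _ eps He.
  destruct (H (RtoC rho * cis t)%C (Cmod_real_cis _ _ Hr) eps He) as [d [Pd Q]].
  destruct (cis_cont t (d / (1 + rho))) as [d' [P' Q']]; [apply Rdiv_lt_0_compat; lra|].
  exists d'; split; [easy|]; intros x Hx; apply Q.
  replace (RtoC rho * cis x - RtoC rho * cis t)%C with (RtoC rho * (cis x - cis t))%C by ring.
  rewrite Cmod_mult, Cmod_R, Rabs_right by lra.
  specialize (Q' x Hx).
  assert (X := Cmod_ge_0 (cis x - cis t)).
  apply Rle_lt_trans with ((1 + rho) * Cmod (cis x - cis t)); [nra|].
  apply Rlt_le_trans with ((1 + rho) * (d / (1 + rho))); [apply Rmult_lt_compat_l; lra|].
  right; field; lra.
- exists (/ RtoC (2 * PI) * v)%C; unfold is_mean.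
  rewrite Cmult_assoc, Cinv_r, Cmult_1_l; [easy|apply two_pi_nz].
Qed.

(* In the coordinates [z = e^(s + i t)] the annulus becomes a rectangle whose two
   horizontal sides contribute the same integral. *)
Lemma is_mean_annulus (f : C -> C) (rho1 rho2 : R) (v w : C) : 0 < rho1 < rho2 ->
  (forall z, rho1 <= Cmod z <= rho2 -> exists l, cdiff f z l) ->
  is_mean f rho1 v -> is_mean f rho2 w -> v = w.
Proof.
intros Hr H Hv Hw.
assert (P := two_pi_pos).
set (F := fun s t => f (polar s t)).
assert (L : ln rho1 < ln rho2) by (apply ln_increasing; lra).
assert (Hol : holo_on F (ln rho1) (ln rho2) 0 (2 * PI)).
{ intros s t Hs _.
  destruct (H (polar s t)) as [l Hl].
  - rewrite Cmod_polar, <- (exp_ln rho1), <- (exp_ln rho2) by lra.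
    split; apply exp_monotone; lra.
  - now apply diff2_polar with l. }
assert (B : is_bd F (ln rho1) (ln rho2) 0 (2 * PI)
   (Ci * (RtoC (2 * PI) * w - RtoC (2 * PI) * v) - 0)%C).
{ exists (RtoC (2 * PI) * w - RtoC (2 * PI) * v)%C, 0%C; split; [|split; [|ring]].
  - unfold F, polar; rewrite !exp_ln by lra.
    now apply (is_CRInt_minus (fun t => f (RtoC rho2 * cis t)%C)
      (fun t => f (RtoC rho1 * cis t)%C)).
  - apply (is_RInt_ext (V := C_R_CompleteNormedModule) (fun _ => RtoC 0)).
    + intros s _; change (RtoC 0 = f (polar s (2 * PI)) - f (polar s 0))%C.
      replace (polar s (2 * PI)) with (polar s 0); [ring|].
      unfold polar, cis; now rewrite cos_2PI, sin_2PI, cos_0, sin_0.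
    + assert (E := is_RInt_const (V := C_R_CompleteNormedModule) (ln rho1) (ln rho2) (RtoC 0)).
      assert (Z : scal (V := C_R_CompleteNormedModule) (ln rho2 - ln rho1) (RtoC 0) = RtoC 0).
      { change (((ln rho2 - ln rho1) * 0, (ln rho2 - ln rho1) * 0)%R = RtoC 0)%C.
        apply injective_projections; simpl; ring. }
      exact (eq_ind _ (is_CRInt (fun _ => RtoC 0) (ln rho1) (ln rho2)) E _ Z). }
apply goursat in B; [|easy|easy|easy].
assert (E : (w - v)%C = 0%C).
{ replace (w - v)%C with (/ (Ci * RtoC (2 * PI))
    * (Ci * (RtoC (2 * PI) * w - RtoC (2 * PI) * v) - 0))%C.
  - rewrite B; ring.
  - field; split; [apply two_pi_nz|apply Ci_nz]. }
symmetry; now apply Ceq_minus.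
Qed.

Lemma circle_unif (f : C -> C) (rho0 eps : R) : 0 <= rho0 -> 0 < eps ->
  (forall z, Cmod z = rho0 -> ccont f z) ->
  exists delta, 0 < delta /\ forall rho t, Rabs (rho - rho0) < delta ->
    0 <= t <= 2 * PI ->
    Cmod (f (RtoC rho * cis t)%C - f (RtoC rho0 * cis t)%C) < eps.
Proof.
intros Hr He H.
assert (L : forall t, exists d : posreal, forall rho x,
  Rabs (rho - rho0) < d -> Rabs (x - t) < d ->
  Cmod (f (RtoC rho * cis x)%C - f (RtoC rho0 * cis x)%C) < eps).
{ intros t.
  destruct (H (RtoC rho0 * cis t)%C (Cmod_real_cis _ _ Hr) (eps / 2)) as [d [Pd Q]]; [lra|].
  destruct (cis_cont t (d / (2 * (1 + rho0)))) as [d' [P' Q']];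
    [apply Rdiv_lt_0_compat; lra|].
  assert (M : 0 < Rmin (d / 2) d') by (apply Rmin_pos; lra).
  exists (mkposreal _ M); simpl; intros rho x H1 H2.
  specialize (Q' x (Rlt_le_trans _ _ _ H2 (Rmin_r _ _))).
  assert (H3 := Rlt_le_trans _ _ _ H1 (Rmin_l _ _)).
  assert (X := Cmod_ge_0 (cis x - cis t)).
  assert (N : rho0 * Cmod (cis x - cis t) < d / 2).
  { apply Rle_lt_trans with ((1 + rho0) * Cmod (cis x - cis t)); [nra|].
    apply Rlt_le_trans with ((1 + rho0) * (d / (2 * (1 + rho0))));
      [apply Rmult_lt_compat_l; lra|].
    right; field; lra. }
  assert (N2 : Cmod (RtoC rho0 * cis x - RtoC rho0 * cis t) < d / 2).
  { replace (RtoC rho0 * cis x - RtoC rho0 * cis t)%C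
      with (RtoC rho0 * (cis x - cis t))%C by ring.
    rewrite Cmod_mult, Cmod_R, Rabs_right; lra. }
  assert (N3 : Cmod (RtoC rho * cis x - RtoC rho0 * cis x) < d / 2).
  { replace (RtoC rho * cis x - RtoC rho0 * cis x)%C
      with (RtoC (rho - rho0) * cis x)%C by (rewrite RtoC_minus; ring).
    rewrite Cmod_mult, Cmod_R, Cmod_cis; lra. }
  assert (A := Q (RtoC rho0 * cis x)%C ltac:(lra)).
  assert (B : Cmod (f (RtoC rho * cis x)%C - f (RtoC rho0 * cis t)%C) < eps / 2).
  { apply Q; eapply Rle_lt_trans; [apply (Cmod_sub_tri _ (RtoC rho0 * cis x))|lra]. }
  eapply Rle_lt_trans; [apply (Cmod_sub_tri _ (f (RtoC rho0 * cis t)%C))|].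
  rewrite (Cmod_sub_sym (f (RtoC rho0 * cis t)%C)); lra. }
set (dl := fun t => proj1_sig (constructive_indefinite_description _ (L t))).
(* The compactness of [[0, 2 pi]] yields, under a double negation, a point [u] whose gauge covers
   [t]. This is enough because the strict inequality to be proved can be decided first. *)
destruct (compactness_value_1d 0 (2 * PI) dl) as [d Hd].
exists d; split; [apply cond_pos|]; intros rho t Hrho Ht.
destruct (Rlt_le_dec (Cmod (f (RtoC rho * cis t)%C - f (RtoC rho0 * cis t)%C)) eps) as [Y|Y];
  [easy|exfalso].
apply (Hd t Ht); intros [u [_ [Hu Hdu]]].
assert (Z : forall rho x, Rabs (rho - rho0) < dl u -> Rabs (x - u) < dl u ->
  Cmod (f (RtoC rho * cis x)%C - f (RtoC rho0 * cis x)%C) < eps)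
  by exact (proj2_sig (constructive_indefinite_description _ (L u))).
specialize (Z rho t (Rlt_le_trans _ _ _ Hrho Hdu) Hu); lra.
Qed.

(** Uniform continuity between nearby circles makes the mean a continuous function of the radius.
    This lets a mean cross a circle, or reach the centre, where [f] is only known to be
    continuous. *)
Lemma is_mean_limit (f : C -> C) (rho0 : R) (v : C) : 0 <= rho0 ->
  (forall z, Cmod z = rho0 -> ccont f z) ->
  (forall delta, 0 < delta -> exists rho, Rabs (rho - rho0) < delta /\ is_mean f rho v) ->
  is_mean f rho0 v.
Proof.
intros Hr H Hlim.
destruct (ex_mean f rho0 Hr H) as [w Hw].
replace v with w; [easy|].
symmetry; apply Ceq_minus, Cmod_small_0; intros eps He.
destruct (circle_unif f rho0 eps Hr He H) as [d [Pd Q]].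
destruct (Hlim d Pd) as [rho [H1 Hv]].
assert (P := two_pi_pos).
assert (D := is_CRInt_minus _ _ _ _ _ _ Hv Hw).
apply (is_CRInt_bound _ _ _ eps) in D; [|lra|].
- replace (RtoC (2 * PI) * v - RtoC (2 * PI) * w)%C with (RtoC (2 * PI) * (v - w))%C in D by ring.
  rewrite Cmod_mult, Cmod_R, Rabs_right in D by lra.
  apply (Rmult_le_reg_l (2 * PI)); lra.
- intros t Ht; apply Rlt_le; now apply Q.
Qed.

(** All radii in [(0, b]] give the same mean, and letting the radius tend to 0 identifies it with
    [f 0]; the limit uses continuity at 0. *)
Lemma mean_value (f : C -> C) (b : R) : 0 < b -> ccont f 0 ->
  (forall z, 0 < Cmod z <= b -> exists l, cdiff f z l) -> is_mean f b (f 0%C).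
Proof.
intros Hb H0 H.
assert (Hc : forall z, 0 < Cmod z <= b -> ccont f z).
{ intros z Hz; destruct (H z Hz) as [l Hl]; now apply cdiff_ccont with l. }
destruct (ex_mean f b) as [v Hv]; [lra|intros; apply Hc; lra|].
replace (f 0%C) with v; [easy|].
apply (is_mean_unique f 0).
- apply is_mean_limit; [lra| |].
  + intros z Hz; apply Cmod_eq_0 in Hz; now subst z.
  + intros d Hd.
    assert (M : 0 < Rmin d b) by now apply Rmin_pos.
    assert (M1 := Rmin_l d b); assert (M2 := Rmin_r d b).
    exists (Rmin d b / 2); split; [rewrite Rminus_0_r, Rabs_right; lra|].
    destruct (ex_mean f (Rmin d b / 2)) as [w Hw]; [lra|intros; apply Hc; lra|].
    replace v with w; [easy|].
    apply (is_mean_annulus f (Rmin d b / 2) b); [lra|intros; apply H; lra|easy|easy].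
- apply (is_RInt_ext (V := C_R_CompleteNormedModule) (fun _ => f 0%C)).
  + intros t _; now rewrite Cmult_0_l.
  + apply (is_mean_const (f 0%C) 0).
Qed.

(** The mean is constant on either side of the circle of radius [a], and continuity glues the two
    values. It is meant for a difference quotient taken at a point of modulus [a], continuous there
    but not yet known to be differentiable. *)
Lemma mean_value_exceptional (f : C -> C) (a b : R) : 0 < a < b ->
  (forall z, Cmod z <= b -> ccont f z) ->
  (forall z, Cmod z <= b -> Cmod z <> a -> exists l, cdiff f z l) ->
  is_mean f b (f 0%C).
Proof.
intros Hab Hc H.
assert (Ha : is_mean f a (f 0%C)).
{ apply is_mean_limit; [lra|intros; apply Hc; lra|].
  intros d Hd.
  assert (M : 0 < Rmin d a) by (apply Rmin_pos; lra).
  assert (M1 := Rmin_l d a); assert (M2 := Rmin_r d a).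
  exists (a - Rmin d a / 2); split.
  - replace (a - Rmin d a / 2 - a) with (- (Rmin d a / 2)) by ring.
    rewrite Rabs_Ropp, Rabs_right; lra.
  - apply mean_value; [lra|apply Hc; rewrite Cmod_0; lra|intros; apply H; lra]. }
destruct (ex_mean f b) as [v Hv]; [lra|intros; apply Hc; lra|].
replace (f 0%C) with v; [easy|].
apply (is_mean_unique f a); [|easy].
apply is_mean_limit; [lra|intros; apply Hc; lra|].
intros d Hd.
assert (M : 0 < Rmin d (b - a)) by (apply Rmin_pos; lra).
assert (M1 := Rmin_l d (b - a)); assert (M2 := Rmin_r d (b - a)).
exists (a + Rmin d (b - a) / 2); split.
- replace (a + Rmin d (b - a) / 2 - a) with (Rmin d (b - a) / 2) by ring.
  rewrite Rabs_right; lra.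
- destruct (ex_mean f (a + Rmin d (b - a) / 2)) as [w Hw]; [lra|intros; apply Hc; lra|].
  replace v with w; [easy|].
  apply (is_mean_annulus f (a + Rmin d (b - a) / 2) b);
    [lra|intros; apply H; lra|easy|easy].
Qed.

Lemma Cneq_of_Cmod (z w : C) : Cmod z <> Cmod w -> z <> w.
Proof. now intros H ->. Qed.

Lemma cdiff_minus_const (f : C -> C) (z l c : C) :
  cdiff f z l -> cdiff (fun w => f w - c)%C z l.
Proof.
intros H; replace l with (l + 0)%C by ring.
apply (cdiff_plus f (fun _ => - c)%C); [easy|apply cdiff_const].
Qed.

Lemma cdiff_div (f g : C -> C) (z a b : C) : cdiff f z a -> cdiff g z b -> g z <> 0%C ->
  exists l, cdiff (fun w => f w / g w)%C z l.
Proof.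
intros Hf Hg N; eexists; apply (cdiff_mult f (fun w => / g w)%C); [apply Hf|].
now apply cdiff_inv with (a := b).
Qed.

Lemma slope_cdiff (f : C -> C) (z l w a : C) : w <> z -> cdiff f w a ->
  exists m, cdiff (slope f z l) w m.
Proof.
intros N H.
destruct (cdiff_div (fun x => f x - f z)%C (fun x => x - z)%C w a 1) as [m Hm].
- now apply cdiff_minus_const.
- apply cdiff_minus_const, cdiff_id.
- now apply Cminus_eq_contra.
- exists m; apply cdiff_ext_loc with (fun x => (f x - f z) / (x - z))%C (Cmod (w - z)); [| |easy].
  + now apply Cmod_gt_0, Cminus_eq_contra.
  + intros x Hx; unfold slope; destruct (Ceq_dec x z) as [->|]; [|easy].
    rewrite (Cmod_sub_sym z) in Hx; lra.
Qed.

(** Write the kernel as [1 + z0 / (z - z0)]. The mean of the second term does not depend on the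
    radius and tends to 0 as the circle grows. *)
Lemma is_mean_kernel (z0 : C) (b : R) : Cmod z0 < b ->
  is_mean (fun z => z / (z - z0))%C b 1.
Proof.
intros Hb; assert (P0 := Cmod_ge_0 z0).
set (g := fun z => (z0 / (z - z0))%C).
assert (Hg : forall z, b <= Cmod z -> exists l, cdiff g z l).
{ intros z Hz; apply (cdiff_div (fun _ => z0) (fun z => z - z0)%C z 0 1).
  - apply cdiff_const.
  - apply cdiff_minus_const, cdiff_id.
  - apply Cminus_eq_contra, Cneq_of_Cmod; lra. }
assert (Hc : forall z, b <= Cmod z -> ccont g z).
{ intros z Hz; destruct (Hg z Hz) as [l Hl]; now apply cdiff_ccont with l. }
destruct (ex_mean g b) as [v Hv]; [lra|intros; apply Hc; lra|].
assert (Z : v = 0%C).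
{ apply Cmod_small_0; intros eps He.
  (* On this circle the distance to [z0] exceeds [Cmod z0 / eps], because [Cmod z0 < b]. *)
  set (rho := b + Cmod z0 / eps + 1).
  assert (Q : 0 <= Cmod z0 / eps).
  { apply Rmult_le_pos; [easy|now apply Rlt_le, Rinv_0_lt_compat]. }
  destruct (ex_mean g rho) as [w Hw]; [unfold rho; lra|
    intros; apply Hc; unfold rho in *; lra|].
  replace v with w.
  - apply (is_mean_bound g rho); [unfold rho; lra| |easy].
    intros z Hz; unfold g.
    assert (N : z <> z0) by (apply Cneq_of_Cmod; unfold rho in Hz; lra).
    assert (T := Cmod_le_sub z z0).
    rewrite Cmod_div by now apply Cminus_eq_contra.
    assert (D : Cmod z0 / eps < Cmod (z - z0)) by (unfold rho in Hz; lra).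
    apply (Rmult_le_reg_r (Cmod (z - z0))); [lra|].
    unfold Rdiv at 1; rewrite Rmult_assoc, Rinv_l, Rmult_1_r by lra.
    apply (Rmult_lt_compat_l eps) in D; [|easy].
    replace (eps * (Cmod z0 / eps)) with (Cmod z0) in D by (field; lra); lra.
  - symmetry; apply (is_mean_annulus g b rho); [unfold rho; lra| |easy|easy].
    intros z Hz; apply Hg; lra. }
subst v.
replace (RtoC 1) with (1 + 0)%C by ring.
apply (is_mean_ext (fun z => 1 + g z)%C); [lra| |].
- intros z Hz; unfold g; field; apply Cminus_eq_contra, Cneq_of_Cmod; lra.
- apply (is_mean_plus (fun _ => RtoC 1)); [apply is_mean_const|easy].
Qed.

(** Away from [z0] the integrand is [slope f z0 l z * z + f z0 * (z / (z - z0))]. The first summand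
    vanishes at 0, hence has mean 0 by the mean value property with exceptional circle through [z0];
    the kernel gives [f z0]. *)
Lemma cauchy_formula (f : C -> C) (z0 : C) (b : R) : Cmod z0 < b ->
  (forall z, Cmod z <= b -> exists l, cdiff f z l) ->
  is_mean (fun z => f z * (z / (z - z0)))%C b (f z0).
Proof.
intros Hb H; assert (P0 := Cmod_ge_0 z0).
assert (Hc : forall z, Cmod z <= b -> ccont f z).
{ intros z Hz; destruct (H z Hz) as [l Hl]; now apply cdiff_ccont with l. }
(* For [z0 = 0] the exceptional circle would have radius 0; the formula is then the mean value
   property itself. *)
destruct (Ceq_dec z0 0) as [->|N].
- apply (is_mean_ext f); [rewrite Cmod_0 in Hb; lra| |].
  + intros z Hz; field.
    replace (z - 0)%C with z by ring.
    apply Cneq_of_Cmod; rewrite Cmod_0 in *; lra.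
  + apply mean_value; [rewrite Cmod_0 in Hb; lra|apply Hc; lra|].
    intros; apply H; lra.
- assert (Pz : 0 < Cmod z0) by now apply Cmod_gt_0.
  destruct (H z0) as [l Hl]; [lra|].
  set (h := fun z => (slope f z0 l z * z)%C).
  assert (Hh : forall z, Cmod z <= b -> z <> z0 -> exists m, cdiff h z m).
  { intros z Hz Nz; destruct (H z Hz) as [a Ha].
    destruct (slope_cdiff f z0 l z a Nz Ha) as [m Hm].
    eexists; apply cdiff_mult; [apply Hm|apply cdiff_id]. }
  assert (M : is_mean h b (h 0%C)).
  { apply mean_value_exceptional with (Cmod z0); [lra| |].
    - intros z Hz; destruct (Ceq_dec z z0) as [->|Nz].
      + apply ccont_mult; [now apply slope_ccont|apply ccont_id].
      + destruct (Hh z Hz Nz) as [m Hm]; now apply cdiff_ccont with m.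
    - intros z Hz Nz; apply Hh; [easy|now intros ->]. }
  replace (f z0) with (h 0 + f z0 * 1)%C by (unfold h; ring).
  apply (is_mean_ext (fun z => h z + f z0 * (z / (z - z0)))%C); [lra| |].
  + intros z Hz; unfold h.
    assert (Nz : (z - z0)%C <> 0%C) by (apply Cminus_eq_contra, Cneq_of_Cmod; lra).
    replace (f z) with (slope f z0 l z * (z - z0) + f z0)%C by (rewrite <- slope_eq; ring).
    now field.
  + apply is_mean_plus; [easy|apply is_mean_mult, is_mean_kernel; lra].
Qed.

(** * Taylor coefficients of entire functions *)

Definition centire (f : C -> C) : Prop := forall z, exists l, cdiff f z l.

Lemma entire_centire (f : C -> C) : entire f <-> centire f.
Proof.
split; intros H z; destruct (H z) as [l Hl]; exists l; now apply is_derive_cdiff.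
Qed.

Lemma centire_ccont (f : C -> C) (z : C) : centire f -> ccont f z.
Proof. intros H; destruct (H z) as [l Hl]; now apply cdiff_ccont with l. Qed.

(** Cauchy's integral for the [n]-th Taylor coefficient at 0, required for all radii at once so that
    estimates may choose the radius. *)
Definition is_tcoef (f : C -> C) (n : nat) (c : C) : Prop :=
  forall rho, 0 < rho -> is_mean (fun z => f z / z ^ n)%C rho c.

Lemma ex_tcoef (f : C -> C) (n : nat) : centire f -> exists c, is_tcoef f n c.
Proof.
intros H.
assert (Hd : forall z, 0 < Cmod z -> exists l, cdiff (fun z => f z / z ^ n)%C z l).
{ intros z Hz; destruct (H z) as [a Ha], (cdiff_pow n z) as [b Hb].
  apply (cdiff_div f (fun z => z ^ n)%C z a b Ha Hb).
  apply Cpow_nz, Cneq_of_Cmod; rewrite Cmod_0; lra. }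
assert (Hc : forall z, 0 < Cmod z -> ccont (fun z => f z / z ^ n)%C z).
{ intros z Hz; destruct (Hd z Hz) as [l Hl]; now apply cdiff_ccont with l. }
destruct (ex_mean (fun z => f z / z ^ n)%C 1) as [c Hc1]; [lra|intros; apply Hc; lra|].
exists c; intros rho Hr.
destruct (ex_mean (fun z => f z / z ^ n)%C rho) as [w Hw]; [lra|intros; apply Hc; lra|].
replace c with w; [easy|].
destruct (Rtotal_order rho 1) as [L|[->|L]].
- apply (is_mean_annulus _ _ _ _ _ (conj Hr L)) with (2 := Hw) (3 := Hc1).
  intros; apply Hd; lra.
- now apply (is_mean_unique _ _ _ _ Hw).
- symmetry; apply (is_mean_annulus _ _ _ _ _ (conj Rlt_0_1 L)) with (2 := Hc1) (3 := Hw).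
  intros; apply Hd; lra.
Qed.

Definition tcoef (f : C -> C) (n : nat) : C :=
  epsilon (inhabits (RtoC 0)) (is_tcoef f n).

Lemma tcoef_spec (f : C -> C) (n : nat) : centire f -> is_tcoef f n (tcoef f n).
Proof. intros H; unfold tcoef; apply epsilon_spec; now apply ex_tcoef. Qed.

Lemma cauchy_estimate (f : C -> C) (n : nat) (rho m : R) : centire f -> 0 < rho ->
  (forall z, Cmod z = rho -> Cmod (f z) <= m) -> Cmod (tcoef f n) * rho ^ n <= m.
Proof.
intros Hf Hr H.
assert (Pn : 0 < rho ^ n) by now apply pow_lt.
assert (B := is_mean_bound (fun z => f z / z ^ n)%C rho (m / rho ^ n) (tcoef f n)
  (Rlt_le _ _ Hr)).
apply (Rmult_le_reg_r (/ rho ^ n)); [now apply Rinv_0_lt_compat|].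
rewrite Rmult_assoc, Rinv_r, Rmult_1_r by lra.
apply B; [|now apply tcoef_spec].
intros z Hz; rewrite Cmod_div, Cmod_pow, Hz.
- apply Rmult_le_compat_r; [now apply Rlt_le, Rinv_0_lt_compat|now apply H].
- apply Cpow_nz, Cneq_of_Cmod; rewrite Cmod_0; lra.
Qed.

Lemma circle_param (z : C) (rho : R) : Cmod z = rho ->
  exists t, 0 <= t <= 2 * PI /\ z = (RtoC rho * cis t)%C.
Proof.
intros Hz; assert (P := two_pi_pos); assert (Hr := Cmod_ge_0 z); rewrite Hz in Hr.
destruct (Req_dec rho 0) as [->|Nr].
- exists 0; split; [lra|]; apply Cmod_eq_0 in Hz; rewrite Hz; ring.
- assert (E : (fst z / rho)² + (snd z / rho)² = 1).
  { assert (S : Cmod z ^ 2 = fst z ^ 2 + snd z ^ 2) by apply Cmod2_alt.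
    rewrite Hz in S; unfold Rsqr.
    replace (fst z / rho * (fst z / rho) + snd z / rho * (snd z / rho))
      with ((fst z ^ 2 + snd z ^ 2) / rho ^ 2) by (field; easy).
    rewrite <- S; field; easy. }
  set (x := fst z / rho) in *; set (y := snd z / rho) in *.
  unfold Rsqr in E.
  assert (Bx : -1 <= x <= 1) by nra.
  assert (Z : forall t, cos t = x -> sin t = y -> z = (RtoC rho * cis t)%C).
  { intros t Ec Es; unfold cis; rewrite Ec, Es; unfold x, y.
    destruct z as [z1 z2]; apply injective_projections; simpl; field; easy. }
  assert (Ba := acos_bound x).
  destruct (Rle_lt_dec 0 y) as [Hy|Hy].
  + exists (acos x); split; [lra|]; apply Z; [now apply cos_acos|].
    rewrite sin_acos by easy.
    apply Rsqr_inj; [apply sqrt_pos|easy|].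
    rewrite Rsqr_sqrt; unfold Rsqr; nra.
  + exists (2 * PI - acos x); split; [lra|].
    apply Z.
    * rewrite cos_minus, cos_2PI, sin_2PI, cos_acos by easy; ring.
    * rewrite sin_minus, cos_2PI, sin_2PI, sin_acos by easy.
      assert (W : sqrt (1 - x²) = - y); [|lra].
      apply Rsqr_inj; [apply sqrt_pos|lra|].
      rewrite Rsqr_sqrt; unfold Rsqr; nra.
Qed.

(** A Riemann integrable function is bounded, so the existence of the mean already supplies the
    bound. *)
Lemma circle_bounded (f : C -> C) (rho : R) : centire f -> 0 <= rho ->
  exists m, forall z, Cmod z = rho -> Cmod (f z) <= m.
Proof.
intros Hf Hr; assert (P := two_pi_pos).
destruct (ex_mean f rho Hr) as [v Hv]; [intros; now apply centire_ccont|].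
destruct (ex_RInt_ub (V := C_R_CompleteNormedModule) (fun t => f (RtoC rho * cis t)%C)
  0 (2 * PI)) as [m Hm]; [now exists (RtoC (2 * PI) * v)%C|].
rewrite Rmin_left, Rmax_right in Hm by lra.
exists m; intros z Hz.
destruct (circle_param z rho Hz) as [t [Ht ->]].
rewrite <- norm_CR; now apply Hm.
Qed.

Notation is_Cseries := (is_series (K := C_AbsRing) (V := C_NormedModule)).

(** Partial sums with exactly [n] terms, whereas [sum_n a n] has [n + 1]; the empty sum is the base
    case of the inductions. *)
Fixpoint psum (a : nat -> C) (n : nat) : C :=
  match n with O => 0%C | S n => (psum a n + a n)%C end.

Lemma psum_sum_n (a : nat -> C) (n : nat) :
  psum a (S n) = sum_n (G := C_AbelianMonoid) a n.
Proof.
induction n as [|n IH].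
- rewrite sum_O; simpl; ring.
- rewrite sum_Sn, <- IH; reflexivity.
Qed.

Lemma is_Cseries_psum (a : nat -> C) (l : C) :
  is_Cseries a l <->
  forall eps, 0 < eps -> exists N, forall n, (N <= n)%nat -> Cmod (psum a n - l) < eps.
Proof.
split.
- intros H eps He.
  destruct (H (fun x => Cmod (x - l) < eps)) as [N HN].
  + exists (mkposreal (eps / 2) ltac:(simpl; lra)); intros x Bx; now apply Cmod_C_ball.
  + exists (S N); intros [|n] Hn; [lia|].
    rewrite psum_sum_n; apply HN; lia.
- intros H P [e He].
  destruct (H e (cond_pos e)) as [N HN]; exists N; intros n Hn.
  apply He, C_ball_Cmod.
  change (Cmod (sum_n (G := C_AbelianMonoid) a n - l)%C < e).
  rewrite <- psum_sum_n; apply HN; lia.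
Qed.

Lemma geom_small (q m eps : R) : 0 <= q < 1 -> 0 <= m -> 0 < eps ->
  exists N, forall n, (N <= n)%nat -> m * q ^ n < eps.
Proof.
intros Hq Hm He.
destruct (pow_lt_1_zero q ltac:(rewrite Rabs_right; lra) (eps / (m + 1))
  ltac:(apply Rdiv_lt_0_compat; lra)) as [N HN].
exists N; intros n Hn; specialize (HN n Hn).
assert (Pq : 0 <= q ^ n) by (apply pow_le; lra).
rewrite Rabs_right in HN by lra.
apply (Rmult_lt_compat_l (m + 1)) in HN; [|lra].
replace ((m + 1) * (eps / (m + 1))) with eps in HN by (field; lra); nra.
Qed.

(** Expanding the Cauchy kernel as a geometric series in [z0 / z] shows that the remainder after [n]
    terms is the mean of [f z * (z0 / z) ^ n * (z / (z - z0))], which decays geometrically. *)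
Lemma taylor (f : C -> C) (z0 : C) : centire f ->
  is_Cseries (fun n => tcoef f n * z0 ^ n)%C (f z0).
Proof.
intros Hf; assert (P0 := Cmod_ge_0 z0).
(* On this circle [z - z0] has modulus at least 1 and the ratio [Cmod z0 / b] is below 1. *)
set (b := Cmod z0 + 1).
destruct (circle_bounded f b Hf) as [m Hm]; [unfold b; lra|].
assert (R0 : forall n, is_mean (fun z => f z * ((z0 / z) ^ n * (z / (z - z0))))%C b
   (f z0 - psum (fun n => tcoef f n * z0 ^ n) n)%C).
{ assert (Nz : forall z, Cmod z = b -> z <> 0%C)
    by (intros z Hz; apply Cneq_of_Cmod; rewrite Cmod_0; unfold b in Hz; lra).
  assert (Nz0 : forall z, Cmod z = b -> (z - z0)%C <> 0%C)
    by (intros z Hz; apply Cminus_eq_contra, Cneq_of_Cmod; unfold b in Hz; lra).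
  induction n as [|n IH].
  - simpl; replace (f z0 - 0)%C with (f z0) by ring.
    apply (is_mean_ext (fun z => f z * (z / (z - z0)))%C); [unfold b; lra| |].
    + intros z Hz; simpl; field; auto.
    + apply cauchy_formula; [unfold b; lra|]; intros; apply Hf.
  - simpl psum.
    replace (f z0 - (psum (fun n => tcoef f n * z0 ^ n) n + tcoef f n * z0 ^ n))%C
      with ((f z0 - psum (fun n => tcoef f n * z0 ^ n) n) - z0 ^ n * tcoef f n)%C by ring.
    apply (is_mean_ext (fun z => f z * ((z0 / z) ^ n * (z / (z - z0)))
       - z0 ^ n * (f z / z ^ n))%C); [unfold b; lra| |].
    + intros z Hz; rewrite Cpow_S.
      unfold Cdiv; rewrite !Cpow_mult_l, Cpow_inv by auto.
      field; repeat split; auto; now apply Cpow_nz, Nz.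
    + apply is_mean_minus; [easy|].
      apply (is_mean_mult (fun z => f z / z ^ n)%C).
      apply tcoef_spec; [easy|unfold b; lra]. }
assert (Pm : 0 <= m).
{ eapply Rle_trans; [apply Cmod_ge_0|].
  apply (Hm (RtoC b)); rewrite Cmod_R, Rabs_right; unfold b; lra. }
apply is_Cseries_psum; intros eps He.
destruct (geom_small (Cmod z0 / b) (m * b) eps) as [N HN]; try (unfold b; nra).
{ split.
  - apply Rmult_le_pos; [easy|apply Rlt_le, Rinv_0_lt_compat; unfold b; lra].
  - apply (Rmult_lt_reg_r b); [unfold b; lra|].
    unfold Rdiv; rewrite Rmult_assoc, Rinv_l; unfold b; lra. }
exists N; intros n Hn; rewrite Cmod_sub_sym.
eapply Rle_lt_trans; [|apply (HN n Hn)].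
apply (is_mean_bound _ b) with (3 := R0 n); [unfold b; lra|].
intros z Hz.
assert (Nz : z <> 0%C) by (apply Cneq_of_Cmod; rewrite Cmod_0; unfold b in Hz; lra).
assert (Nz0 : (z - z0)%C <> 0%C)
  by (apply Cminus_eq_contra, Cneq_of_Cmod; unfold b in Hz; lra).
rewrite !Cmod_mult, Cmod_pow, !Cmod_div, Hz by easy.
assert (D : 1 <= Cmod (z - z0)).
{ assert (T := Cmod_le_sub z z0); unfold b in Hz; lra. }
assert (Q : 0 <= (Cmod z0 / b) ^ n).
{ apply pow_le, Rmult_le_pos; [easy|apply Rlt_le, Rinv_0_lt_compat; unfold b; lra]. }
assert (I : b / Cmod (z - z0) <= b).
{ rewrite <- (Rdiv_1_r b) at 2; apply Rmult_le_compat_l; [unfold b; lra|].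
  apply Rinv_le_contravar; lra. }
replace (m * b * (Cmod z0 / b) ^ n) with (m * ((Cmod z0 / b) ^ n * b)) by ring.
apply Rmult_le_compat; [apply Cmod_ge_0| |now apply Hm|].
- apply Rmult_le_pos; [easy|].
  apply Rmult_le_pos; [unfold b; lra|apply Rlt_le, Rinv_0_lt_compat; lra].
- now apply Rmult_le_compat_l.
Qed.

Lemma is_Cseries_unique (a : nat -> C) (l l' : C) :
  is_Cseries a l -> is_Cseries a l' -> l = l'.
Proof.
intros H1 H2; rewrite is_Cseries_psum in H1, H2.
apply Ceq_minus, Cmod_small_0; intros eps He.
destruct (H1 (eps / 2) ltac:(lra)) as [N1 Q1].
destruct (H2 (eps / 2) ltac:(lra)) as [N2 Q2].
specialize (Q1 (N1 + N2)%nat ltac:(lia)); specialize (Q2 (N1 + N2)%nat ltac:(lia)).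
rewrite Cmod_sub_sym in Q1.
eapply Rle_trans; [apply (Cmod_sub_tri _ (psum a (N1 + N2)))|lra].
Qed.

Lemma liouville (f : C -> C) (m : R) : centire f ->
  (forall z, Cmod (f z) <= m) -> forall z, f z = f 0%C.
Proof.
intros Hf Hm.
assert (Z : forall n, tcoef f (S n) = 0%C).
{ intros n; apply Cmod_small_0; intros eps He.
  assert (Pm : 0 <= m) by (eapply Rle_trans; [apply Cmod_ge_0|apply (Hm 0%C)]).
  assert (Q : 0 <= m / eps) by (apply Rmult_le_pos; [easy|now apply Rlt_le, Rinv_0_lt_compat]).
  (* The radius exceeds 1, so its power [S n] is at least the radius. A coefficient larger than
     [eps] would then give [eps + m <= m]. *)
  assert (E := cauchy_estimate f (S n) (1 + m / eps) m Hf ltac:(lra) (fun z _ => Hm z)).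
  assert (P1 : 1 <= (1 + m / eps) ^ n) by (apply pow_R1_Rle; lra).
  assert (P2 : 1 + m / eps <= (1 + m / eps) ^ S n) by (simpl; nra).
  assert (X := Cmod_ge_0 (tcoef f (S n))).
  destruct (Rle_lt_dec (Cmod (tcoef f (S n))) eps) as [L|L]; [easy|exfalso].
  assert (Y : eps * (1 + m / eps) <= m).
  { eapply Rle_trans; [|apply E]; apply Rmult_le_compat; lra. }
  replace (eps * (1 + m / eps)) with (eps + m) in Y by (field; lra); lra. }
assert (E : forall z, f z = tcoef f 0).
{ intros z; apply (is_Cseries_unique _ _ _ (taylor f z Hf)).
  apply is_Cseries_psum; intros eps He; exists 1%nat; intros [|n] Hn; [lia|].
  replace (psum (fun n => tcoef f n * z ^ n)%C (S n)) with (tcoef f 0).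
  - rewrite Cmod_self; lra.
  - clear Hn; induction n as [|n IH]; [simpl; ring|].
    change (psum (fun n => tcoef f n * z ^ n)%C (S (S n)))
      with (psum (fun n => tcoef f n * z ^ n)%C (S n) + tcoef f (S n) * z ^ (S n))%C.
    rewrite <- IH, Z; ring. }
intros z; now rewrite !E.
Qed.

(** * Everywhere convergent power series *)

(** Infinite radius of convergence in terms of bounds instead of sums. A bound at [2 * rho] gives a
    geometric majorant at [rho]. *)
Definition grow (c : nat -> C) : Prop :=
  forall rho, 0 <= rho -> exists m, forall n, Cmod (c n) * rho ^ n <= m.

Definition is_ps (c : nat -> C) (f : C -> C) : Prop :=
  grow c /\ forall z, is_Cseries (fun n => c n * z ^ n)%C (f z).

Lemma is_Cseries_ext (a b : nat -> C) (l : C) :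
  (forall n, a n = b n) -> is_Cseries a l -> is_Cseries b l.
Proof. apply is_series_ext. Qed.

Lemma is_Cseries_plus (a b : nat -> C) (l k : C) :
  is_Cseries a l -> is_Cseries b k -> is_Cseries (fun n => a n + b n)%C (l + k)%C.
Proof.
intros H1 H2.
exact (is_series_plus (K := C_AbsRing) (V := C_NormedModule) a b l k H1 H2).
Qed.

Lemma is_Cseries_scal (c : C) (a : nat -> C) (l : C) :
  is_Cseries a l -> is_Cseries (fun n => c * a n)%C (c * l)%C.
Proof. intros H; exact (is_series_scal (K := C_AbsRing) (V := C_NormedModule) c a l H). Qed.

Lemma is_Cseries_minus (a b : nat -> C) (l k : C) :
  is_Cseries a l -> is_Cseries b k -> is_Cseries (fun n => a n - b n)%C (l - k)%C.
Proof.
intros H1 H2.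
exact (is_series_minus (K := C_AbsRing) (V := C_NormedModule) a b l k H1 H2).
Qed.

Lemma psum_S_l (a : nat -> C) (n : nat) :
  psum a (S n) = (a 0%nat + psum (fun n => a (S n)) n)%C.
Proof.
induction n as [|n IH]; [simpl; ring|].
change (psum a (S (S n))) with (psum a (S n) + a (S n))%C.
rewrite IH; simpl; ring.
Qed.

Lemma is_Cseries_shift (a : nat -> C) (l : C) :
  is_Cseries (fun n => a (S n)) l -> is_Cseries a (a 0%nat + l)%C.
Proof.
rewrite !is_Cseries_psum; intros H eps He; destruct (H eps He) as [N HN].
exists (S N); intros [|n] Hn; [lia|].
rewrite psum_S_l.
replace (a 0%nat + psum (fun n => a (S n)) n - (a 0%nat + l))%C
  with (psum (fun n => a (S n)) n - l)%C by ring.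
apply HN; lia.
Qed.

(** The geometric majorant [m / 2 ^ n] has sum [2 * m]. Estimates of sums of power series all come
    down to this one after doubling the radius. *)
Lemma is_Cseries_bound (a : nat -> C) (l : C) (m : R) :
  (forall n, Cmod (a n) * 2 ^ n <= m) -> is_Cseries a l -> Cmod l <= 2 * m.
Proof.
intros H Hl; rewrite is_Cseries_psum in Hl.
assert (B : forall n, Cmod (psum a n) <= 2 * m - 2 * m / 2 ^ n).
{ induction n as [|n IH].
  - simpl; rewrite Cmod_0; lra.
  - simpl psum; eapply Rle_trans; [apply Cmod_triangle|].
    assert (P := pow_two_gt_0 n).
    assert (X : Cmod (a n) <= m / 2 ^ n).
    { apply (Rmult_le_reg_r (2 ^ n)); [easy|].
      unfold Rdiv; rewrite Rmult_assoc, Rinv_l, Rmult_1_r; [apply H|lra]. }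
    replace (2 * m / 2 ^ S n) with (m / 2 ^ n) by (simpl; field; lra).
    replace (2 * m / 2 ^ n) with (m / 2 ^ n + m / 2 ^ n) in IH by (field; lra).
    lra. }
apply Rnot_lt_le; intros L.
destruct (Hl ((Cmod l - 2 * m) / 2)) as [N HN]; [lra|].
specialize (HN N (le_n N)); specialize (B N).
assert (Pm : 0 <= m).
{ eapply Rle_trans; [|apply (H 0%nat)]; simpl; generalize (Cmod_ge_0 (a 0%nat)); lra. }
assert (Q : 0 <= 2 * m / 2 ^ N).
{ apply Rmult_le_pos; [lra|apply Rlt_le, Rinv_0_lt_compat, pow_two_gt_0]. }
assert (T := Cmod_le_sub l (psum a N)); rewrite Cmod_sub_sym in T; lra.
Qed.

Lemma ps_bound (c : nat -> C) (f : C -> C) (z : C) (rho m : R) :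
  is_ps c f -> Cmod z <= rho -> (forall n, Cmod (c n) * (2 * rho) ^ n <= m) ->
  Cmod (f z) <= 2 * m.
Proof.
intros [_ H] Hz Hm; apply (is_Cseries_bound _ _ _) with (2 := H z).
intros n; eapply Rle_trans; [|apply (Hm n)].
rewrite Cmod_mult, Cmod_pow, Rpow_mult_distr, Rmult_assoc, (Rmult_comm _ (2 ^ n)).
apply Rmult_le_compat_l; [apply Cmod_ge_0|].
apply Rmult_le_compat_l; [apply Rlt_le, pow_two_gt_0|].
apply pow_incr; split; [apply Cmod_ge_0|easy].
Qed.

Lemma ex_ps (c : nat -> C) : grow c -> exists f, is_ps c f.
Proof.
intros Hc.
assert (E : forall z, exists l, is_Cseries (fun n => c n * z ^ n)%C l).
{ intros z; destruct (Hc (2 * Cmod z)) as [m Hm];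
    [apply Rmult_le_pos; [lra|apply Cmod_ge_0]|].
  apply (ex_series_le (K := C_AbsRing) (V := C_CompleteNormedModule)
    (fun n => c n * z ^ n)%C (fun n => scal m ((/ 2) ^ n))).
  - intros n; change (Cmod (c n * z ^ n) <= m * (/ 2) ^ n).
    rewrite Cmod_mult, Cmod_pow.
    specialize (Hm n); rewrite Rpow_mult_distr in Hm.
    assert (P := pow_two_gt_0 n); rewrite pow_inv.
    apply (Rmult_le_reg_r (2 ^ n)); [easy|].
    rewrite (Rmult_assoc m), Rinv_l by lra; lra.
  - apply (ex_series_scal (K := R_AbsRing) (V := R_NormedModule)).
    apply ex_series_geom; rewrite Rabs_right; lra. }
exists (fun z => proj1_sig (constructive_indefinite_description _ (E z))).
split; [easy|]; intros z.
apply (proj2_sig (constructive_indefinite_description _ (E z))).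
Qed.

Lemma INR_le_pow2 (n : nat) : INR n <= 2 ^ n.
Proof.
induction n as [|n IH]; [simpl; lra|].
rewrite S_INR; simpl; assert (1 <= 2 ^ n) by (apply pow_R1_Rle; lra); lra.
Qed.

(** The factor [l ^ n] is absorbed by replacing the radius [rho] with [l * rho]. *)
Lemma grow_dominated (c d : nat -> C) (k l : R) : 0 <= k -> 0 <= l -> grow c ->
  (forall n, Cmod (d n) <= k * l ^ n * Cmod (c n)) -> grow d.
Proof.
intros Hk Hl Hc H rho Hr.
destruct (Hc (l * rho)) as [m Hm]; [now apply Rmult_le_pos|].
exists (k * m); intros n.
specialize (Hm n); rewrite Rpow_mult_distr in Hm.
apply Rle_trans with (k * (Cmod (c n) * (l ^ n * rho ^ n))).
- replace (k * (Cmod (c n) * (l ^ n * rho ^ n)))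
    with (k * l ^ n * Cmod (c n) * rho ^ n) by ring.
  apply Rmult_le_compat_r; [now apply pow_le|easy].
- now apply Rmult_le_compat_l.
Qed.

Lemma grow_plus (c d : nat -> C) : grow c -> grow d -> grow (fun n => c n + d n)%C.
Proof.
intros Hc Hd rho Hr.
destruct (Hc rho Hr) as [m Hm], (Hd rho Hr) as [m' Hm'].
exists (m + m'); intros n.
apply Rle_trans with ((Cmod (c n) + Cmod (d n)) * rho ^ n).
- apply Rmult_le_compat_r; [now apply pow_le|apply Cmod_triangle].
- rewrite Rmult_plus_distr_r; now apply Rplus_le_compat.
Qed.

Lemma grow_scal (a : C) (c : nat -> C) : grow c -> grow (fun n => a * c n)%C.
Proof.
intros Hc; apply (grow_dominated c _ (Cmod a) 1); [apply Cmod_ge_0|lra|easy|].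
intros n; rewrite Cmod_mult, pow1; lra.
Qed.

Lemma grow_shift (c : nat -> C) : grow c -> grow (fun n => c (S n)).
Proof.
intros Hc rho Hr.
destruct (Hc (rho + 1)) as [m Hm]; [lra|].
exists m; intros n; eapply Rle_trans; [|apply (Hm (S n))].
apply Rmult_le_compat_l; [apply Cmod_ge_0|].
apply Rle_trans with ((rho + 1) ^ n); [apply pow_incr; lra|].
simpl; assert (0 <= (rho + 1) ^ n) by (apply pow_le; lra); nra.
Qed.

Lemma grow_INR (c : nat -> C) : grow c -> grow (fun n => RtoC (INR n) * c n)%C.
Proof.
intros Hc; apply (grow_dominated c _ 1 2); [lra|lra|easy|]; intros n.
rewrite Cmod_mult, Cmod_R, Rabs_right by (apply Rle_ge, pos_INR).
rewrite Rmult_1_l; apply Rmult_le_compat_r; [apply Cmod_ge_0|apply INR_le_pow2].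
Qed.

Definition dcoef (c : nat -> C) (n : nat) : C := (RtoC (INR (S n)) * c (S n))%C.

Lemma grow_dcoef (c : nat -> C) : grow c -> grow (dcoef c).
Proof. intros H; exact (grow_shift _ (grow_INR _ H)). Qed.

(** Multiplying the remainder for [n] by [z + h] gives the one for [n + 1] up to the extra term
    [n z ^ (n - 1) h ^ 2]. At [n = 0] the value of [pred] is harmless because of the factor
    [INR 0]. *)
Lemma pow_second_order (z h : C) (n : nat) : Cmod h <= 1 ->
  Cmod ((z + h) ^ n - z ^ n - RtoC (INR n) * z ^ pred n * h)
    <= INR n ^ 2 * (Cmod z + 1) ^ n * Cmod h ^ 2.
Proof.
intros Hh; assert (Pz := Cmod_ge_0 z); assert (Ph := Cmod_ge_0 h).
set (s := Cmod z + 1).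
induction n as [|n IH].
- simpl; replace (1 - 1 - 0 * 1 * h)%C with (RtoC 0) by ring; rewrite Cmod_0; lra.
- set (d := ((z + h) ^ n - z ^ n - RtoC (INR n) * z ^ pred n * h)%C) in *.
  assert (En : (RtoC (INR n) * z ^ n = RtoC (INR n) * z * z ^ pred n)%C).
  { destruct n; [simpl; ring|rewrite Cpow_S; simpl pred; ring]. }
  replace ((z + h) ^ S n - z ^ S n - RtoC (INR (S n)) * z ^ pred (S n) * h)%C
    with ((z + h) * d + RtoC (INR n) * z ^ pred n * h ^ 2)%C.
  2:{ unfold d; rewrite S_INR, RtoC_plus; simpl pred; rewrite !Cpow_S.
      replace ((RtoC (INR n) + 1) * z ^ n * h)%C
        with ((RtoC (INR n) * z ^ n) * h + z ^ n * h)%C by ring.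
      rewrite En; simpl; ring. }
  eapply Rle_trans; [apply Cmod_triangle|].
  rewrite !Cmod_mult, !Cmod_pow, Cmod_R, Rabs_right by (apply Rle_ge, pos_INR).
  assert (A : Cmod (z + h) * Cmod d <= s * (INR n ^ 2 * s ^ n * Cmod h ^ 2)).
  { apply Rmult_le_compat; [apply Cmod_ge_0|apply Cmod_ge_0| |easy].
    eapply Rle_trans; [apply Cmod_triangle|unfold s; lra]. }
  assert (B : Cmod z ^ pred n <= s ^ S n).
  { apply Rle_trans with (s ^ pred n); [apply pow_incr; unfold s; lra|].
    apply Rle_pow; [unfold s; lra|lia]. }
  assert (D : INR n * Cmod z ^ pred n * Cmod h ^ 2 <= INR n * s ^ S n * Cmod h ^ 2).
  { apply Rmult_le_compat_r; [apply pow2_ge_0|].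
    apply Rmult_le_compat_l; [apply pos_INR|easy]. }
  rewrite S_INR.
  replace (s * (INR n ^ 2 * s ^ n * Cmod h ^ 2))
    with (INR n ^ 2 * s ^ S n * Cmod h ^ 2) in A by (simpl; ring).
  assert (Q : 0 <= s ^ S n * Cmod h ^ 2).
  { apply Rmult_le_pos; [apply pow_le; unfold s; lra|apply pow2_ge_0]. }
  assert (I := pos_INR n).
  replace ((INR n + 1) ^ 2 * s ^ S n * Cmod h ^ 2)
    with (INR n ^ 2 * s ^ S n * Cmod h ^ 2 + INR n * s ^ S n * Cmod h ^ 2
      + (INR n + 1) * (s ^ S n * Cmod h ^ 2)) by (simpl; ring).
  assert (0 <= (INR n + 1) * (s ^ S n * Cmod h ^ 2)) by (apply Rmult_le_pos; lra).
  lra.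
Qed.

Lemma ps_cdiff (c : nat -> C) (f g : C -> C) (z : C) :
  is_ps c f -> is_ps (dcoef c) g -> cdiff f z (g z).
Proof.
intros [Gc Hf] [_ Hg] eps He.
assert (Pz := Cmod_ge_0 z).
(* The 8 is [2 * 2 * 2]: two factors absorb [INR n ^ 2] by [INR n <= 2 ^ n], the third provides the
   geometric majorant. *)
destruct (Gc (8 * (Cmod z + 1))) as [m Hm]; [lra|].
assert (Pm : 0 <= m).
{ eapply Rle_trans; [|apply (Hm 0%nat)]; simpl; generalize (Cmod_ge_0 (c 0%nat)); lra. }
exists (Rmin 1 (eps / (2 * m + 1))); split.
- apply Rmin_pos; [lra|apply Rdiv_lt_0_compat; lra].
- intros w Hw.
  set (h := (w - z)%C) in *.
  assert (Ph := Cmod_ge_0 h).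
  assert (H1 := Rlt_le_trans _ _ _ Hw (Rmin_l _ _)).
  assert (H2 := Rlt_le_trans _ _ _ Hw (Rmin_r _ _)).
  assert (Sg : is_Cseries (fun n => c n * (RtoC (INR n) * z ^ pred n))%C (g z)).
  { replace (g z) with (c 0%nat * (RtoC (INR 0) * z ^ pred 0) + g z)%C by (simpl; ring).
    apply (is_Cseries_shift (fun n => c n * (RtoC (INR n) * z ^ pred n))%C).
    apply is_Cseries_ext with (2 := Hg z); intros n; unfold dcoef; simpl pred; ring. }
  assert (D := is_Cseries_minus _ _ _ _ (is_Cseries_minus _ _ _ _ (Hf w) (Hf z))
    (is_Cseries_scal h _ _ Sg)).
  rewrite (Cmult_comm (g z)).
  apply is_Cseries_bound with (m := m * Cmod h ^ 2) in D.
  + eapply Rle_trans; [apply D|].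
    apply (Rmult_lt_compat_r (2 * m + 1)) in H2; [|lra].
    unfold Rdiv in H2; rewrite Rmult_assoc, Rinv_l, Rmult_1_r in H2 by lra.
    replace (2 * (m * Cmod h ^ 2)) with (2 * m * Cmod h * Cmod h) by ring.
    apply Rmult_le_compat_r; [easy|nra].
  + intros n.
    replace (c n * w ^ n - c n * z ^ n - h * (c n * (RtoC (INR n) * z ^ pred n)))%C
      with (c n * ((z + h) ^ n - z ^ n - RtoC (INR n) * z ^ pred n * h))%C
      by (replace (z + h)%C with w by (unfold h; ring); ring).
    rewrite Cmod_mult.
    assert (A := pow_second_order z h n (Rlt_le _ _ H1)).
    assert (Pc := Cmod_ge_0 (c n)).
    apply (Rmult_le_compat_l (Cmod (c n))) in A; [|easy].
    apply (Rmult_le_compat_r (2 ^ n)) in A; [|apply Rlt_le, pow_two_gt_0].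
    eapply Rle_trans; [apply A|].
    specialize (Hm n); rewrite Rpow_mult_distr in Hm.
    assert (I : INR n ^ 2 * 2 ^ n <= 8 ^ n).
    { replace 8 with (2 * 2 * 2) by lra; rewrite !Rpow_mult_distr.
      apply Rmult_le_compat_r; [apply Rlt_le, pow_two_gt_0|].
      simpl; rewrite Rmult_1_r; assert (J := INR_le_pow2 n).
      apply Rmult_le_compat; try apply pos_INR; easy. }
    replace (Cmod (c n) * (INR n ^ 2 * (Cmod z + 1) ^ n * Cmod h ^ 2) * 2 ^ n)
      with (INR n ^ 2 * 2 ^ n * (Cmod (c n) * (Cmod z + 1) ^ n) * Cmod h ^ 2) by ring.
    apply Rmult_le_compat_r; [apply pow2_ge_0|].
    eapply Rle_trans; [|apply Hm].
    replace (Cmod (c n) * (8 ^ n * (Cmod z + 1) ^ n))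
      with (8 ^ n * (Cmod (c n) * (Cmod z + 1) ^ n)) by ring.
    apply Rmult_le_compat_r; [|easy].
    apply Rmult_le_pos; [easy|apply pow_le; lra].
Qed.

Lemma ps_derivative (c : nat -> C) (f : C -> C) : is_ps c f ->
  exists g, is_ps (dcoef c) g /\ forall z, cdiff f z (g z).
Proof.
intros H; destruct (ex_ps (dcoef c)) as [g Hg]; [apply grow_dcoef, H|].
exists g; split; [easy|]; intros z; now apply ps_cdiff with c.
Qed.

Lemma ps_centire (c : nat -> C) (f : C -> C) : is_ps c f -> centire f.
Proof.
intros H z; destruct (ps_derivative c f H) as [g [_ Hg]]; now exists (g z).
Qed.

Lemma cdiff_unique (f : C -> C) (z a b : C) : cdiff f z a -> cdiff f z b -> a = b.
Proof.
intros Ha Hb; apply is_derive_cdiff, is_C_derive_unique in Ha, Hb; congruence.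
Qed.

Lemma ps_at_0 (c : nat -> C) (f : C -> C) : is_ps c f -> f 0%C = c 0%nat.
Proof.
intros [_ H]; apply (is_Cseries_unique _ _ _ (H 0%C)).
replace (c 0%nat) with (c 0%nat * 0 ^ 0 + 0)%C by (simpl; ring).
apply (is_Cseries_shift (fun n => c n * 0 ^ n)%C).
apply is_Cseries_psum; intros eps He; exists 0%nat; intros n _.
replace (psum _ n) with (RtoC 0); [now rewrite Cmod_self|].
induction n as [|n IH]; [easy|]; cbn [psum]; rewrite <- IH, Cpow_S; ring.
Qed.

(** Evaluation at 0 gives the constant coefficient. The derivative again sums to zero, and its
    [n]-th coefficient is a nonzero multiple of [c (S n)]. *)
Lemma ps_zero (c : nat -> C) (f : C -> C) : is_ps c f -> (forall z, f z = 0%C) ->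
  forall n, c n = 0%C.
Proof.
intros H E n; revert c f H E; induction n as [|n IH]; intros c f H E.
- now rewrite <- (ps_at_0 c f H).
- destruct (ps_derivative c f H) as [g [Hg Dg]].
  assert (X : dcoef c n = 0%C).
  { apply (IH _ g Hg); intros z; apply (cdiff_unique f z); [easy|].
    apply cdiff_ext with (fun _ => RtoC 0); [easy|apply cdiff_const]. }
  unfold dcoef in X.
  assert (N : RtoC (INR (S n)) <> 0%C).
  { intros Z; apply RtoC_inj in Z; now apply (not_0_INR (S n)). }
  replace (c (S n)) with (/ RtoC (INR (S n)) * (RtoC (INR (S n)) * c (S n)))%C
    by (field; easy).
  rewrite X; ring.
Qed.

Lemma ps_plus (c d : nat -> C) (f g : C -> C) : is_ps c f -> is_ps d g ->
  is_ps (fun n => c n + d n)%C (fun z => f z + g z)%C.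
Proof.
intros [Gc Hf] [Gd Hg]; split; [now apply grow_plus|]; intros z.
apply is_Cseries_ext with (fun n => c n * z ^ n + d n * z ^ n)%C;
  [intros; ring|now apply is_Cseries_plus].
Qed.

Lemma ps_scal (a : C) (c : nat -> C) (f : C -> C) : is_ps c f ->
  is_ps (fun n => a * c n)%C (fun z => a * f z)%C.
Proof.
intros [Gc Hf]; split; [now apply grow_scal|]; intros z.
apply is_Cseries_ext with (fun n => a * (c n * z ^ n))%C;
  [intros; ring|now apply is_Cseries_scal].
Qed.

Lemma ps_ext (c d : nat -> C) (f g : C -> C) : is_ps c f ->
  (forall n, c n = d n) -> (forall z, f z = g z) -> is_ps d g.
Proof.
intros [Gc Hf] E1 E2; split.
- intros rho Hr; destruct (Gc rho Hr) as [m Hm]; exists m; intros n; now rewrite <- E1.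
- intros z; rewrite <- E2; apply is_Cseries_ext with (2 := Hf z); intros n; now rewrite E1.
Qed.

Lemma ps_unique (c d : nat -> C) (f : C -> C) : is_ps c f -> is_ps d f ->
  forall n, c n = d n.
Proof.
intros Hc Hd n; apply Ceq_minus.
apply (ps_zero (fun n => c n - d n)%C (fun z => f z - f z)%C); [|intros; ring].
apply (ps_ext (fun n => c n + (- (1)) * d n)%C _ (fun z => f z + (- (1)) * f z)%C);
  [|intros; ring|intros; ring].
apply ps_plus; [easy|now apply ps_scal].
Qed.

Lemma ps_determines (c : nat -> C) (f g : C -> C) : is_ps c f -> is_ps c g ->
  forall z, f z = g z.
Proof. intros [_ Hf] [_ Hg] z; exact (is_Cseries_unique _ _ _ (Hf z) (Hg z)). Qed.

Lemma ps_taylor (f : C -> C) : centire f -> is_ps (tcoef f) f.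
Proof.
intros Hf; split; [|intros; now apply taylor].
intros rho Hr.
destruct (circle_bounded f (rho + 1) Hf) as [m Hm]; [lra|].
exists m; intros n.
eapply Rle_trans; [|apply (cauchy_estimate f n (rho + 1) m Hf); [lra|easy]].
apply Rmult_le_compat_l; [apply Cmod_ge_0|apply pow_incr; lra].
Qed.

Lemma tcoef_ps (c : nat -> C) (f : C -> C) : is_ps c f -> forall n, tcoef f n = c n.
Proof.
intros H; apply ps_unique with f; [|easy]; apply ps_taylor; now apply ps_centire with c.
Qed.

Lemma ps_divide_z (c : nat -> C) (f : C -> C) : is_ps c f ->
  exists g, is_ps (fun n => c (S n)) g /\ forall z, (f z = c 0%nat + z * g z)%C.
Proof.
intros [Gc Hf]; destruct (ex_ps (fun n => c (S n))) as [g [Gg Hg]]; [now apply grow_shift|].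
exists g; split; [now split|]; intros z.
apply (is_Cseries_unique _ _ _ (Hf z)).
replace (c 0%nat + z * g z)%C with (c 0%nat * z ^ 0 + z * g z)%C by (simpl; ring).
apply (is_Cseries_shift (fun n => c n * z ^ n)%C).
apply is_Cseries_ext with (fun n => z * (c (S n) * z ^ n))%C.
- intros n; rewrite Cpow_S; ring.
- now apply is_Cseries_scal.
Qed.

(** Serves to factor out a zero of order [k] in the open mapping theorem, and to divide by
    [z ^ (r - 1)] in the hyper-Bessel formula. *)
Lemma ps_divide_pow (k : nat) (c : nat -> C) (f : C -> C) : is_ps c f ->
  (forall n, (n < k)%nat -> c n = 0%C) ->
  exists g, is_ps (fun n => c (k + n)%nat) g /\ forall z, (f z = z ^ k * g z)%C.
Proof.
revert c f; induction k as [|k IH]; intros c f H Z.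
- exists f; split; [easy|]; intros z; simpl; ring.
- destruct (ps_divide_z c f H) as [g [Hg Eg]].
  destruct (IH _ g Hg) as [g' [Hg' Eg']]; [intros n Hn; apply Z; lia|].
  exists g'; split; [easy|]; intros z.
  rewrite Eg, Eg', Z, Cpow_S; [ring|lia].
Qed.

(** * Values of nonconstant entire functions *)

Lemma least_nat (P : nat -> Prop) : (exists n, P n) ->
  exists n, P n /\ forall k, (k < n)%nat -> ~ P k.
Proof.
intros H.
destruct (dec_inh_nat_subset_has_unique_least_element P) as [n [[Hn L] _]].
- intros n; apply classic.
- easy.
- exists n; split; [easy|]; intros k Hk Pk; specialize (L k Pk); lia.
Qed.

(** The increment [g] of [f] at [z0] is [z ^ k * h] with [h] nonzero at 0, so its modulus is at
    least some [eta > 0] on a small circle of radius [s]. Values close to [f z0] compared with [eta]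
    must then be attained inside. *)
Lemma open_mapping (f : C -> C) (z0 : C) (rho : R) : centire f ->
  (exists z, f z <> f z0) -> 0 < rho ->
  exists delta, 0 < delta /\ forall w, Cmod (w - f z0) < delta ->
    exists z, Cmod (z - z0) < rho /\ f z = w.
Proof.
intros Hf [z1 N1] Hrho.
set (g := fun z => (f (z0 + z) - f z0)%C).
assert (Hg : centire g).
{ intros z; destruct (Hf (z0 + z)%C) as [l Hl]; exists l.
  apply cdiff_minus_const with (f := fun z => f (z0 + z)%C); now apply cdiff_shift. }
assert (Pg := ps_taylor g Hg).
destruct (least_nat (fun n => tcoef g n <> 0%C)) as [k [Hk Lk]].
{ apply NNPP; intros A; apply N1.
  assert (Z : forall n, tcoef g n = 0%C).
  { intros n; apply NNPP; intros B; apply A; now exists n. }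
  assert (E : g (z1 - z0)%C = 0%C).
  { apply (ps_determines (fun _ => RtoC 0) g (fun _ => RtoC 0)).
    - now apply (ps_ext (tcoef g) _ g).
    - apply (ps_ext (fun n => 0 * tcoef g n)%C _ (fun z => 0 * g z)%C);
        [now apply ps_scal|intros; ring|intros; ring]. }
  unfold g in E; replace (z0 + (z1 - z0))%C with z1 in E by ring; now apply Ceq_minus. }
destruct (ps_divide_pow k _ g Pg) as [h [Hh Eh]].
{ intros n Hn; apply NNPP; intros B; now apply (Lk n). }
assert (H0 : h 0%C = tcoef g k) by (rewrite (ps_at_0 _ _ Hh), Nat.add_0_r; easy).
set (a := Cmod (tcoef g k)).
assert (Pa : 0 < a) by now apply Cmod_gt_0.
destruct (centire_ccont h 0%C (ps_centire _ _ Hh) (a / 2)) as [d [Pd Qd]]; [lra|].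
set (s := Rmin (d / 2) (rho / 2)).
assert (Ps : 0 < s) by (apply Rmin_pos; lra).
assert (S1 : s <= d / 2) by apply Rmin_l; assert (S2 : s <= rho / 2) by apply Rmin_r.
set (eta := s ^ k * (a / 2)).
assert (Pe : 0 < eta) by (apply Rmult_lt_0_compat; [now apply pow_lt|lra]).
assert (Circ : forall z, Cmod z = s -> eta <= Cmod (g z)).
{ intros z Hz; rewrite Eh, Cmod_mult, Cmod_pow, Hz.
  apply Rmult_le_compat_l; [apply pow_le; lra|].
  specialize (Qd z); replace (z - 0)%C with z in Qd by ring; specialize (Qd ltac:(lra)).
  rewrite H0, Cmod_sub_sym in Qd.
  assert (T := Cmod_le_sub (tcoef g k) (h z)); fold a in T; lra. }
(* Half of [eta] ensures [Cmod v < eta - Cmod v]: the reciprocal of [g - v] is smaller on the circle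
   than at the centre. *)
exists (eta / 2); split; [lra|]; intros w Hw.
apply NNPP; intros A.
set (v := (w - f z0)%C) in *.
assert (Nv : forall z, Cmod z <= s -> (g z - v)%C <> 0%C).
{ intros z Hz B; apply A; exists (z0 + z)%C; split.
  - replace (z0 + z - z0)%C with z by ring; lra.
  - apply Ceq_minus in B; unfold g, v in B.
    replace (f (z0 + z)%C) with (f (z0 + z) - f z0 + f z0)%C by ring; rewrite B; ring. }
(* Otherwise [1 / (g - v)] would violate the maximum principle on [|z| <= s]. *)
assert (Dq : forall z, Cmod z <= s -> exists l, cdiff (fun z => / (g z - v))%C z l).
{ intros z Hz; destruct (Hg z) as [l Hl]; eexists.
  apply (cdiff_inv (fun z => g z - v)%C z l); [now apply cdiff_minus_const|now apply Nv]. }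
assert (M : is_mean (fun z => / (g z - v))%C s (/ (g 0 - v))%C).
{ apply (mean_value (fun z => / (g z - v))%C); [easy| |].
  - destruct (Dq 0%C) as [l Hl]; [rewrite Cmod_0; lra|]; now apply cdiff_ccont with l.
  - intros z Hz; apply Dq; lra. }
assert (N0 := Nv 0%C ltac:(rewrite Cmod_0; lra)).
apply is_mean_bound with (m := / (eta - Cmod v)) in M; [|lra|].
- rewrite Cmod_inv in M by easy.
  assert (G0 : g 0%C = 0%C) by (unfold g; rewrite Cplus_0_r; ring).
  rewrite G0 in M, N0; replace (0 - v)%C with (- v)%C in M, N0 by ring.
  rewrite Cmod_opp in M.
  assert (Pv : 0 < Cmod v) by (rewrite <- Cmod_opp; now apply Cmod_gt_0).
  apply Rinv_le_contravar in M; [|apply Rinv_0_lt_compat; lra].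
  rewrite !Rinv_inv in M; lra.
- intros z Hz; rewrite Cmod_inv by (apply Nv; lra).
  apply Rinv_le_contravar; [lra|].
  specialize (Circ z Hz).
  assert (T := Cmod_le_sub (g z) v); lra.
Qed.

Lemma ex_Cmod_gt_1 (f : C -> C) : centire f -> (exists z, f z <> f 0%C) ->
  exists z, 1 < Cmod (f z).
Proof.
intros Hf [z Hz]; apply NNPP; intros A; apply Hz, (liouville f 1); [easy|].
intros w; apply Rnot_lt_le; intros B; apply A; now exists w.
Qed.

(** Otherwise [1 / f] is entire and bounded by 1. *)
Lemma ex_Cmod_lt_1 (f : C -> C) : centire f -> (exists z, f z <> f 0%C) ->
  exists z, Cmod (f z) < 1.
Proof.
intros Hf [z Hz]; apply NNPP; intros A; apply Hz.
assert (B : forall w, 1 <= Cmod (f w)).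
{ intros w; apply Rnot_lt_le; intros B; apply A; now exists w. }
assert (N : forall w, f w <> 0%C).
{ intros w; apply Cmod_gt_0; specialize (B w); lra. }
assert (E : (/ f z = / f 0)%C).
{ apply (liouville (fun w => / f w)%C 1).
  - intros w; destruct (Hf w) as [l Hl]; eexists; now apply cdiff_inv with (1 := Hl).
  - intros w; rewrite Cmod_inv, <- Rinv_1 by easy; apply Rinv_le_contravar; [lra|easy]. }
replace (f z) with (/ / f z)%C by (field; auto); rewrite E; field; auto.
Qed.

(** Intermediate value theorem for the modulus, along the segment joining a point where it is below
    1 to one where it is above 1. *)
Lemma ex_Cmod_eq_1 (f : C -> C) : centire f -> (exists z, f z <> f 0%C) ->
  exists z, Cmod (f z) = 1.
Proof.
intros Hf N.
destruct (ex_Cmod_lt_1 f Hf N) as [a Ha], (ex_Cmod_gt_1 f Hf N) as [b Hb].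
set (p := fun t => (a + RtoC t * (b - a))%C).
destruct (IVT (fun t => Cmod (f (p t)) - 1) 0 1) as [t [_ Ht]].
- intros t eps He.
  destruct (centire_ccont f (p t) Hf eps He) as [d [Pd Q]].
  assert (Pb := Cmod_ge_0 (b - a)).
  exists (d / (1 + Cmod (b - a))); split; [apply Rdiv_lt_0_compat; lra|].
  intros x [_ Hx]; simpl in *; unfold Rdist in *.
  assert (X : Cmod (p x - p t) < d).
  { unfold p; replace (a + RtoC x * (b - a) - (a + RtoC t * (b - a)))%C
      with (RtoC (x - t) * (b - a))%C by (rewrite RtoC_minus; ring).
    rewrite Cmod_mult, Cmod_R.
    assert (Q1 := Rabs_pos (x - t)).
    apply Rle_lt_trans with (Rabs (x - t) * (1 + Cmod (b - a))); [nra|].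
    apply (Rmult_lt_compat_r (1 + Cmod (b - a))) in Hx; [|lra].
    unfold Rdiv in Hx; rewrite (Rmult_assoc d), Rinv_l, Rmult_1_r in Hx by lra; easy. }
  specialize (Q _ X).
  assert (T1 := Cmod_le_sub (f (p x)) (f (p t))).
  assert (T2 := Cmod_le_sub (f (p t)) (f (p x))); rewrite (Cmod_sub_sym (f (p t))) in T2.
  apply Rabs_def1; lra.
- lra.
- unfold p; replace (a + 0 * (b - a))%C with a by ring; lra.
- unfold p; replace (a + 1 * (b - a))%C with b by ring; lra.
- exists (p t); lra.
Qed.

(** * Roots of unity and accumulation points *)

Definition root_of_unity (w : C) : Prop := exists n, (1 <= n)%nat /\ (w ^ n = 1)%C.

Lemma cis_pow (t : R) (n : nat) : (cis t ^ n)%C = cis (INR n * t).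
Proof.
induction n as [|n IH].
- simpl; unfold cis; rewrite Rmult_0_l, cos_0, sin_0; easy.
- rewrite Cpow_S, IH, <- cis_plus, S_INR; f_equal; ring.
Qed.

Lemma cis_2PI : cis (2 * PI) = 1%C.
Proof. unfold cis; now rewrite cos_2PI, sin_2PI. Qed.

Lemma cis_neq_1 (t : R) : 0 < t < 2 * PI -> cis t <> 1%C.
Proof.
intros Ht E; injection E as Ec Es.
assert (S : 0 < sin (t / 2)) by (apply sin_gt_0; lra).
replace t with (2 * (t / 2)) in Ec by field.
rewrite cos_2a_sin in Ec; nra.
Qed.

(** The root must differ from [w0], which may itself be a root of unity. Hence the first multiple of
    [2 pi / N] strictly beyond the argument [t] is taken: [up] rounds strictly upwards, and [N >= 2]
    keeps the rotation below a full turn. *)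
Lemma roots_of_unity_dense (w0 : C) (delta : R) : Cmod w0 = 1 -> 0 < delta ->
  exists w, w <> w0 /\ Cmod (w - w0) < delta /\ root_of_unity w.
Proof.
intros H0 Hd; assert (P := two_pi_pos).
destruct (circle_param w0 1 H0) as [t [Ht ->]].
rewrite Cmult_1_l.
destruct (cis_cont 0 delta Hd) as [d [Pd Q]].
assert (PN : exists N, (2 <= N)%nat /\ 2 * PI / INR N < d).
{ destruct (archimed (2 * PI / d)) as [A _].
  assert (0 < 2 * PI / d) by now apply Rdiv_lt_0_compat.
  exists (Z.to_nat (up (2 * PI / d)) + 2)%nat; split; [lia|].
  assert (B : 2 * PI / d < INR (Z.to_nat (up (2 * PI / d)) + 2)).
  { rewrite plus_INR, INR_IZR_INZ, Z2Nat.id by (apply le_IZR; lra); simpl; lra. }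
  apply (Rmult_lt_reg_r (INR (Z.to_nat (up (2 * PI / d)) + 2))); [lra|].
  unfold Rdiv at 1; rewrite Rmult_assoc, Rinv_l, Rmult_1_r by lra.
  apply (Rmult_lt_compat_l d) in B; [|easy].
  replace (d * (2 * PI / d)) with (2 * PI) in B by (field; lra); easy. }
destruct PN as [N [HN1 HN2]].
assert (PN : 2 <= INR N) by (apply (le_INR 2); easy).
set (x := t * INR N / (2 * PI)).
assert (Px : 0 <= x).
{ apply Rmult_le_pos; [apply Rmult_le_pos; lra|apply Rlt_le, Rinv_0_lt_compat; lra]. }
destruct (archimed x) as [A1 A2].
set (k := Z.to_nat (up x)).
assert (Ek : INR k = IZR (up x)).
{ unfold k; rewrite INR_IZR_INZ, Z2Nat.id; [easy|apply le_IZR; lra]. }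
rewrite <- Ek in A1, A2.
set (s := INR k * (2 * PI) / INR N).
assert (B : s - t = (INR k - x) * (2 * PI / INR N)).
{ unfold s, x; field; lra. }
assert (PQ : 0 < 2 * PI / INR N) by (apply Rdiv_lt_0_compat; lra).
assert (B1 : 0 < s - t) by (rewrite B; apply Rmult_lt_0_compat; lra).
assert (B2 : s - t <= 2 * PI / INR N) by (rewrite B; nra).
assert (B3 : 2 * PI / INR N < 2 * PI).
{ apply (Rmult_lt_reg_r (INR N)); [lra|].
  unfold Rdiv; rewrite Rmult_assoc, Rinv_l by lra; nra. }
assert (E : cis s = (cis (s - t) * cis t)%C) by (rewrite <- cis_plus; f_equal; ring).
exists (cis s); split; [|split].
- intros F; rewrite E in F; apply (cis_neq_1 (s - t)); [lra|].
  assert (Nz : cis t <> 0%C) by (apply Cmod_gt_0; rewrite Cmod_cis; lra).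
  replace (cis (s - t)) with ((cis (s - t) * cis t) * / cis t)%C by (field; easy).
  rewrite F; field; easy.
- rewrite E; replace (cis (s - t) * cis t - cis t)%C
    with ((cis (s - t) - cis 0) * cis t)%C
    by (replace (cis 0) with (RtoC 1) by (unfold cis; now rewrite cos_0, sin_0); ring).
  rewrite Cmod_mult, Cmod_cis, Rmult_1_r; apply Q.
  rewrite Rminus_0_r, Rabs_right; lra.
- exists N; split; [lia|].
  rewrite cis_pow; unfold s.
  replace (INR N * (INR k * (2 * PI) / INR N)) with (INR k * (2 * PI)) by (field; lra).
  rewrite <- cis_pow, cis_2PI; apply Cpow_1_l.
Qed.

Definition acc_point (S : C -> Prop) (z0 : C) : Prop :=
  forall rho, 0 < rho -> exists z, S z /\ z <> z0 /\ Cmod (z - z0) < rho.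

Lemma acc_point_open (S : C -> Prop) (z0 : C) (d : R) : 0 < d ->
  (forall z, Cmod (z - z0) < d -> S z) -> acc_point S z0.
Proof.
intros Hd H rho Hr.
assert (P : 0 < Rmin d rho) by now apply Rmin_pos.
assert (M1 := Rmin_l d rho); assert (M2 := Rmin_r d rho).
assert (E : Cmod (z0 + RtoC (Rmin d rho / 2) - z0) = Rmin d rho / 2).
{ replace (z0 + RtoC (Rmin d rho / 2) - z0)%C with (RtoC (Rmin d rho / 2)) by ring.
  rewrite Cmod_R, Rabs_right; lra. }
exists (z0 + RtoC (Rmin d rho / 2))%C; split; [apply H; lra|split; [|lra]].
intros F; rewrite F, Cmod_self in E; lra.
Qed.

Lemma acc_point_Cmod_lt_1 (f : C -> C) : centire f -> (exists z, f z <> f 0%C) ->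
  exists z0, acc_point (fun z => Cmod (f z) < 1) z0.
Proof.
intros Hf N; destruct (ex_Cmod_lt_1 f Hf N) as [z0 H0]; exists z0.
destruct (centire_ccont f z0 Hf (1 - Cmod (f z0))) as [d [Pd Q]]; [lra|].
apply acc_point_open with d; [easy|]; intros z Hz; specialize (Q z Hz).
assert (T := Cmod_le_sub (f z) (f z0)); lra.
Qed.

Lemma acc_point_Cmod_gt_1 (f : C -> C) : centire f -> (exists z, f z <> f 0%C) ->
  exists z0, acc_point (fun z => 1 < Cmod (f z)) z0.
Proof.
intros Hf N; destruct (ex_Cmod_gt_1 f Hf N) as [z0 H0]; exists z0.
destruct (centire_ccont f z0 Hf (Cmod (f z0) - 1)) as [d [Pd Q]]; [lra|].
apply acc_point_open with d; [easy|]; intros z Hz; specialize (Q z Hz).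
assert (T := Cmod_le_sub (f z0) (f z)); rewrite Cmod_sub_sym in T; lra.
Qed.

(** A root of unity close to [f z0] but different from it has a preimage close to [z0], which is
    then automatically different from [z0]. *)
Lemma acc_point_root_of_unity (f : C -> C) : centire f -> (exists z, f z <> f 0%C) ->
  exists z0, acc_point (fun z => root_of_unity (f z)) z0.
Proof.
intros Hf N; destruct (ex_Cmod_eq_1 f Hf N) as [z0 H0]; exists z0; intros rho Hr.
assert (N' : exists z, f z <> f z0).
{ destruct N as [z Hz]; destruct (Ceq_dec (f z) (f z0)) as [E|]; [|now exists z].
  exists 0%C; now rewrite <- E; intros F; apply Hz. }
destruct (open_mapping f z0 rho Hf N' Hr) as [d [Pd Q]].
destruct (roots_of_unity_dense (f z0) d H0 Pd) as [w [Nw [Dw Rw]]].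
destruct (Q w Dw) as [z [Hz E]]; exists z; split; [now rewrite E|split; [|easy]].
intros ->; now apply Nw.
Qed.

(** * The space of r-even entire functions in terms of Taylor coefficients *)

Lemma omega_pow_r (r : nat) : (1 <= r)%nat -> (omega r ^ r)%C = 1%C.
Proof.
intros Hr; change (omega r) with (cis (2 * PI / INR r)); rewrite cis_pow.
replace (INR r * (2 * PI / INR r)) with (2 * PI); [apply cis_2PI|].
field; apply not_0_INR; lia.
Qed.

Lemma omega_pow_neq_1 (r n : nat) : (1 <= r)%nat -> (n mod r <> 0)%nat ->
  (omega r ^ n)%C <> 1%C.
Proof.
intros Hr Hn.
rewrite (Nat.div_mod_eq n r), Cpow_add_r, Cpow_mult_r, omega_pow_r, Cpow_1_l, Cmult_1_l by easy.
change (omega r) with (cis (2 * PI / INR r)); rewrite cis_pow.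
assert (P := two_pi_pos).
assert (Hm : (n mod r < r)%nat) by (apply Nat.mod_upper_bound; lia).
assert (Pr : 0 < INR r) by (apply lt_0_INR; lia).
assert (Pm : 0 < INR (n mod r)) by (apply lt_0_INR; lia).
apply lt_INR in Hm.
assert (PQ : 0 < 2 * PI / INR r) by now apply Rdiv_lt_0_compat.
apply cis_neq_1; split; [now apply Rmult_lt_0_compat|].
replace (2 * PI) with (INR r * (2 * PI / INR r)) at 2 by (field; lra).
now apply Rmult_lt_compat_r.
Qed.

Lemma omega_pow_mod_0 (r n : nat) : (1 <= r)%nat -> (n mod r = 0)%nat ->
  (omega r ^ n)%C = 1%C.
Proof.
intros Hr Hn.
rewrite (Nat.div_mod_eq n r), Hn, Nat.add_0_r, Cpow_mult_r, omega_pow_r by easy.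
apply Cpow_1_l.
Qed.

Lemma ps_Hr (r : nat) (u : Hr r) : is_ps (tcoef u) u.
Proof. apply ps_taylor, entire_centire, Hr_entire. Qed.

(** The function [z -> u (omega r * z)] has coefficients [omega r ^ n * c_n]. It equals [u], so
    uniqueness forces [c_n = 0] unless [omega r ^ n = 1]. *)
Lemma tcoef_Hr_support (r : nat) (u : Hr r) (n : nat) : (2 <= r)%nat ->
  (n mod r <> 0)%nat -> tcoef u n = 0%C.
Proof.
intros Hr Hn; destruct (ps_Hr r u) as [G S].
assert (E : is_ps (fun n => omega r ^ n * tcoef u n)%C u).
{ split.
  - apply (grow_dominated (tcoef u) _ 1 1); [lra|lra|easy|]; intros k.
    change (omega r) with (cis (2 * PI / INR r)).
    rewrite Cmod_mult, Cmod_pow, Cmod_cis; lra.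
  - intros z; rewrite <- (Hr_even _ u z 1%nat) by lia.
    apply is_Cseries_ext with (2 := S (omega r ^ 1%nat * z)%C); intros k.
    rewrite Cpow_1_r, Cpow_mult_l; ring. }
assert (X := ps_unique _ _ _ E (ps_Hr r u) n).
assert (N := omega_pow_neq_1 r n ltac:(lia) Hn).
destruct (Ceq_dec (tcoef u n) 0) as [Z|Z]; [easy|exfalso; apply N].
replace (omega r ^ n)%C with (omega r ^ n * tcoef u n * / tcoef u n)%C by (field; easy).
rewrite X; field; easy.
Qed.

Lemma r_even_of_ps (r : nat) (c : nat -> C) (f : C -> C) : (1 <= r)%nat -> is_ps c f ->
  (forall n, (n mod r <> 0)%nat -> c n = 0%C) -> r_even r f.
Proof.
intros Hr [_ H] Z z k _.
apply (is_Cseries_unique _ _ _ (H _)).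
apply is_Cseries_ext with (2 := H z); intros n.
destruct (Nat.eq_dec (n mod r) 0) as [E|N]; [|rewrite Z by easy; ring].
rewrite Cpow_mult_l, <- Cpow_mult_r, (Nat.mul_comm k), Cpow_mult_r, omega_pow_mod_0, Cpow_1_l
  by easy; ring.
Qed.

Lemma ex_Hr_of_ps (r : nat) (c : nat -> C) (f : C -> C) : (1 <= r)%nat -> is_ps c f ->
  (forall n, (n mod r <> 0)%nat -> c n = 0%C) -> exists u : Hr r, Hr_fun u = f.
Proof.
intros Hr H Z.
exists (mkHr f (proj2 (entire_centire f) (ps_centire c f H)) (r_even_of_ps r c f Hr H Z)).
reflexivity.
Qed.

(** The coefficient of [(z ^ r) ^ n]. In these coordinates [Hr r] is exactly the space of sequences
    satisfying [grow]. *)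
Definition hcoef {r : nat} (u : Hr r) (n : nat) : C := tcoef u (r * n).

Lemma hcoef_inj (r : nat) (u v : Hr r) : (2 <= r)%nat ->
  (forall n, hcoef u n = hcoef v n) -> u = v.
Proof.
intros Hr H; apply Hr_ext; apply ps_determines with (tcoef u); [apply ps_Hr|].
apply ps_ext with (tcoef v) v; [apply ps_Hr| |easy]; intros n.
destruct (Nat.eq_dec (n mod r) 0) as [E|N].
- rewrite (Nat.div_mod_eq n r), E, Nat.add_0_r; symmetry; apply H.
- now rewrite !tcoef_Hr_support.
Qed.

Lemma hcoef_grow (r : nat) (u : Hr r) : (1 <= r)%nat -> grow (hcoef u).
Proof.
intros Hr rho Hrho; destruct (ps_Hr r u) as [G _].
destruct (G (rho + 1)) as [m Hm]; [lra|].
exists m; intros n; eapply Rle_trans; [|apply (Hm (r * n)%nat)].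
apply Rmult_le_compat_l; [apply Cmod_ge_0|].
apply Rle_trans with ((rho + 1) ^ n); [apply pow_incr; lra|].
apply Rle_pow; [lra|nia].
Qed.

Lemma grow_spread (r : nat) (a : nat -> C) : (1 <= r)%nat -> grow a ->
  grow (fun n => if Nat.eq_dec (n mod r) 0 then a (n / r)%nat else RtoC 0).
Proof.
intros Hr Ha rho Hrho.
destruct (Ha (rho ^ r)) as [m Hm]; [now apply pow_le|].
exists m; intros n; destruct (Nat.eq_dec (n mod r) 0) as [E|N].
- replace (rho ^ n) with ((rho ^ r) ^ (n / r)); [apply Hm|].
  rewrite <- pow_mult; f_equal; rewrite (Nat.div_mod_eq n r) at 2; lia.
- rewrite Cmod_0, Rmult_0_l.
  eapply Rle_trans; [|apply (Hm 0%nat)].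
  simpl; rewrite Rmult_1_r; apply Cmod_ge_0.
Qed.

Lemma hcoef_surj (r : nat) (a : nat -> C) : (1 <= r)%nat -> grow a ->
  exists u : Hr r, forall n, hcoef u n = a n.
Proof.
intros Hr Ha.
destruct (ex_ps _ (grow_spread r a Hr Ha)) as [f Hf].
destruct (ex_Hr_of_ps r _ f Hr Hf) as [u Hu].
- intros n Hn; now destruct (Nat.eq_dec (n mod r) 0).
- exists u; intros n; unfold hcoef; rewrite Hu, (tcoef_ps _ _ Hf).
  replace (r * n)%nat with (n * r)%nat by lia.
  rewrite Nat.Div0.mod_mul, Nat.div_mul by lia; reflexivity.
Qed.

Lemma hcoef_plus (r : nat) (u v : Hr r) (n : nat) :
  hcoef (plus u v) n = (hcoef u n + hcoef v n)%C.
Proof.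
unfold hcoef.
(* The type ascription identifies, by conversion, the pointwise sum with the sum taken in [Hr r]. *)
now rewrite (tcoef_ps _ _ (ps_plus _ _ _ _ (ps_Hr r u) (ps_Hr r v))
  : forall k, tcoef (plus u v) k = _).
Qed.

Lemma hcoef_scal (r : nat) (a : C) (u : Hr r) (n : nat) :
  hcoef (scal a u) n = (a * hcoef u n)%C.
Proof.
unfold hcoef.
now rewrite (tcoef_ps _ _ (ps_scal a _ _ (ps_Hr r u)) : forall k, tcoef (scal a u) k = _).
Qed.

Lemma hcoef_zero (r : nat) (n : nat) : hcoef (zero : Hr r) n = 0%C.
Proof.
replace (zero : Hr r) with (scal (RtoC 0) (zero : Hr r)).
- rewrite hcoef_scal; ring.
- apply Hr_ext; intros z; exact (Cmult_0_l 0).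
Qed.

(** * The hyper-Bessel operator in coefficients *)

Lemma ps_mult_z (c : nat -> C) (f : C -> C) : is_ps c f ->
  is_ps (fun n => match n with O => RtoC 0 | S n => c n end) (fun z => z * f z)%C.
Proof.
intros [G H]; split.
- intros rho Hrho; destruct (G rho Hrho) as [m Hm].
  exists (rho * m); intros [|n].
  + rewrite Cmod_0, Rmult_0_l; apply Rmult_le_pos; [easy|].
    eapply Rle_trans; [|apply (Hm 0%nat)].
    simpl; rewrite Rmult_1_r; apply Cmod_ge_0.
  + specialize (Hm n); simpl.
    replace (Cmod (c n) * (rho * rho ^ n)) with (rho * (Cmod (c n) * rho ^ n)) by ring.
    now apply Rmult_le_compat_l.
- intros z; replace (z * f z)%C with (0 * z ^ 0 + z * f z)%C by ring.
  apply (is_Cseries_shift (fun n => match n with O => 0 | S n => c n end * z ^ n)%C).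
  apply is_Cseries_ext with (fun n => z * (c n * z ^ n))%C; [|now apply is_Cseries_scal].
  intros n; rewrite Cpow_S; ring.
Qed.

Lemma ps_C_derive (c : nat -> C) (f : C -> C) : is_ps c f -> is_ps (dcoef c) (C_derive f).
Proof.
intros H; destruct (ps_derivative c f H) as [g [Hg Dg]].
apply ps_ext with (dcoef c) g; [easy|easy|]; intros z.
symmetry; apply is_C_derive_unique, is_derive_cdiff, Dg.
Qed.

(** The eigenvalue on [z ^ m] of the product of the first-order operators, each of which multiplies
    [z ^ m] by [m + r gamma_i + 1]. *)
Definition bessel_factor (r : nat) (gamma : nat -> R) (l : list nat) (m : nat) : R :=
  fold_right (fun i p => (INR m + (INR r * gamma i + 1)) * p) 1 l.

Lemma ps_bessel_factors (r : nat) (gamma : nat -> R) (l : list nat) (c : nat -> C)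
  (f : C -> C) : is_ps c f ->
  is_ps (fun m => RtoC (bessel_factor r gamma l m) * c m)%C
    (fold_right (fun (i : nat) (f : C -> C) (w : C) =>
        w * C_derive f w + RtoC (INR r * gamma i + 1) * f w)%C f l).
Proof.
intros H; induction l as [|i l IH].
- apply ps_ext with c f; [easy| |easy]; intros n; simpl; ring.
- simpl fold_right.
  set (F := fold_right _ f l) in *.
  refine (ps_ext _ _ _ _ (ps_plus _ _ _ _ (ps_mult_z _ _ (ps_C_derive _ _ IH))
      (ps_scal (RtoC (INR r * gamma i + 1)) _ _ IH)) _ (fun z => eq_refl)).
  intros n.
  change (bessel_factor r gamma (i :: l) n)
    with ((INR n + (INR r * gamma i + 1)) * bessel_factor r gamma l n).
  rewrite RtoC_mult, !RtoC_plus.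
  destruct n as [|n]; unfold dcoef; cbv beta iota; [change (INR 0) with 0|]; ring.
Qed.

(** [B_r] sends [z ^ (r (n + 1))] to this multiple of [z ^ (r n)]: the derivative contributes
    [r (n + 1)] and leaves the exponent [r n + r - 1], on which the first-order operators act. *)
Definition bessel_weight (r : nat) (gamma : nat -> R) (n : nat) : R :=
  INR (r * S n) * bessel_factor r gamma (seq 1 (r - 1)) (r * n + (r - 1)).

Lemma hyper_Bessel_spec (r : nat) (gamma : nat -> R) (u : Hr r) : (2 <= r)%nat ->
  forall n, hcoef (hyper_Bessel r gamma u) n
    = (RtoC (bessel_weight r gamma n) * hcoef u (S n))%C.
Proof.
intros Hr.
set (d := fun m => (RtoC (bessel_factor r gamma (seq 1 (r - 1)) m) * dcoef (tcoef u) m)%C).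
assert (Pd := ps_bessel_factors r gamma (seq 1 (r - 1)) _ _ (ps_C_derive _ _ (ps_Hr r u))).
fold d in Pd.
(* After one derivative the coefficients live on the exponents congruent to -1 modulo [r]. The
   lowest is [r - 1], so division by [z ^ (r - 1)] is possible and the quotient is [r]-even. *)
assert (Zd : forall m, (S m mod r <> 0)%nat -> d m = 0%C).
{ intros m Hm; unfold d, dcoef; rewrite tcoef_Hr_support by easy; ring. }
destruct (ps_divide_pow (r - 1) d _ Pd) as [g [Hg Eg]].
{ intros m Hm; apply Zd; rewrite Nat.mod_small; lia. }
assert (Zg : forall m, (m mod r <> 0)%nat -> d (r - 1 + m)%nat = 0%C).
{ intros m Hm; apply Zd.
  replace (S (r - 1 + m)) with (m + 1 * r)%nat by lia.
  now rewrite Nat.Div0.mod_add. }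
destruct (ex_Hr_of_ps r _ g ltac:(lia) Hg Zg) as [v Hv].
assert (Fv : forall z, z <> RtoC 0 -> v z = hyper_Bessel_formula r gamma u z).
{ intros z Nz; unfold hyper_Bessel_formula; rewrite Eg, Hv.
  field; now apply Cpow_nz. }
set (b := hyper_Bessel r gamma u).
assert (Fb : forall z, z <> RtoC 0 -> b z = hyper_Bessel_formula r gamma u z).
{ unfold b, hyper_Bessel; apply epsilon_spec; now exists v. }
assert (E : is_ps (fun n => d (r - 1 + n)%nat) b).
{ apply ps_ext with (1 := Hg); [easy|]; intros z.
  destruct (Ceq_dec z 0) as [->|Nz]; [|rewrite Fb, <- Fv, Hv by easy; easy].
  (* The formula is silent at 0; there [g] and [b] are compared by continuity at a small real point
     [x]. *)
  apply Ceq_minus, Cmod_small_0; intros eps He.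
  destruct (centire_ccont g 0 (ps_centire _ _ Hg) (eps / 2)) as [d1 [P1 Q1]]; [lra|].
  destruct (centire_ccont b 0 (proj1 (entire_centire b) (Hr_entire r b)) (eps / 2))
    as [d2 [P2 Q2]]; [lra|].
  assert (M : 0 < Rmin d1 d2 / 2) by (assert (X := Rmin_pos d1 d2 P1 P2); lra).
  set (x := RtoC (Rmin d1 d2 / 2)).
  assert (Nx : x <> 0%C) by (intros F; apply RtoC_inj in F; lra).
  assert (Mx : Cmod (x - 0) = Rmin d1 d2 / 2).
  { replace (x - 0)%C with x by ring; unfold x; rewrite Cmod_R, Rabs_right; lra. }
  assert (L1 := Rmin_l d1 d2); assert (L2 := Rmin_r d1 d2).
  specialize (Q1 x ltac:(lra)); specialize (Q2 x ltac:(lra)).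
  rewrite Fb, <- Fv, Hv in Q2 by easy.
  rewrite Cmod_sub_sym in Q1.
  eapply Rle_trans; [apply (Cmod_sub_tri _ (g x))|lra]. }
intros n; unfold hcoef at 1; rewrite (tcoef_ps _ _ E).
unfold d, dcoef, bessel_weight, hcoef.
replace (S (r - 1 + r * n)) with (r * S n)%nat by lia.
replace (r - 1 + r * n)%nat with (r * n + (r - 1))%nat by lia.
rewrite RtoC_mult; ring.
Qed.

(** The assumption on [gamma] enters here: multiplied by [r] it makes the factor of index [k] at
    least [r n + k], hence at least 1, so the weight is at least [r (n + 1)]. *)
Lemma bessel_weight_ge (r : nat) (gamma : nat -> R) (n : nat) : (2 <= r)%nat ->
  (forall k : nat, (1 <= k <= r - 1)%nat -> - 1 + INR k / INR r <= gamma k) ->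
  INR (S n) <= bessel_weight r gamma n.
Proof.
intros Hr Hg; unfold bessel_weight.
assert (P : 1 <= bessel_factor r gamma (seq 1 (r - 1)) (r * n + (r - 1))).
{ assert (L : forall k, In k (seq 1 (r - 1)) -> (1 <= k <= r - 1)%nat)
    by (intros k Hk; apply in_seq in Hk; lia).
  induction (seq 1 (r - 1)) as [|k l IH]; [simpl; lra|].
  change (1 <= (INR (r * n + (r - 1)) + (INR r * gamma k + 1))
    * bessel_factor r gamma l (r * n + (r - 1))).
  assert (I := IH ltac:(intros; apply L; now right)).
  assert (Lk := L k (or_introl eq_refl)).
  assert (G := Hg k Lk).
  assert (Pr : 0 < INR r) by (apply lt_0_INR; lia).
  apply (Rmult_le_compat_l (INR r)) in G; [|lra].
  replace (INR r * (-1 + INR k / INR r)) with (INR k - INR r) in G by (field; lra).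
  assert (E : INR (r * n + (r - 1)) = INR r * INR n + INR r - 1).
  { rewrite plus_INR, minus_INR, mult_INR by lia; simpl; ring. }
  assert (Pn := pos_INR n).
  assert (K : 1 <= INR k) by (apply (le_INR 1); lia).
  assert (F : 1 <= INR (r * n + (r - 1)) + (INR r * gamma k + 1)) by (rewrite E; nra).
  nra. }
assert (Q : INR (S n) <= INR (r * S n)) by (apply le_INR; nia).
assert (Z := pos_INR (S n)); nra.
Qed.

(** * The topology in terms of coefficient seminorms *)

Lemma compact_square (rho : R) :
  compact_set (U := C_UniformSpace)
    (fun z => - rho <= fst z <= rho /\ - rho <= snd z <= rho).
Proof.
intros I O Ho Hc.
assert (D : forall t : Compactness.Tn 2 R, exists d : posreal,
  bounded_n 2 (- rho, (- rho, tt)) (rho, (rho, tt)) t ->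
  exists i, forall z, close_n 2 d (fst z, (snd z, tt)) t -> O i z).
{ intros [x [y []]].
  destruct (classic (bounded_n 2 (- rho, (- rho, tt)) (rho, (rho, tt)) (x, (y, tt)))) as [B|B].
  - destruct B as [Bx [By _]].
    destruct (Hc (x, y) (conj Bx By)) as [i Hi].
    destruct (Ho i (x, y) Hi) as [d Hd].
    exists d; intros _; exists i; intros [z1 z2] [H1 [H2 _]]; apply Hd; now split.
  - exists (mkposreal 1 Rlt_0_1); now intros B'. }
set (dl := fun t => proj1_sig (constructive_indefinite_description _ (D t))).
assert (Hdl : forall t, bounded_n 2 (- rho, (- rho, tt)) (rho, (rho, tt)) t ->
  exists i, forall z, close_n 2 (dl t) (fst z, (snd z, tt)) t -> O i z)
  by exact (fun t => proj2_sig (constructive_indefinite_description _ (D t))).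
(* [compactness_list] gives its finite list of gauge centres under a double negation. One member of
   the cover is then attached to each centre lying in the box. *)
apply NNPP; intros A.
apply (compactness_list 2 (- rho, (- rho, tt)) (rho, (rho, tt)) dl); intros [l Hl].
apply A; clear A.
assert (S : forall l : list (Compactness.Tn 2 R), exists li : list I,
  forall t, In t l -> bounded_n 2 (- rho, (- rho, tt)) (rho, (rho, tt)) t ->
  exists i, In i li /\ forall z, close_n 2 (dl t) (fst z, (snd z, tt)) t -> O i z).
{ clear l Hl; intros l.
  induction l as [|t l [li IH]]; [exists nil; now intros t []|].
  destruct (classic (bounded_n 2 (- rho, (- rho, tt)) (rho, (rho, tt)) t)) as [B|B].
  - destruct (Hdl t B) as [i Hi].
    exists (i :: li); intros t' [<-|H'] B'.
    + exists i; split; [now left|easy].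
    + destruct (IH t' H' B') as [i' [Hi' Q]]; exists i'; split; [now right|easy].
  - exists li; intros t' [<-|H'] B'; [easy|now apply IH]. }
destruct (S l) as [li Hli]; exists li; intros z [Hx Hy].
destruct (Hl (fst z, (snd z, tt))) as [t [It [Bt Ct]]]; [now repeat split|].
destruct (Hli t It Bt) as [i [Hi Q]]; exists i; split; [easy|now apply Q].
Qed.

Lemma compact_set_bounded (K : C -> Prop) : compact_set (U := C_UniformSpace) K ->
  exists rho, 0 <= rho /\ forall z, K z -> Cmod z <= rho.
Proof.
intros H.
destruct (H nat (fun n z => Cmod z < INR n)) as [l Hl].
- intros n z Hz.
  assert (P : 0 < (INR n - Cmod z) / 2) by lra.
  exists (mkposreal _ P); intros w Hw.
  assert (B := Cmod_C_ball z w (INR n - Cmod z) Hw).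
  assert (T := Cmod_le_sub w z); lra.
- intros z _; destruct (archimed (Cmod z)) as [A _].
  assert (P := Cmod_ge_0 z).
  exists (Z.to_nat (up (Cmod z))).
  rewrite INR_IZR_INZ, Z2Nat.id; [lra|apply le_IZR; lra].
- exists (INR (list_max l)); split; [apply pos_INR|].
  intros z Hz; destruct (Hl z Hz) as [n [Hn Bn]].
  assert (L : (n <= list_max l)%nat).
  { apply (proj1 (Forall_forall _ l) (proj1 (list_max_le l (list_max l)) (le_n _)) n Hn). }
  apply le_INR in L; lra.
Qed.

(** The closed ball of centre [u] and radius [e] for the seminorm [sup |c_n| rho ^ n]. *)
Definition near {r : nat} (u v : Hr r) (rho e : R) : Prop :=
  forall n, Cmod (hcoef v n - hcoef u n) * rho ^ n <= e.

Lemma hcoef_minus_fun (r : nat) (u v : Hr r) :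
  is_ps (fun n => tcoef v n - tcoef u n)%C (fun z => v z - u z)%C.
Proof.
apply (ps_ext (fun n => tcoef v n + (- (1)) * tcoef u n)%C _
  (fun z => v z + (- (1)) * u z)%C); [|intros; ring|intros; ring].
apply ps_plus; [apply ps_Hr|apply ps_scal, ps_Hr].
Qed.

(** Geometric majoration bounds the values on a compact set by a coefficient seminorm; conversely
    Cauchy's estimate on a circle bounds the coefficients by the values on a square containing it.
    The condition [1 <= rho] allows [rho ^ n <= rho ^ (r * n)]. *)
Lemma nbhs_Hr_near (r : nat) (u : Hr r) (P : Hr r -> Prop) : (2 <= r)%nat ->
  nbhs_Hr u P <->
  exists rho e, 1 <= rho /\ 0 < e /\ forall v, near u v rho e -> P v.
Proof.
intros Hr; split.
- intros [K [HK [eps H]]].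
  destruct (compact_set_bounded K HK) as [s [Hs Bs]].
  assert (Pe := cond_pos eps).
  (* The exponent [r] appears because [near] weighs the coefficient of [z ^ (r n)] by [rho ^ n]; the
     2 pays for the geometric majorant, and [eps / 4] makes the resulting [eps / 2] strictly smaller
     than [eps]. *)
  exists ((2 * (s + 1)) ^ r), (eps / 4); split; [apply pow_R1_Rle; lra|split; [lra|]].
  intros v Hv; apply H; intros z Hz.
  apply Rle_lt_trans with (2 * (eps / 4)); [|lra].
  apply (ps_bound _ _ z (s + 1) _ (hcoef_minus_fun r u v)).
  + specialize (Bs z Hz); lra.
  + intros n; destruct (Nat.eq_dec (n mod r) 0) as [E|N].
    * specialize (Hv (n / r)%nat); unfold hcoef in Hv.
      rewrite <- pow_mult in Hv.
      replace (r * (n / r))%nat with n in Hv; [easy|].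
      rewrite (Nat.div_mod_eq n r) at 1; lia.
    * rewrite !tcoef_Hr_support by easy; rewrite Cmod_self; lra.
- intros [rho [e [Hrho [He H]]]].
  exists (fun z => - rho <= fst z <= rho /\ - rho <= snd z <= rho).
  split; [apply compact_square|].
  exists (mkposreal e He); simpl; intros v Hv; apply H; intros n.
  assert (D := hcoef_minus_fun r u v).
  rewrite <- (tcoef_ps _ _ D (r * n)%nat : _ = (hcoef v n - hcoef u n)%C).
  eapply Rle_trans.
  + apply Rmult_le_compat_l with (r2 := rho ^ (r * n)); [apply Cmod_ge_0|].
    apply Rle_pow; [easy|nia].
  + apply (cauchy_estimate _ _ _ e); [now apply ps_centire with (1 := D)|lra|].
    intros z Hz; apply Rlt_le, Hv.
    assert (M := Rmax_Cmod z); rewrite Hz in M.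
    assert (M1 := Rle_trans _ _ _ (Rmax_l _ _) M); assert (M2 := Rle_trans _ _ _ (Rmax_r _ _) M).
    apply Rabs_le_between in M1, M2; now split.
Qed.

Lemma near_refl (r : nat) (u : Hr r) (rho e : R) : 0 <= e -> near u u rho e.
Proof. intros He n; rewrite Cmod_self; lra. Qed.

Lemma near_tri (r : nat) (u v w : Hr r) (rho e1 e2 : R) : 0 <= rho ->
  near u v rho e1 -> near v w rho e2 -> near u w rho (e1 + e2).
Proof.
intros Hr H1 H2 n; specialize (H1 n); specialize (H2 n).
assert (P : 0 <= rho ^ n) by now apply pow_le.
assert (T := Cmod_sub_tri (hcoef w n) (hcoef v n) (hcoef u n)).
apply (Rmult_le_compat_r _ _ _ P) in T; lra.
Qed.

Lemma near_mono (r : nat) (u v : Hr r) (rho rho' e e' : R) : 0 <= rho <= rho' -> e' <= e ->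
  near u v rho' e' -> near u v rho e.
Proof.
intros Hr He H n; specialize (H n).
apply Rle_trans with e'; [|easy].
eapply Rle_trans; [|apply H].
apply Rmult_le_compat_l; [apply Cmod_ge_0|now apply pow_incr].
Qed.

Lemma near_plus (r : nat) (u v u' v' : Hr r) (rho e e' : R) : 0 <= rho ->
  near u v rho e -> near u' v' rho e' -> near (plus u u') (plus v v') rho (e + e').
Proof.
intros Hr H H' n; specialize (H n); specialize (H' n).
rewrite !hcoef_plus.
replace (hcoef v n + hcoef v' n - (hcoef u n + hcoef u' n))%C
  with ((hcoef v n - hcoef u n) + (hcoef v' n - hcoef u' n))%C by ring.
assert (P : 0 <= rho ^ n) by now apply pow_le.
assert (T := Cmod_triangle (hcoef v n - hcoef u n) (hcoef v' n - hcoef u' n)).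
apply (Rmult_le_compat_r _ _ _ P) in T; lra.
Qed.

Lemma near_scal (r : nat) (a : C) (u v : Hr r) (rho e : R) :
  near u v rho e -> near (scal a u) (scal a v) rho (Cmod a * e).
Proof.
intros H n; specialize (H n); rewrite !hcoef_scal.
replace (a * hcoef v n - a * hcoef u n)%C with (a * (hcoef v n - hcoef u n))%C by ring.
rewrite Cmod_mult, Rmult_assoc; apply Rmult_le_compat_l; [apply Cmod_ge_0|easy].
Qed.

(** An element of [Hr r] with prescribed coefficients; meaningful only when these
    satisfy [grow]. *)
Definition of_coefs (r : nat) (a : nat -> C) : Hr r :=
  epsilon (inhabits (Hr_zero r)) (fun u => forall n, hcoef u n = a n).

Lemma of_coefs_spec (r : nat) (a : nat -> C) : (1 <= r)%nat -> grow a ->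
  forall n, hcoef (of_coefs r a) n = a n.
Proof. intros Hr Ha; unfold of_coefs; apply epsilon_spec; now apply hcoef_surj. Qed.

(** Beyond [N >= x] each new factor [x] is dominated by the new factor of the factorial. *)
Lemma pow_le_fact (x : R) : 0 <= x -> exists m, 0 <= m /\ forall n, x ^ n <= m * INR (fact n).
Proof.
intros Hx.
set (N := Z.to_nat (up x)).
assert (HN : x <= INR N).
{ destruct (archimed x) as [A _]; unfold N.
  rewrite INR_IZR_INZ, Z2Nat.id; [lra|apply le_IZR; lra]. }
exists ((1 + x) ^ N); split; [apply pow_le; lra|]; intros n.
assert (F : forall n, 1 <= INR (fact n)) by (intros k; apply (le_INR 1), lt_O_fact).
assert (P : 1 <= (1 + x) ^ N) by (apply pow_R1_Rle; lra).
destruct (Nat.le_gt_cases n N) as [L|L].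
- apply Rle_trans with ((1 + x) ^ N * 1); [|apply Rmult_le_compat_l; [lra|apply F]].
  rewrite Rmult_1_r; apply Rle_trans with ((1 + x) ^ n);
    [apply pow_incr; lra|apply Rle_pow; [lra|easy]].
- induction n as [|n IH]; [lia|].
  assert (A : x ^ n <= (1 + x) ^ N * INR (fact n)).
  { destruct (Nat.eq_dec n N) as [->|]; [|apply IH; lia].
    apply Rle_trans with ((1 + x) ^ N * 1); [|apply Rmult_le_compat_l; [lra|apply F]].
    rewrite Rmult_1_r; apply pow_incr; lra. }
  rewrite fact_simpl, mult_INR; simpl pow.
  assert (B : x <= INR (S n)).
  { apply Rle_trans with (INR N); [easy|apply le_INR; lia]. }
  assert (0 <= x ^ n) by now apply pow_le.
  replace ((1 + x) ^ N * (INR (S n) * INR (fact n)))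
    with (INR (S n) * ((1 + x) ^ N * INR (fact n))) by ring.
  now apply Rmult_le_compat.
Qed.

(** * Eigenvectors of the hyper-Bessel operator *)

(** This is [alpha_{rn}(gamma)]: the weights are [r ^ r (n + 1)] times the product of the
    [gamma_i + n + 1], and their product telescopes into the quotients of Gamma values. *)
Fixpoint bessel_fact (r : nat) (gamma : nat -> R) (n : nat) : R :=
  match n with
  | O => 1
  | S n => bessel_weight r gamma n * bessel_fact r gamma n
  end.

(** [taylor_pow mu n m] is the coefficient of [d ^ m] in [(mu + d) ^ n], and
    [(mu + d) ^ n = sum_(i < m) taylor_pow mu n i * d ^ i + d ^ m * taylor_rem mu d n m]. *)
Fixpoint taylor_pow (mu : C) (n m : nat) : C :=
  match n with
  | O => match m with O => RtoC 1 | S _ => RtoC 0 end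
  | S n => (mu * taylor_pow mu n m
            + match m with O => RtoC 0 | S m => taylor_pow mu n m end)%C
  end.

Fixpoint taylor_rem (mu d : C) (n m : nat) : C :=
  match n with
  | O => match m with O => RtoC 1 | S _ => RtoC 0 end
  | S n => ((mu + d) * taylor_rem mu d n m
            + match m with O => RtoC 0 | S m => taylor_pow mu n m end)%C
  end.

Lemma taylor_rem_0 (mu d : C) (n : nat) : taylor_rem mu d n 0 = ((mu + d) ^ n)%C.
Proof. induction n as [|n IH]; [easy|]; simpl; rewrite IH; ring. Qed.

Lemma taylor_rem_step (mu d : C) (n m : nat) :
  taylor_rem mu d n m = (taylor_pow mu n m + d * taylor_rem mu d n (S m))%C.
Proof.
revert m; induction n as [|n IH]; intros m.
- destruct m; simpl; ring.
- cbn [taylor_rem taylor_pow]; rewrite (IH m); destruct m; ring.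
Qed.

Lemma taylor_pow_rem (mu : C) (n m : nat) : taylor_pow mu n m = taylor_rem mu 0 n m.
Proof. rewrite taylor_rem_step; ring. Qed.

Lemma taylor_rem_bound (mu d : C) (n m : nat) :
  Cmod (taylor_rem mu d n m) <= (1 + Cmod mu + Cmod d) ^ n.
Proof.
assert (Pm := Cmod_ge_0 mu).
assert (G : forall d n m,
  Cmod match m with O => RtoC 0 | S m => taylor_pow mu n m end <= (1 + Cmod mu + Cmod d) ^ n ->
  Cmod (taylor_rem mu d n m) <= (1 + Cmod mu + Cmod d) ^ n ->
  Cmod (taylor_rem mu d (S n) m) <= (1 + Cmod mu + Cmod d) ^ S n).
{ clear; intros d n m A B; cbn [taylor_rem].
  eapply Rle_trans; [apply Cmod_triangle|]; rewrite Cmod_mult.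
  assert (T := Cmod_triangle mu d).
  apply (Rmult_le_compat _ _ _ _ (Cmod_ge_0 _) (Cmod_ge_0 _) T) in B.
  simpl; lra. }
assert (Z : forall d m, Cmod (taylor_rem mu d 0 m) <= (1 + Cmod mu + Cmod d) ^ 0).
{ intros d0 [|k]; simpl; [rewrite Cmod_1|rewrite Cmod_0]; lra. }
(* The recursion of [taylor_rem] calls [taylor_pow], which is its case [d = 0]; that case is
   therefore bounded first. *)
assert (T : forall n m, Cmod (taylor_rem mu 0 n m) <= (1 + Cmod mu + Cmod 0) ^ n).
{ intros k; induction k as [|k IH]; intros l; [apply Z|apply G; [|apply IH]].
  destruct l; [rewrite Cmod_0; apply pow_le; lra|rewrite taylor_pow_rem; apply IH]. }
assert (Pd := Cmod_ge_0 d).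
revert m; induction n as [|n IH]; intros m; [apply Z|apply G; [|apply IH]].
destruct m; [rewrite Cmod_0; apply pow_le; lra|].
rewrite taylor_pow_rem; eapply Rle_trans; [apply T|].
apply pow_incr; rewrite Cmod_0; lra.
Qed.

Lemma taylor_rem_lt (mu d : C) (n m : nat) : (n < m)%nat -> taylor_rem mu d n m = 0%C.
Proof.
assert (T : forall n m, (n < m)%nat -> taylor_pow mu n m = 0%C).
{ intros k; induction k as [|k IH]; intros [|l] H; try lia; [easy|].
  cbn [taylor_pow]; rewrite !IH by lia; ring. }
revert m; induction n as [|n IH]; intros [|m] H; try lia; [easy|].
cbn [taylor_rem]; rewrite IH, T by lia; ring.
Qed.

Lemma taylor_pow_at_0 (n m : nat) :
  taylor_pow 0 n m = if Nat.eq_dec n m then RtoC 1 else RtoC 0.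
Proof.
revert m; induction n as [|n IH]; intros [|m]; [easy|easy| |]; cbn [taylor_pow].
- destruct (Nat.eq_dec (S n) 0); [lia|ring].
- rewrite (IH m); destruct (Nat.eq_dec n m), (Nat.eq_dec (S n) (S m)); try lia; ring.
Qed.

Record closed_subspace {r : nat} (V : Hr r -> Prop) : Prop := {
  cs_zero : V zero;
  cs_plus : forall u v, V u -> V v -> V (plus u v);
  cs_scal : forall a u, V u -> V (scal a u);
  cs_closed : forall u,
    (forall rho e, 1 <= rho -> 0 < e -> exists v, V v /\ near u v rho e) -> V u
}.

(** The two facts about [r] and [gamma] on which the rest depends; they give [bessel_fact] factorial
    growth. *)
Definition weights_ok (r : nat) (gamma : nat -> R) : Prop :=
  (2 <= r)%nat /\ forall n, INR (S n) <= bessel_weight r gamma n.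

Lemma bessel_fact_ge (r : nat) (gamma : nat -> R) (n : nat) : weights_ok r gamma ->
  INR (fact n) <= bessel_fact r gamma n.
Proof.
intros [_ W]; induction n as [|n IH]; [simpl; lra|].
rewrite fact_simpl, mult_INR; simpl bessel_fact.
apply Rmult_le_compat; try apply pos_INR; [apply W|easy].
Qed.

Lemma bessel_fact_pos (r : nat) (gamma : nat -> R) (n : nat) : weights_ok r gamma ->
  0 < bessel_fact r gamma n.
Proof.
intros W; eapply Rlt_le_trans; [apply INR_fact_lt_0|now apply bessel_fact_ge].
Qed.

Lemma bessel_fact_nz (r : nat) (gamma : nat -> R) (n : nat) : weights_ok r gamma ->
  RtoC (bessel_fact r gamma n) <> 0%C.
Proof.
intros W E; apply RtoC_inj in E; generalize (bessel_fact_pos r gamma n W); lra.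
Qed.

Lemma pow_le_bessel_fact (r : nat) (gamma : nat -> R) (x : R) : weights_ok r gamma ->
  0 <= x -> exists m, 0 <= m /\ forall n, x ^ n <= m * bessel_fact r gamma n.
Proof.
intros W Hx; destruct (pow_le_fact x Hx) as [m [Pm Hm]]; exists m; split; [easy|].
intros n; eapply Rle_trans; [apply Hm|].
apply Rmult_le_compat_l; [easy|now apply bessel_fact_ge].
Qed.

(** Factorial growth beats [(s * rho) ^ n]. The constant depends on [s] and [rho] alone, which makes
    the estimates on [jrem] uniform in its order and its increment. *)
Lemma div_bessel_fact_bound (r : nat) (gamma : nat -> R) (s rho : R) : weights_ok r gamma ->
  0 <= s -> 0 <= rho -> exists m, 0 <= m /\ forall n c, Cmod c <= s ^ n ->
    Cmod (c / RtoC (bessel_fact r gamma n)) * rho ^ n <= m.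
Proof.
intros W Hs Hr.
destruct (pow_le_bessel_fact r gamma (s * rho) W) as [m [Pm Hm]]; [now apply Rmult_le_pos|].
exists m; split; [easy|]; intros n c Hc.
assert (P := bessel_fact_pos r gamma n W).
rewrite Cmod_div, Cmod_R, Rabs_right by (try lra; now apply bessel_fact_nz).
apply (Rmult_le_reg_r (bessel_fact r gamma n)); [easy|].
eapply Rle_trans; [|apply Hm].
rewrite Rpow_mult_distr; unfold Rdiv.
replace (Cmod c * / bessel_fact r gamma n * rho ^ n * bessel_fact r gamma n)
  with (Cmod c * rho ^ n) by (field; lra).
apply Rmult_le_compat_r; [now apply pow_le|easy].
Qed.

Lemma grow_div_bessel_fact (r : nat) (gamma : nat -> R) (s : R) (c : nat -> C) :
  weights_ok r gamma -> 0 <= s -> (forall n, Cmod (c n) <= s ^ n) ->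
  grow (fun n => c n / RtoC (bessel_fact r gamma n))%C.
Proof.
intros W Hs Hc rho Hr.
destruct (div_bessel_fact_bound r gamma s rho W Hs Hr) as [m [_ Hm]].
exists m; intros n; now apply Hm.
Qed.

(** [jrem gamma mu d 0] is the eigenvector of eigenvalue [mu + d], and
    [jrem gamma mu 0 m] is [/ m!] times the [m]-th derivative at [mu] of the
    eigenvector with respect to the eigenvalue. *)
Definition jrem {r : nat} (gamma : nat -> R) (mu d : C) (m : nat) : Hr r :=
  of_coefs r (fun n => taylor_rem mu d n m / RtoC (bessel_fact r gamma n))%C.

(** The normalised hyper-Bessel function, sum of [mu ^ n z ^ (r n) / alpha_{rn}(gamma)], with value
    1 at 0. *)
Definition jvec {r : nat} (gamma : nat -> R) (mu : C) : Hr r :=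
  of_coefs r (fun n => mu ^ n / RtoC (bessel_fact r gamma n))%C.

Lemma hcoef_jrem (r : nat) (gamma : nat -> R) (mu d : C) (m n : nat) : weights_ok r gamma ->
  hcoef (jrem gamma mu d m : Hr r) n
  = (taylor_rem mu d n m / RtoC (bessel_fact r gamma n))%C.
Proof.
intros W.
apply (of_coefs_spec r (fun n => taylor_rem mu d n m / RtoC (bessel_fact r gamma n))%C);
  [destruct W; lia|].
apply (grow_div_bessel_fact r gamma (1 + Cmod mu + Cmod d) (fun n => taylor_rem mu d n m));
  [easy| |].
- generalize (Cmod_ge_0 mu) (Cmod_ge_0 d); lra.
- intros k; apply taylor_rem_bound.
Qed.

Lemma hcoef_jvec (r : nat) (gamma : nat -> R) (mu : C) (n : nat) : weights_ok r gamma ->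
  hcoef (jvec gamma mu : Hr r) n = (mu ^ n / RtoC (bessel_fact r gamma n))%C.
Proof.
intros W.
apply (of_coefs_spec r (fun n => mu ^ n / RtoC (bessel_fact r gamma n))%C);
  [destruct W; lia|].
apply (grow_div_bessel_fact r gamma (Cmod mu) (fun n => mu ^ n)%C); [easy|apply Cmod_ge_0|].
intros k; rewrite Cmod_pow; lra.
Qed.

Lemma jrem_0 (r : nat) (gamma : nat -> R) (mu d : C) : weights_ok r gamma ->
  jrem gamma mu d 0 = jvec gamma (mu + d) :> Hr r.
Proof.
intros W; apply hcoef_inj; [apply W|]; intros n.
now rewrite hcoef_jrem, hcoef_jvec, taylor_rem_0.
Qed.

Lemma jrem_step (r : nat) (gamma : nat -> R) (mu d : C) (m : nat) : weights_ok r gamma ->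
  jrem gamma mu d m = plus (jrem gamma mu 0 m) (scal d (jrem gamma mu d (S m))) :> Hr r.
Proof.
intros W; apply hcoef_inj; [apply W|]; intros n.
rewrite hcoef_plus, hcoef_scal, !hcoef_jrem, <- taylor_pow_rem by easy.
rewrite (taylor_rem_step mu d n m); field; now apply bessel_fact_nz.
Qed.

Lemma near_of_bound (r : nat) (u v w : Hr r) (d : C) (rho m : R) :
  v = plus u (scal d w) -> (forall n, Cmod (hcoef w n) * rho ^ n <= m) ->
  near u v rho (Cmod d * m).
Proof.
intros -> H n; rewrite hcoef_plus, hcoef_scal.
replace (hcoef u n + d * hcoef w n - hcoef u n)%C with (d * hcoef w n)%C by ring.
rewrite Cmod_mult, Rmult_assoc; apply Rmult_le_compat_l; [apply Cmod_ge_0|easy].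
Qed.

Lemma jrem_bound (r : nat) (gamma : nat -> R) (mu : C) (rho : R) : weights_ok r gamma ->
  0 <= rho -> exists k, 0 <= k /\ forall d m n, Cmod d <= 1 ->
    Cmod (hcoef (jrem gamma mu d m : Hr r) n) * rho ^ n <= k.
Proof.
intros W Hr; assert (P := Cmod_ge_0 mu).
destruct (div_bessel_fact_bound r gamma (2 + Cmod mu) rho W) as [k [Pk Hk]]; [lra|easy|].
exists k; split; [easy|]; intros d m n Hd.
rewrite hcoef_jrem by easy; apply Hk.
eapply Rle_trans; [apply taylor_rem_bound|].
apply pow_incr; generalize (Cmod_ge_0 d); lra.
Qed.

(** Strong induction on the order. Dividing the Taylor recursion by [d] puts [jrem gamma mu d m] in
    [V] once the lower derivatives and [jvec gamma (mu + d)] are there; letting [mu + d] approach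
    [mu] inside the given set, closedness yields the derivative of order [m]. *)
Lemma closed_subspace_derivatives (r : nat) (gamma : nat -> R) (V : Hr r -> Prop) (mu : C) :
  weights_ok r gamma -> closed_subspace V -> acc_point (fun z => V (jvec gamma z)) mu ->
  forall m, V (jrem gamma mu 0 m).
Proof.
intros W HV Hacc.
assert (A : forall m, (forall i, (i < m)%nat -> V (jrem gamma mu 0 i)) ->
  forall d : C, d <> RtoC 0 -> V (jvec gamma (mu + d)) -> V (jrem gamma mu d m)).
{ induction m as [|m IH]; intros H d Nd Hd.
  - now rewrite jrem_0.
  - replace (jrem gamma mu d (S m)) with
      (plus (scal (/ d)%C (jrem gamma mu d m)) (scal (- / d)%C (jrem gamma mu 0 m)) : Hr r).
    + apply (cs_plus V HV); apply (cs_scal V HV).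
      * apply IH; [intros i Hi; apply H; lia|easy|easy].
      * apply H; lia.
    + rewrite (jrem_step r gamma mu d m W).
      apply hcoef_inj; [apply W|]; intros n.
      rewrite hcoef_plus, !hcoef_scal, hcoef_plus, hcoef_scal; field; easy. }
intros m; induction m as [m IH] using lt_wf_ind.
apply (cs_closed V HV); intros rho e Hrho He.
destruct (jrem_bound r gamma mu rho W) as [k [Pk Hk]]; [lra|].
(* The bound [k] is valid for [Cmod d <= 1]; [1 + k] avoids a division by 0. *)
assert (Pm : 0 < Rmin 1 (e / (1 + k))) by (apply Rmin_pos; [lra|apply Rdiv_lt_0_compat; lra]).
destruct (Hacc _ Pm) as [z [Vz [Nz Dz]]].
assert (M1 := Rmin_l 1 (e / (1 + k))); assert (M2 := Rmin_r 1 (e / (1 + k))).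
set (d := (z - mu)%C) in *.
exists (jrem gamma mu d m); split.
- apply A; [easy|now apply Cminus_eq_contra|].
  replace (mu + d)%C with z by (unfold d; ring); easy.
- apply near_mono with rho (Cmod d * k); [lra| |].
  + apply Rle_trans with (e / (1 + k) * (1 + k)); [|right; field; lra].
    apply Rmult_le_compat; [apply Cmod_ge_0|easy|lra|lra].
  + apply near_of_bound with (jrem gamma mu d (S m)); [now apply jrem_step|].
    intros n; apply Hk; lra.
Qed.

(** The Taylor polynomials of [jvec] about [mu], evaluated at [z], lie in [V] and converge to
    [jvec gamma z]: the remainder of order [N] has no coefficients below [N], and the others are
    uniformly small. *)
Lemma closed_subspace_eigenvectors (r : nat) (gamma : nat -> R) (V : Hr r -> Prop) (mu : C) :
  weights_ok r gamma -> closed_subspace V -> (forall m, V (jrem gamma mu 0 m)) ->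
  forall z, V (jvec gamma z).
Proof.
intros W HV H z; set (d := (z - mu)%C).
assert (A : forall m, exists x : Hr r, V x /\
  forall n, hcoef x n = (hcoef (jvec gamma z : Hr r) n
    - d ^ m * hcoef (jrem gamma mu d m : Hr r) n)%C).
{ induction m as [|m [x [Vx Hx]]].
  - exists zero; split; [apply (cs_zero V HV)|]; intros n.
    rewrite jrem_0 by easy; replace (mu + d)%C with z by (unfold d; ring).
    rewrite hcoef_zero; simpl; ring.
  - exists (plus x (scal (d ^ m)%C (jrem gamma mu 0 m))); split.
    + apply (cs_plus V HV); [easy|]; now apply (cs_scal V HV).
    + intros n; rewrite hcoef_plus, hcoef_scal, Hx, (jrem_step r gamma mu d m W).
      rewrite hcoef_plus, hcoef_scal, Cpow_S; ring. }
apply (cs_closed V HV); intros rho e Hrho He.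
set (s := 1 + Cmod mu + Cmod d).
assert (Pmu := Cmod_ge_0 mu); assert (Pd := Cmod_ge_0 d).
assert (Ps : 1 <= s) by (unfold s; lra).
(* For [n >= N] one factor [s ^ n] bounds [d ^ N] and the other the remainder coefficient. The
   doubled radius supplies the factor [(/ 2) ^ n] that makes the tail small. *)
destruct (div_bessel_fact_bound r gamma (s * s) (2 * rho) W) as [k [Pk Hk]]; [nra|lra|].
destruct (geom_small (/ 2) k e) as [N HN]; [lra|easy|easy|].
destruct (A N) as [x [Vx Hx]]; exists x; split; [easy|]; intros n.
rewrite Hx.
replace (hcoef (jvec gamma z : Hr r) n - d ^ N * hcoef (jrem gamma mu d N : Hr r) n
  - hcoef (jvec gamma z : Hr r) n)%C
  with (- (d ^ N * hcoef (jrem gamma mu d N : Hr r) n))%C by ring.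
rewrite Cmod_opp, hcoef_jrem by easy.
destruct (Nat.lt_ge_cases n N) as [L|L].
- rewrite taylor_rem_lt by easy.
  replace (d ^ N * (0 / RtoC (bessel_fact r gamma n)))%C with (RtoC 0)
    by (field; now apply bessel_fact_nz).
  rewrite Cmod_0; lra.
- replace (d ^ N * (taylor_rem mu d n N / RtoC (bessel_fact r gamma n)))%C
    with (d ^ N * taylor_rem mu d n N / RtoC (bessel_fact r gamma n))%C
    by (field; now apply bessel_fact_nz).
  assert (B : Cmod (d ^ N * taylor_rem mu d n N) <= (s * s) ^ n).
  { rewrite Cmod_mult, Cmod_pow, Rpow_mult_distr.
    apply Rmult_le_compat; [now apply pow_le|apply Cmod_ge_0| |apply taylor_rem_bound].
    apply Rle_trans with (s ^ N); [apply pow_incr; unfold s; lra|now apply Rle_pow]. }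
  specialize (Hk n _ B); specialize (HN n L).
  rewrite Rpow_mult_distr in Hk.
  set (x0 := Cmod (d ^ N * taylor_rem mu d n N / RtoC (bessel_fact r gamma n))) in *.
  replace (x0 * rho ^ n) with ((x0 * (2 ^ n * rho ^ n)) * (/ 2) ^ n).
  + apply Rle_trans with (k * (/ 2) ^ n); [|lra].
    apply Rmult_le_compat_r; [apply pow_le; lra|easy].
  + rewrite pow_inv; field; apply Rgt_not_eq, pow_two_gt_0.
Qed.

(** Once [V] contains all eigenvectors, the derivatives can be taken at 0, where [jrem gamma 0 0 m]
    is a multiple of the monomial [z ^ (r m)]. Hence [V] contains all polynomials in [z ^ r], and
    truncation concludes. *)
Lemma closed_subspace_full (r : nat) (gamma : nat -> R) (V : Hr r -> Prop) (mu : C) :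
  weights_ok r gamma -> closed_subspace V -> acc_point (fun z => V (jvec gamma z)) mu ->
  forall u, V u.
Proof.
intros W HV Hacc.
assert (J := closed_subspace_eigenvectors r gamma V mu W HV
  (closed_subspace_derivatives r gamma V mu W HV Hacc)).
assert (E : forall m, V (jrem gamma 0 0 m)).
{ apply closed_subspace_derivatives; [easy|easy|].
  apply acc_point_open with 1; [lra|]; intros; apply J. }
intros u.
assert (A : forall m, exists x : Hr r, V x /\
  forall n, hcoef x n = if lt_dec n m then hcoef u n else RtoC 0).
{ induction m as [|m [x [Vx Hx]]].
  - exists zero; split; [apply (cs_zero V HV)|]; intros n; apply hcoef_zero.
  - exists (plus x (scal (hcoef u m * RtoC (bessel_fact r gamma m))%C (jrem gamma 0 0 m))).
    split; [apply (cs_plus V HV); [easy|]; now apply (cs_scal V HV)|].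
    intros n; rewrite hcoef_plus, hcoef_scal, Hx, hcoef_jrem, <- taylor_pow_rem, taylor_pow_at_0
      by easy.
    destruct (lt_dec n m), (lt_dec n (S m)), (Nat.eq_dec n m); try lia; subst;
      field; now apply bessel_fact_nz. }
apply (cs_closed V HV); intros rho e Hrho He.
destruct (hcoef_grow r u ltac:(destruct W; lia) (2 * rho)) as [k Hk]; [lra|].
assert (Pk : 0 <= k).
{ eapply Rle_trans; [|apply (Hk 0%nat)]; simpl; rewrite Rmult_1_r; apply Cmod_ge_0. }
destruct (geom_small (/ 2) k e) as [N HN]; [lra|easy|easy|].
destruct (A N) as [x [Vx Hx]]; exists x; split; [easy|]; intros n.
rewrite Hx; destruct (lt_dec n N) as [L|L]; [rewrite Cmod_self; lra|].
replace (0 - hcoef u n)%C with (- hcoef u n)%C by ring; rewrite Cmod_opp.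
specialize (Hk n); specialize (HN n ltac:(lia)).
rewrite Rpow_mult_distr in Hk.
replace (Cmod (hcoef u n) * rho ^ n)
  with ((Cmod (hcoef u n) * (2 ^ n * rho ^ n)) * (/ 2) ^ n).
- apply Rle_trans with (k * (/ 2) ^ n); [|lra].
  apply Rmult_le_compat_r; [apply pow_le; lra|easy].
- rewrite pow_inv; field; apply Rgt_not_eq, pow_two_gt_0.
Qed.

Inductive eigenspan {r : nat} (gamma : nat -> R) (S : C -> Prop) : Hr r -> Prop :=
| eigenspan_zero : eigenspan gamma S zero
| eigenspan_add (a mu : C) (v : Hr r) : S mu -> eigenspan gamma S v ->
    eigenspan gamma S (plus (scal a (jvec gamma mu)) v).

Lemma eigenspan_plus (r : nat) (gamma : nat -> R) (S : C -> Prop) (u v : Hr r) :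
  eigenspan gamma S u -> eigenspan gamma S v -> eigenspan gamma S (plus u v).
Proof.
intros Hu Hv; induction Hu as [|a mu u Hmu Hu IH].
- now rewrite plus_zero_l.
- rewrite <- plus_assoc; now constructor.
Qed.

Lemma eigenspan_scal (r : nat) (gamma : nat -> R) (S : C -> Prop) (a : C) (u : Hr r) :
  (2 <= r)%nat -> eigenspan gamma S u -> eigenspan gamma S (scal a u).
Proof.
intros H2 Hu; induction Hu as [|b mu u Hmu Hu IH].
- replace (scal a (zero : Hr r)) with (zero : Hr r); [constructor|].
  apply hcoef_inj; [easy|]; intros n; rewrite hcoef_scal, hcoef_zero; ring.
- replace (scal a (plus (scal b (jvec gamma mu)) u))
    with (plus (scal (a * b)%C (jvec gamma mu)) (scal a u)); [now constructor|].
  apply hcoef_inj; [easy|]; intros n.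
  rewrite !hcoef_plus, !hcoef_scal, !hcoef_plus, !hcoef_scal; ring.
Qed.

(** The closure of the span is a closed subspace containing [jvec gamma z] for every [z] in [S]. *)
Lemma eigenspan_dense (r : nat) (gamma : nat -> R) (S : C -> Prop) (mu : C) :
  weights_ok r gamma -> acc_point S mu ->
  forall (u : Hr r) rho e, 1 <= rho -> 0 < e ->
    exists v, eigenspan gamma S v /\ near u v rho e.
Proof.
intros W Hacc u.
apply (closed_subspace_full r gamma (fun u => forall rho e, 1 <= rho -> 0 < e ->
    exists v, eigenspan gamma S v /\ near u v rho e) mu W).
- split.
  + intros rho e Hr He; exists zero; split; [constructor|apply near_refl; lra].
  + intros x y Hx Hy rho e Hr He.
    destruct (Hx rho (e / 2) Hr ltac:(lra)) as [x' [Sx Nx]].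
    destruct (Hy rho (e / 2) Hr ltac:(lra)) as [y' [Sy Ny]].
    exists (plus x' y'); split; [now apply eigenspan_plus|].
    replace e with (e / 2 + e / 2) by field; apply near_plus; [lra|easy|easy].
  + intros a x Hx rho e Hr He; assert (Pa := Cmod_ge_0 a).
    destruct (Hx rho (e / (1 + Cmod a)) Hr) as [x' [Sx Nx]]; [apply Rdiv_lt_0_compat; lra|].
    exists (scal a x'); split; [apply eigenspan_scal; [apply W|easy]|].
    apply near_mono with rho (Cmod a * (e / (1 + Cmod a))); [lra| |now apply near_scal].
    apply Rle_trans with ((1 + Cmod a) * (e / (1 + Cmod a))); [|right; field; lra].
    apply Rmult_le_compat_r; [apply Rlt_le, Rdiv_lt_0_compat; lra|lra].
  + intros x Hx rho e Hr He.
    destruct (Hx rho (e / 2) Hr ltac:(lra)) as [y [Hy Ny]].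
    destruct (Hy rho (e / 2) Hr ltac:(lra)) as [v [Sv Nv]].
    exists v; split; [easy|].
    replace e with (e / 2 + e / 2) by field; apply near_tri with y; [lra|easy|easy].
- intros rho Prho; destruct (Hacc rho Prho) as [z [Sz Hz]]; exists z; split; [|easy].
  intros rho' e Hr' He; exists (jvec gamma z); split; [|apply near_refl; lra].
  replace (jvec gamma z) with (plus (scal (RtoC 1) (jvec gamma z)) zero : Hr r);
    [now repeat constructor|].
  apply hcoef_inj; [apply W|]; intros n.
  rewrite hcoef_plus, hcoef_scal, hcoef_zero; ring.
Qed.

(** * Chaotic linear operators *)

(** Continuity is uniform in the base point, a form that linearity provides and that passes at once
    to iterates. *)
Record lin_cont {r : nat} (T : Hr r -> Hr r) : Prop := {
  lc_plus : forall u v, T (plus u v) = plus (T u) (T v);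
  lc_scal : forall a u, T (scal a u) = scal a (T u);
  lc_cont : forall rho e, 1 <= rho -> 0 < e -> exists rho' e', 1 <= rho' /\ 0 < e' /\
    forall u v, near u v rho' e' -> near (T u) (T v) rho e
}.

Lemma scal_C0 (r : nat) (u : Hr r) : scal (RtoC 0) u = zero.
Proof. apply Hr_ext; intros z; exact (Cmult_0_l _). Qed.

Lemma scal_C1 (r : nat) (u : Hr r) : scal (RtoC 1) u = u.
Proof. apply Hr_ext; intros z; exact (Cmult_1_l _). Qed.

Lemma lc_zero (r : nat) (T : Hr r -> Hr r) : lin_cont T -> T zero = zero.
Proof.
intros HT; rewrite <- (scal_C0 r zero) at 1; rewrite (lc_scal T HT); apply scal_C0.
Qed.

Lemma lin_cont_iter (r : nat) (T : Hr r -> Hr r) (n : nat) :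
  lin_cont T -> lin_cont (Nat.iter n T).
Proof.
intros HT; induction n as [|n IH].
- split; [easy|easy|]; intros rho e H1 H2; exists rho, e; auto.
- split; simpl.
  + intros u v; now rewrite (lc_plus _ IH), (lc_plus _ HT).
  + intros a u; now rewrite (lc_scal _ IH), (lc_scal _ HT).
  + intros rho e H1 H2.
    destruct (lc_cont _ HT rho e H1 H2) as [rho1 [e1 [P1 [Q1 C1]]]].
    destruct (lc_cont _ IH rho1 e1 P1 Q1) as [rho2 [e2 [P2 [Q2 C2]]]].
    exists rho2, e2; split; [easy|split; [easy|]]; auto.
Qed.

(** Continuity at [zero] is moved to every other point by applying it to the difference [v - u]. *)
Lemma continuous_op_lin_cont (r : nat) (T : Hr r -> Hr r) : (2 <= r)%nat ->
  (forall u v, T (plus u v) = plus (T u) (T v)) ->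
  (forall (a : C) u, T (scal a u) = scal a (T u)) ->
  continuous_op nbhs_Hr T -> lin_cont T.
Proof.
intros H2 Hp Hs Hc; split; [easy|easy|]; intros rho e Hrho He.
assert (N : nbhs_Hr (T zero) (fun v => near (T zero) v rho e)).
{ apply nbhs_Hr_near; [easy|]; exists rho, e; auto. }
apply Hc in N; apply nbhs_Hr_near in N; [|easy].
destruct N as [rho' [e' [P' [Q' H']]]].
exists rho', e'; split; [easy|split; [easy|]]; intros u v Huv.
set (d := plus v (scal (- RtoC 1)%C u)).
assert (E : v = plus u d).
{ apply hcoef_inj; [easy|]; intros n; unfold d.
  rewrite !hcoef_plus, hcoef_scal; ring. }
assert (Nd : near zero d rho' e').
{ intros n; specialize (Huv n); rewrite hcoef_zero.
  unfold d; rewrite hcoef_plus, hcoef_scal.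
  replace (hcoef v n + - (1) * hcoef u n - 0)%C with (hcoef v n - hcoef u n)%C by ring; easy. }
assert (Z : T zero = zero) by (rewrite <- (scal_C0 r zero) at 1; rewrite Hs; apply scal_C0).
specialize (H' d Nd); rewrite Z in H'.
intros n; specialize (H' n); rewrite hcoef_zero in H'.
rewrite E, Hp, hcoef_plus.
replace (hcoef (T u) n + hcoef (T d) n - hcoef (T u) n)%C with (hcoef (T d) n - 0)%C by ring.
easy.
Qed.

(** * A countable dense set *)

Definition code_R (k : nat) : R :=
  let (p, s) := Cantor.of_nat k in
  let (q, d) := Cantor.of_nat s in (INR p - INR q) / INR (S d).

Definition code_C (k : nat) : C :=
  let (a, b) := Cantor.of_nat k in (code_R a, code_R b).

(** Reads a natural number as a list of naturals built by iterated Cantor pairing. *)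
Fixpoint code_nth (n c : nat) : nat :=
  match n with
  | O => fst (Cantor.of_nat c)
  | S n => code_nth n (snd (Cantor.of_nat c))
  end.

(** Enumerates the polynomials in [z ^ r] with coefficients in [Q(i)]; the zero tail makes [grow]
    automatic. *)
Definition code_Hr (r k : nat) : Hr r :=
  let (len, c) := Cantor.of_nat k in
  of_coefs r (fun n => if lt_dec n len then code_C (code_nth n c) else RtoC 0).

Lemma code_R_dense (x eps : R) : 0 < eps -> exists k, Rabs (code_R k - x) < eps.
Proof.
intros He.
destruct (archimed (/ eps)) as [A _].
assert (Pi : 0 < / eps) by now apply Rinv_0_lt_compat.
set (d := Z.to_nat (up (/ eps))).
assert (Hd : / eps < INR (S d)).
{ unfold d; rewrite S_INR, INR_IZR_INZ, Z2Nat.id; [lra|apply le_IZR; lra]. }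
assert (Pd : 0 < INR (S d)) by lra.
destruct (archimed (x * INR (S d))) as [B1 B2].
set (z := up (x * INR (S d))) in *.
(* The integer numerator [z] is the difference of [Z.to_nat z] and [Z.to_nat (- z)], at least one of
   which is 0. *)
exists (Cantor.to_nat (Z.to_nat z, Cantor.to_nat (Z.to_nat (- z), d))).
unfold code_R; rewrite !Cantor.cancel_of_to.
assert (E : INR (Z.to_nat z) - INR (Z.to_nat (- z)) = IZR z).
{ rewrite !INR_IZR_INZ, <- minus_IZR; f_equal; lia. }
rewrite E.
replace (IZR z / INR (S d) - x) with ((IZR z - x * INR (S d)) / INR (S d)) by (field; lra).
rewrite Rabs_right by (apply Rle_ge, Rmult_le_pos; [lra|apply Rlt_le, Rinv_0_lt_compat; lra]).
apply (Rmult_lt_reg_r (INR (S d))); [easy|].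
unfold Rdiv; rewrite Rmult_assoc, Rinv_l, Rmult_1_r by lra.
apply Rle_lt_trans with 1; [lra|].
apply (Rmult_lt_compat_l eps) in Hd; [|easy]; rewrite Rinv_r in Hd; lra.
Qed.

Lemma code_C_dense (z : C) (eps : R) : 0 < eps -> exists k, Cmod (code_C k - z) < eps.
Proof.
intros He.
destruct (code_R_dense (fst z) (eps / 2)) as [a Ha]; [lra|].
destruct (code_R_dense (snd z) (eps / 2)) as [b Hb]; [lra|].
exists (Cantor.to_nat (a, b)); unfold code_C; rewrite Cantor.cancel_of_to.
assert (M := Cmod_le_abs (code_R a - fst z) (code_R b - snd z)).
change ((code_R a, code_R b) - z)%C with (code_R a - fst z, code_R b - snd z); lra.
Qed.

Lemma code_nth_surj (N : nat) (f : nat -> nat) :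
  exists c, forall n, (n < N)%nat -> code_nth n c = f n.
Proof.
revert f; induction N as [|N IH]; intros f; [exists 0%nat; lia|].
destruct (IH (fun n => f (S n))) as [c Hc].
exists (Cantor.to_nat (f 0%nat, c)); intros [|n] Hn; cbn [code_nth];
  rewrite Cantor.cancel_of_to; [easy|].
cbn [snd]; rewrite Hc by lia; easy.
Qed.

Lemma grow_finite (N : nat) (a : nat -> C) : (forall n, (N <= n)%nat -> a n = 0%C) -> grow a.
Proof.
intros H rho Hr.
assert (P : forall n, 0 <= Cmod (a n) * rho ^ n)
  by (intros n; apply Rmult_le_pos; [apply Cmod_ge_0|now apply pow_le]).
assert (B : exists m, 0 <= m /\ forall n, (n < N)%nat -> Cmod (a n) * rho ^ n <= m).
{ clear H; induction N as [|N [m [Pm IH]]]; [exists 0; split; [lra|lia]|].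
  exists (m + Cmod (a N) * rho ^ N); split; [specialize (P N); lra|]; intros n Hn.
  destruct (Nat.eq_dec n N) as [->|]; [lra|].
  specialize (IH n ltac:(lia)); specialize (P N); lra. }
destruct B as [m [Pm Hm]]; exists m; intros n.
destruct (Nat.lt_ge_cases n N) as [L|L]; [now apply Hm|].
rewrite H, Cmod_0 by easy; lra.
Qed.

Lemma code_Hr_dense (r : nat) (u : Hr r) (rho e : R) : (1 <= r)%nat -> 1 <= rho -> 0 < e ->
  exists k, near u (code_Hr r k) rho e.
Proof.
intros Hr Hrho He.
destruct (hcoef_grow r u Hr (2 * rho)) as [m Hm]; [lra|].
assert (Pm : 0 <= m).
{ eapply Rle_trans; [|apply (Hm 0%nat)]; simpl; rewrite Rmult_1_r; apply Cmod_ge_0. }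
destruct (geom_small (/ 2) m e) as [N HN]; [lra|easy|easy|].
assert (PN : 0 < rho ^ N) by (apply pow_lt; lra).
(* Below [N] the weight [rho ^ n] is at most [rho ^ N], hence this precision; beyond [N] the
   coefficients of [u] are small enough to be dropped. *)
assert (F : forall n, exists k, Cmod (code_C k - hcoef u n) < e / rho ^ N).
{ intros n; apply code_C_dense; now apply Rdiv_lt_0_compat. }
set (f := fun n => proj1_sig (constructive_indefinite_description _ (F n))).
assert (Hf : forall n, Cmod (code_C (f n) - hcoef u n) < e / rho ^ N)
  by exact (fun n => proj2_sig (constructive_indefinite_description _ (F n))).
destruct (code_nth_surj N f) as [c Hc].
exists (Cantor.to_nat (N, c)); intros n.
unfold code_Hr; rewrite Cantor.cancel_of_to.
rewrite (of_coefs_spec r (fun n => if lt_dec n N then code_C (code_nth n c) else RtoC 0) Hr).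
2:{ apply (grow_finite N); intros k Hk; destruct (lt_dec k N); [lia|easy]. }
destruct (lt_dec n N) as [L|L].
- rewrite Hc by easy; specialize (Hf n).
  assert (R1 : rho ^ n <= rho ^ N) by (apply Rle_pow; [easy|lia]).
  assert (P1 : 0 <= rho ^ n) by (apply pow_le; lra).
  apply Rle_trans with (e / rho ^ N * rho ^ N); [|right; field; lra].
  apply Rmult_le_compat; [apply Cmod_ge_0|easy|lra|easy].
- replace (0 - hcoef u n)%C with (- hcoef u n)%C by ring; rewrite Cmod_opp.
  specialize (Hm n); specialize (HN n ltac:(lia)).
  rewrite Rpow_mult_distr in Hm.
  replace (Cmod (hcoef u n) * rho ^ n)
    with ((Cmod (hcoef u n) * (2 ^ n * rho ^ n)) * (/ 2) ^ n).
  + apply Rle_trans with (m * (/ 2) ^ n); [|lra].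
    apply Rmult_le_compat_r; [apply pow_le; lra|easy].
  + rewrite pow_inv; field; apply Rgt_not_eq, pow_two_gt_0.
Qed.

(** * Birkhoff transitivity *)

Lemma R_cauchy_limit (u : nat -> R) :
  (forall eps, 0 < eps -> exists N, forall m n, (N <= m)%nat -> (N <= n)%nat ->
     Rabs (u m - u n) < eps) ->
  exists l, forall eps, 0 < eps -> exists N, forall n, (N <= n)%nat -> Rabs (u n - l) < eps.
Proof.
intros H; destruct (Rcomplete.R_complete u) as [l Hl].
- intros eps He; destruct (H eps He) as [N HN]; exists N; intros n m Hn Hm; now apply HN.
- exists l; intros eps He; destruct (Hl eps He) as [N HN]; exists N; intros n Hn; now apply HN.
Qed.

Lemma C_cauchy_limit (u : nat -> C) :
  (forall eps, 0 < eps -> exists N, forall m n, (N <= m)%nat -> (N <= n)%nat ->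
     Cmod (u m - u n) < eps) ->
  exists l, forall eps, 0 < eps -> exists N, forall n, (N <= n)%nat -> Cmod (u n - l) < eps.
Proof.
intros H.
destruct (R_cauchy_limit (fun n => fst (u n))) as [a Ha].
{ intros eps He; destruct (H eps He) as [N HN]; exists N; intros m n Hm Hn.
  eapply Rle_lt_trans; [|apply (HN m n Hm Hn)].
  eapply Rle_trans; [apply (Rmax_l _ (Rabs (snd (u m - u n)%C)))|].
  apply (Rmax_Cmod (u m - u n)%C). }
destruct (R_cauchy_limit (fun n => snd (u n))) as [b Hb].
{ intros eps He; destruct (H eps He) as [N HN]; exists N; intros m n Hm Hn.
  eapply Rle_lt_trans; [|apply (HN m n Hm Hn)].
  eapply Rle_trans; [apply (Rmax_r (Rabs (fst (u m - u n)%C)))|].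
  apply (Rmax_Cmod (u m - u n)%C). }
exists (a, b); intros eps He.
destruct (Ha (eps / 2) ltac:(lra)) as [N1 H1], (Hb (eps / 2) ltac:(lra)) as [N2 H2].
exists (N1 + N2)%nat; intros n Hn.
specialize (H1 n ltac:(lia)); specialize (H2 n ltac:(lia)).
assert (M := Cmod_le_abs (fst (u n) - a) (snd (u n) - b)).
change (u n - (a, b))%C with (fst (u n) - a, snd (u n) - b); lra.
Qed.

(** Completeness in coefficients: since [rho k >= 1] and [e k] tends to 0, each coefficient is a
    Cauchy sequence, and the limits inherit the closed inequalities. The radii [rho k] tend to
    infinity, so the limit sequence satisfies [grow]. *)
Lemma nested_balls (r : nat) (x : nat -> Hr r) (rho e : nat -> R) : (2 <= r)%nat ->
  (forall k, INR k <= rho k /\ 1 <= rho k /\ e k <= / INR (S k)) ->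
  (forall k, near (x k) (x (S k)) (rho k) (e k)) ->
  (forall k y, near (x (S k)) y (rho (S k)) (e (S k)) -> near (x k) y (rho k) (e k)) ->
  exists y, forall k, near (x k) y (rho k) (e k).
Proof.
intros H2 Hb Hx Hn.
assert (Pe : forall k, 0 <= e k).
{ intros k; eapply Rle_trans; [|apply (Hx k 0%nat)].
  simpl; rewrite Rmult_1_r; apply Cmod_ge_0. }
assert (Nest : forall j k y, near (x (k + j)%nat) y (rho (k + j)%nat) (e (k + j)%nat) ->
  near (x k) y (rho k) (e k)).
{ induction j as [|j IH]; intros k y; [now rewrite Nat.add_0_r|].
  rewrite Nat.add_succ_r; intros H; apply IH; now apply Hn. }
assert (Near : forall k m, (k <= m)%nat -> near (x k) (x m) (rho k) (e k)).
{ intros k m Hm; apply (Nest (m - k)%nat).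
  replace (k + (m - k))%nat with m by lia; now apply near_refl. }
assert (One : forall k m i, (k <= m)%nat -> Cmod (hcoef (x m) i - hcoef (x k) i) <= e k).
{ intros k m i Hm; eapply Rle_trans; [|apply (Near k m Hm i)].
  rewrite <- (Rmult_1_r (Cmod _)) at 1; apply Rmult_le_compat_l; [apply Cmod_ge_0|].
  apply pow_R1_Rle, Hb. }
assert (Small : forall eps, 0 < eps -> exists k, e k < eps).
{ intros eps He; destruct (archimed (/ eps)) as [A _].
  assert (Pi : 0 < / eps) by now apply Rinv_0_lt_compat.
  set (N := Z.to_nat (up (/ eps))).
  assert (HN : / eps < INR (S N)).
  { unfold N; rewrite S_INR, INR_IZR_INZ, Z2Nat.id; [lra|apply le_IZR; lra]. }
  exists N; eapply Rle_lt_trans; [apply Hb|].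
  rewrite <- (Rinv_inv eps); apply Rinv_lt_contravar; [|easy].
  apply Rmult_lt_0_compat; lra. }
assert (Lim : forall i, exists l, forall eps, 0 < eps ->
  exists N, forall n, (N <= n)%nat -> Cmod (hcoef (x n) i - l) < eps).
{ intros i; apply C_cauchy_limit; intros eps He.
  destruct (Small (eps / 2)) as [N HN]; [lra|]; exists N; intros m n Hm Hn'.
  eapply Rle_lt_trans; [apply (Cmod_sub_tri _ (hcoef (x N) i))|].
  rewrite (Cmod_sub_sym (hcoef (x N) i)).
  assert (A := One N m i Hm); assert (B := One N n i Hn'); lra. }
set (a := fun i => proj1_sig (constructive_indefinite_description _ (Lim i))).
assert (Ha : forall i eps, 0 < eps ->
  exists N, forall n, (N <= n)%nat -> Cmod (hcoef (x n) i - a i) < eps)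
  by exact (fun i => proj2_sig (constructive_indefinite_description _ (Lim i))).
assert (La : forall k i, Cmod (a i - hcoef (x k) i) * rho k ^ i <= e k).
{ intros k i; apply Rnot_lt_le; intros L.
  assert (Pr : 0 < rho k ^ i) by (apply pow_lt; specialize (Hb k); lra).
  destruct (Ha i ((Cmod (a i - hcoef (x k) i) * rho k ^ i - e k) / rho k ^ i)) as [N HN];
    [apply Rdiv_lt_0_compat; lra|].
  specialize (HN (N + k)%nat ltac:(lia)).
  assert (Q := Near k (N + k)%nat ltac:(lia) i).
  assert (T := Cmod_sub_tri (a i) (hcoef (x (N + k)%nat) i) (hcoef (x k) i)).
  rewrite (Cmod_sub_sym (a i) (hcoef (x (N + k)%nat) i)) in T.
  apply (Rmult_lt_compat_r (rho k ^ i)) in HN; [|easy].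
  unfold Rdiv in HN; rewrite (Rmult_assoc (_ - _)), Rinv_l, Rmult_1_r in HN by lra.
  apply (Rmult_le_compat_r (rho k ^ i)) in T; [|lra]; lra. }
assert (G : grow a).
{ intros s Hs.
  destruct (archimed s) as [A _].
  set (k := Z.to_nat (up s)).
  assert (Hk : s <= rho k).
  { apply Rle_trans with (INR k); [|apply Hb].
    unfold k; rewrite INR_IZR_INZ, Z2Nat.id; [lra|apply le_IZR; lra]. }
  destruct (hcoef_grow r (x k) ltac:(lia) (rho k)) as [m Hm]; [lra|].
  exists (m + e k); intros i.
  assert (P : s ^ i <= rho k ^ i) by (apply pow_incr; lra).
  assert (P0 : 0 <= rho k ^ i) by (apply pow_le; lra).
  assert (T := Cmod_le_sub (a i) (hcoef (x k) i)).
  apply Rle_trans with (Cmod (a i) * rho k ^ i);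
    [apply Rmult_le_compat_l; [apply Cmod_ge_0|easy]|].
  apply (Rmult_le_compat_r _ _ _ P0) in T.
  specialize (Hm i); specialize (La k i); lra. }
exists (of_coefs r a); intros k i.
rewrite of_coefs_spec by (easy || lia); apply La.
Qed.

Definition transitive {r : nat} (T : Hr r -> Hr r) : Prop :=
  forall u v rho e, 1 <= rho -> 0 < e ->
    exists x n, near u x rho e /\ near v (Nat.iter n T x) rho e.

(** A Baire argument with explicit balls: at stage [k] the ball is shrunk until a single iterate of
    [T] maps all of it close to the [k]-th target. A point common to all balls has a dense orbit. *)
Lemma transitive_hypercyclic (r : nat) (T : Hr r -> Hr r) : (2 <= r)%nat ->
  lin_cont T -> transitive T -> hypercyclic nbhs_Hr T.
Proof.
intros H2 HT Htr.
(* The index [k] codes a pair (element of the dense set, precision), so every element is a target at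
   every precision. *)
set (tgt := fun k => code_Hr r (fst (Cantor.of_nat k))).
set (rd := fun k => INR (S (snd (Cantor.of_nat k)))).
set (P := fun (k : nat) (s : Hr r * (R * R)) => INR k <= fst (snd s) /\ 1 <= fst (snd s) /\
   0 < snd (snd s) <= / INR (S k)).
set (Q := fun (k : nat) (s s' : Hr r * (R * R)) =>
  near (fst s) (fst s') (fst (snd s)) (snd (snd s)) /\
  (forall y, near (fst s') y (fst (snd s')) (snd (snd s')) ->
     near (fst s) y (fst (snd s)) (snd (snd s))) /\
  exists n, forall y, near (fst s') y (fst (snd s')) (snd (snd s')) ->
     near (tgt k) (Nat.iter n T y) (rd k) (/ rd k)).
destruct (dependent_choice P Q) as [s Hs].
- exists (zero, (1, 1)); unfold P; simpl; rewrite Rinv_1; lra.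
- intros k [x [rho e]] [_ [P1 [P2 _]]]; simpl in P1, P2.
  assert (R1 : 1 <= rd k) by (apply (le_INR 1); lia).
  assert (Ri : 0 < / rd k) by (apply Rinv_0_lt_compat; lra).
  destruct (Htr x (tgt k) (Rmax rho (rd k)) (Rmin (e / 2) (/ rd k / 2))) as [x' [n [A B]]].
  { eapply Rle_trans; [apply P1|apply Rmax_l]. }
  { apply Rmin_pos; lra. }
  apply near_mono with (rho := rho) (e := e / 2) in A;
    [|split; [lra|apply Rmax_l]|apply Rmin_l].
  apply near_mono with (rho := rd k) (e := / rd k / 2) in B;
    [|split; [lra|apply Rmax_r]|apply Rmin_r].
  destruct (lc_cont _ (lin_cont_iter r T n HT) (rd k) (/ rd k / 2) R1 ltac:(lra))
    as [rho1 [e1 [C1 [C2 C3]]]].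
  assert (PS : 0 < INR (S (S k))) by (apply lt_0_INR; lia).
  (* The three entries of each extremum ensure convergence of the balls, inclusion in the previous
     ball, and continuity of the [n]-th iterate on the new one. *)
  exists (x', (Rmax (INR (S k)) (Rmax rho rho1), Rmin (/ INR (S (S k))) (Rmin (e / 2) e1))).
  assert (M1 := Rmax_l (INR (S k)) (Rmax rho rho1)).
  assert (M2 := Rmax_r (INR (S k)) (Rmax rho rho1)).
  assert (M3 := Rmax_l rho rho1); assert (M4 := Rmax_r rho rho1).
  assert (m1 := Rmin_l (/ INR (S (S k))) (Rmin (e / 2) e1)).
  assert (m2 := Rmin_r (/ INR (S (S k))) (Rmin (e / 2) e1)).
  assert (m3 := Rmin_l (e / 2) e1); assert (m4 := Rmin_r (e / 2) e1).
  unfold P, Q; cbn [fst snd]; split; [|split; [|split; [|exists n]]].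
  + split; [easy|split; [lra|split; [|easy]]].
    apply Rmin_pos; [now apply Rinv_0_lt_compat|apply Rmin_pos; lra].
  + apply near_mono with rho (e / 2); [lra|lra|easy].
  + intros y Hy; replace e with (e / 2 + e / 2) by field.
    apply near_tri with x'; [lra|easy|].
    eapply near_mono; [| |apply Hy]; [lra|lra].
  + intros y Hy; replace (/ rd k) with (/ rd k / 2 + / rd k / 2) by lra.
    apply near_tri with (Nat.iter n T x'); [lra|easy|].
    apply C3; eapply near_mono; [| |apply Hy]; [lra|lra].
- destruct (nested_balls r (fun k => fst (s k)) (fun k => fst (snd (s k)))
    (fun k => snd (snd (s k))) H2) as [x Hx].
  + intros k; destruct (Hs k) as [[A [B [D E]]] _]; auto.
  + intros k; exact (proj1 (proj2 (Hs k))).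
  + intros k; exact (proj1 (proj2 (proj2 (Hs k)))).
  + exists x; intros y N Hy; apply nbhs_Hr_near in Hy; [|easy].
    destruct Hy as [rho [e [Hrho [He HN]]]].
    destruct (code_Hr_dense r y rho (e / 2)) as [i Hi]; [lia|easy|lra|].
    destruct (archimed (rho + / (e / 2))) as [A _].
    assert (Pi : 0 < / (e / 2)) by (apply Rinv_0_lt_compat; lra).
    (* Chosen so that [S m] is at least both [rho] and [1 / (e / 2)]: the precision coded by [m] is
       then finer than the ball of radius [e / 2] at [rho]. *)
    set (m := Z.to_nat (up (rho + / (e / 2)))).
    assert (Hm : rho + / (e / 2) <= INR (S m)).
    { unfold m; rewrite S_INR, INR_IZR_INZ, Z2Nat.id; [lra|apply le_IZR; lra]. }
    destruct (Hs (Cantor.to_nat (i, m))) as [_ [_ [_ [n Hn]]]].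
    specialize (Hn x (Hx (S (Cantor.to_nat (i, m))))).
    unfold tgt, rd in Hn; rewrite Cantor.cancel_of_to in Hn; cbn [fst snd] in Hn.
    exists (Nat.iter n T x); split; [now exists n|].
    apply HN; replace e with (e / 2 + e / 2) by field.
    apply near_tri with (code_Hr r i); [lra|easy|].
    eapply near_mono; [| |apply Hn]; [lra|].
    rewrite <- (Rinv_inv (e / 2)); apply Rinv_le_contravar; [easy|lra].
Qed.

(** * Convolution operators *)

Lemma iter_mult_fixed {X : Type} (T : X -> X) (x : X) (n m : nat) :
  Nat.iter n T x = x -> Nat.iter (m * n) T x = x.
Proof.
intros H; induction m as [|m IH]; [easy|].
simpl; rewrite Nat.iter_add, IH; easy.
Qed.

(* In the coefficients, [B_r u = mu u] is a one-term recursion. *)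
Lemma hyper_Bessel_eigenspace (r : nat) (gamma : nat -> R) (mu : C) (u : Hr r) :
  weights_ok r gamma ->
  hyper_Bessel r gamma u = scal mu u <-> u = scal (hcoef u 0) (jvec gamma mu).
Proof.
intros W; assert (H2 := proj1 W).
assert (Nz := fun n => bessel_fact_nz r gamma n W).
split.
- intros H; apply hcoef_inj; [easy|]; intros n.
  rewrite hcoef_scal, hcoef_jvec by easy.
  induction n as [|n IH]; [simpl; field; injection; lra|].
  assert (E := hyper_Bessel_spec r gamma u H2 n).
  rewrite H, hcoef_scal, IH in E.
  assert (Nw : RtoC (bessel_weight r gamma n) <> 0%C).
  { intros F; apply (Nz (S n)); simpl; rewrite RtoC_mult, F; ring. }
  replace (hcoef u (S n)) with (/ RtoC (bessel_weight r gamma n)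
    * (RtoC (bessel_weight r gamma n) * hcoef u (S n)))%C by (field; easy).
  rewrite <- E; simpl bessel_fact; rewrite RtoC_mult, Cpow_S; field; now split.
- intros ->; apply hcoef_inj; [easy|]; intros n.
  rewrite hyper_Bessel_spec, !hcoef_scal, !hcoef_jvec by easy.
  assert (Nw : RtoC (bessel_weight r gamma n) <> 0%C).
  { intros F; apply (Nz (S n)); simpl; rewrite RtoC_mult, F; ring. }
  simpl bessel_fact; rewrite RtoC_mult, Cpow_S; field; now split.
Qed.

(** Coefficient 0 reads off the eigenvalue because [jvec gamma mu] has coefficient 0 equal to 1. In
    terms of the series [Phi] representing [L], this is the function with
    [Phi z = symbol (z ^ r)]. *)
Definition symbol {r : nat} (gamma : nat -> R) (L : Hr r -> Hr r) (mu : C) : C :=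
  hcoef (L (jvec gamma mu)) 0.

Lemma convolution_eigenvector (r : nat) (gamma : nat -> R) (L : Hr r -> Hr r) (mu : C) :
  weights_ok r gamma -> convolution_operator r gamma L ->
  L (jvec gamma mu) = scal (symbol gamma L mu) (jvec gamma mu).
Proof.
intros W HL; apply hyper_Bessel_eigenspace; [easy|].
rewrite <- (conv_commute _ _ _ HL), <- (conv_scal _ _ _ HL); f_equal.
apply hyper_Bessel_eigenspace; [easy|].
rewrite hcoef_jvec by easy; simpl.
replace (1 / RtoC 1)%C with (RtoC 1) by (field; injection; lra).
now rewrite scal_C1.
Qed.

(** By linearity the difference quotient of the symbol at [mu] is coefficient 0 of
    [L (jrem gamma mu d 1)]. Continuity of [L] makes it continuous at [d = 0], and Caratheodory's
    criterion applies. *)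
Lemma symbol_centire (r : nat) (gamma : nat -> R) (L : Hr r -> Hr r) :
  weights_ok r gamma -> lin_cont L -> centire (symbol gamma L).
Proof.
intros W HL mu.
set (l := fun d => hcoef (L (jrem gamma mu d 1)) 0).
exists (l 0%C).
apply (cdiff_caratheodory _ (fun z => l (z - mu)%C) _ _ 1 Rlt_0_1).
- intros z _; unfold symbol, l.
  replace (jvec gamma z) with (jrem gamma mu (z - mu) 0 : Hr r)
    by (rewrite jrem_0 by easy; f_equal; ring).
  replace (jvec gamma mu) with (jrem gamma mu 0 0 : Hr r)
    by (rewrite jrem_0 by easy; f_equal; ring).
  rewrite (jrem_step r gamma mu (z - mu) 0 W) at 1.
  rewrite (lc_plus _ HL), (lc_scal _ HL), hcoef_plus, hcoef_scal; ring.
- f_equal; ring.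
- intros eps He.
  destruct (lc_cont _ HL 1 (eps / 2)) as [rho [e [Hrho [Pe H]]]]; [lra|lra|].
  destruct (jrem_bound r gamma mu rho W) as [k [Pk Hk]]; [lra|].
  assert (Pd : 0 < Rmin 1 (e / (1 + k))).
  { apply Rmin_pos; [lra|apply Rdiv_lt_0_compat; lra]. }
  assert (M1 := Rmin_l 1 (e / (1 + k))); assert (M2 := Rmin_r 1 (e / (1 + k))).
  exists (Rmin 1 (e / (1 + k))); split; [easy|]; intros w Hw.
  replace (mu - mu)%C with (RtoC 0) by ring.
  set (d := (w - mu)%C) in *.
  assert (N : near (jrem gamma mu 0 1 : Hr r) (jrem gamma mu d 1) rho e).
  { apply near_mono with rho (Cmod d * k); [lra| |].
    - apply Rle_trans with (e / (1 + k) * (1 + k)); [|right; field; lra].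
      apply Rmult_le_compat; [apply Cmod_ge_0|easy|lra|lra].
    - apply near_of_bound with (jrem gamma mu d 2); [now apply jrem_step|].
      intros n; apply Hk; lra. }
  specialize (H _ _ N 0%nat); simpl in H; rewrite Rmult_1_r in H.
  unfold l; lra.
Qed.

Lemma acc_point_full (z : C) : acc_point (fun _ => True) z.
Proof. apply acc_point_open with 1; [lra|easy]. Qed.

(** If the symbol is constantly [c], then [L] agrees with multiplication by [c] on all eigenvectors,
    hence on their dense span, hence everywhere by continuity. *)
Lemma symbol_nonconstant (r : nat) (gamma : nat -> R) (L : Hr r -> Hr r) :
  weights_ok r gamma -> convolution_operator r gamma L -> lin_cont L ->
  (~ exists c : C, forall u : Hr r, L u = scal c u) ->
  exists z, symbol gamma L z <> symbol gamma L 0.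
Proof.
intros W HC HL Hns; apply NNPP; intros A; apply Hns.
set (c := symbol gamma L 0) in *.
assert (E : forall z, symbol gamma L z = c).
{ intros z; apply NNPP; intros B; apply A; now exists z. }
exists c; intros u; apply hcoef_inj; [apply W|]; intros n.
rewrite hcoef_scal; apply Ceq_minus, Cmod_small_0; intros eps He.
assert (Pc := Cmod_ge_0 c).
destruct (lc_cont _ HL 1 (eps / 2)) as [rho [e [Hrho [Pe H]]]]; [lra|lra|].
assert (Pm : 0 < Rmin e (eps / (2 * (1 + Cmod c)))).
{ apply Rmin_pos; [easy|apply Rdiv_lt_0_compat; lra]. }
destruct (eigenspan_dense r gamma _ 0%C W (acc_point_full 0) u rho _ Hrho Pm)
  as [v [Sv Nv]].
assert (Lv : L v = scal c v).
{ clear Nv; induction Sv as [|a mu v _ Sv IH].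
  - rewrite (lc_zero _ _ HL); apply hcoef_inj; [apply W|]; intros k.
    rewrite hcoef_scal, !hcoef_zero; ring.
  - rewrite (lc_plus _ HL), (lc_scal _ HL), IH, (convolution_eigenvector r gamma L mu W HC), E.
    apply hcoef_inj; [apply W|]; intros k.
    rewrite !hcoef_plus, !hcoef_scal, !hcoef_plus, !hcoef_scal; ring. }
assert (N1 : near u v rho e) by (eapply near_mono; [| |apply Nv]; [lra|apply Rmin_l]).
assert (N2 := H _ _ N1 n); rewrite pow1, Rmult_1_r, Lv, hcoef_scal in N2.
assert (N3 : Cmod (hcoef v n - hcoef u n) <= eps / (2 * (1 + Cmod c))).
{ eapply Rle_trans; [|eapply Rle_trans; [apply (Nv n)|apply Rmin_r]].
  rewrite <- (Rmult_1_r (Cmod _)) at 1; apply Rmult_le_compat_l; [apply Cmod_ge_0|].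
  now apply pow_R1_Rle. }
replace (hcoef (L u) n - c * hcoef u n)%C
  with (c * (hcoef v n - hcoef u n) - (c * hcoef v n - hcoef (L u) n))%C by ring.
eapply Rle_trans; [apply Cmod_sub_le|]; rewrite Cmod_mult.
assert (X : Cmod c * Cmod (hcoef v n - hcoef u n) <= eps / 2); [|lra].
apply Rle_trans with ((1 + Cmod c) * (eps / (2 * (1 + Cmod c)))); [|right; field; lra].
apply Rmult_le_compat; [easy|apply Cmod_ge_0|lra|easy].
Qed.

(** * Dynamics on the span of eigenvectors *)

Lemma iter_eigenvector (r : nat) (T : Hr r -> Hr r) (a : C) (u : Hr r) (n : nat) :
  lin_cont T -> T u = scal a u -> Nat.iter n T u = scal (a ^ n)%C u.
Proof.
intros HT H; induction n as [|n IH]; [simpl; now rewrite scal_C1|].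
simpl; rewrite IH, (lc_scal _ HT), H.
apply Hr_ext; intros z; change (a ^ n * (a * u z) = a * a ^ n * u z)%C; ring.
Qed.

Lemma jvec_bound (r : nat) (gamma : nat -> R) (mu : C) (rho : R) : weights_ok r gamma ->
  0 <= rho -> exists m, 0 <= m /\ near zero (jvec gamma mu : Hr r) rho m.
Proof.
intros W Hr.
destruct (div_bessel_fact_bound r gamma (Cmod mu) rho W (Cmod_ge_0 mu) Hr) as [m [Pm Hm]].
exists m; split; [easy|]; intros n; rewrite hcoef_zero, hcoef_jvec by easy.
replace (mu ^ n / RtoC (bessel_fact r gamma n) - 0)%C
  with (mu ^ n / RtoC (bessel_fact r gamma n))%C by ring.
apply Hm; rewrite Cmod_pow; lra.
Qed.

Lemma near_zero_add (r : nat) (a : C) (u v : Hr r) (rho m e : R) : 0 <= rho ->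
  Cmod a * m <= e / 2 -> near zero u rho m -> near zero v rho (e / 2) ->
  near zero (plus (scal a u) v) rho e.
Proof.
intros Prho Ha Hu Hv.
apply (near_scal r a) in Hu.
replace (scal a (zero : Hr r)) with (zero : Hr r) in Hu
  by (apply Hr_ext; intros z; symmetry; exact (Cmult_0_r a)).
apply near_mono with (rho := rho) (e := e / 2) in Hu; [|lra|easy].
replace e with (e / 2 + e / 2) by field.
rewrite <- (plus_zero_l zero); now apply near_plus.
Qed.

Lemma eigenspan_iter_small (r : nat) (gamma : nat -> R) (T : Hr r -> Hr r) (f : C -> C)
  (u : Hr r) : weights_ok r gamma -> lin_cont T ->
  (forall mu, T (jvec gamma mu) = scal (f mu) (jvec gamma mu)) ->
  eigenspan gamma (fun mu => Cmod (f mu) < 1) u ->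
  forall rho e, 0 <= rho -> 0 < e ->
    exists N, forall n, (N <= n)%nat -> near zero (Nat.iter n T u) rho e.
Proof.
intros W HT Hf Hu rho e Prho; revert e; induction Hu as [|a mu u Hmu Hu IH]; intros e He.
- exists 0%nat; intros n _; rewrite (lc_zero _ _ (lin_cont_iter r T n HT)).
  apply near_refl; lra.
- destruct (jvec_bound r gamma mu rho W Prho) as [m [Pm Hm]].
  destruct (IH (e / 2)) as [N1 H1]; [lra|].
  destruct (geom_small (Cmod (f mu)) (Cmod a * m) (e / 2)) as [N2 H2];
    [split; [apply Cmod_ge_0|easy]|apply Rmult_le_pos; [apply Cmod_ge_0|easy]|lra|].
  exists (N1 + N2)%nat; intros n Hn.
  assert (HTn := lin_cont_iter r T n HT).
  rewrite (lc_plus _ HTn), (lc_scal _ HTn), (iter_eigenvector r T (f mu) _ n HT (Hf mu)).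
  replace (scal a (scal (f mu ^ n)%C (jvec gamma mu)))
    with (scal (a * f mu ^ n)%C (jvec gamma mu) : Hr r)
    by (apply Hr_ext; intros z; symmetry; exact (Cmult_assoc _ _ _)).
  apply near_zero_add with m; [easy| |easy|apply H1; lia].
  rewrite Cmod_mult, Cmod_pow; specialize (H2 n ltac:(lia)); lra.
Qed.

(** Though [T] need not be invertible, a combination of eigenvectors has an explicit preimage under
    the [n]-th iterate: divide each coefficient by [f mu ^ n]. As [Cmod (f mu) > 1], these preimages
    tend to zero. *)
Lemma eigenspan_small_preimage (r : nat) (gamma : nat -> R) (T : Hr r -> Hr r) (f : C -> C)
  (u : Hr r) : weights_ok r gamma -> lin_cont T ->
  (forall mu, T (jvec gamma mu) = scal (f mu) (jvec gamma mu)) ->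
  eigenspan gamma (fun mu => 1 < Cmod (f mu)) u ->
  forall rho e, 0 <= rho -> 0 < e ->
    exists N, forall n, (N <= n)%nat -> exists v, near zero v rho e /\ Nat.iter n T v = u.
Proof.
intros W HT Hf Hu rho e Prho; revert e; induction Hu as [|a mu u Hmu Hu IH]; intros e He.
- exists 0%nat; intros n _; exists zero; split; [apply near_refl; lra|].
  apply (lc_zero _ _ (lin_cont_iter r T n HT)).
- destruct (jvec_bound r gamma mu rho W Prho) as [m [Pm Hm]].
  assert (Nf : f mu <> 0%C) by (apply Cmod_gt_0; lra).
  destruct (IH (e / 2)) as [N1 H1]; [lra|].
  destruct (geom_small (/ Cmod (f mu)) (Cmod a * m) (e / 2)) as [N2 H2];
    [|apply Rmult_le_pos; [apply Cmod_ge_0|easy]|lra|].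
  { split; [apply Rlt_le, Rinv_0_lt_compat; lra|].
    rewrite <- Rinv_1; apply Rinv_lt_contravar; lra. }
  exists (N1 + N2)%nat; intros n Hn.
  assert (HTn := lin_cont_iter r T n HT).
  destruct (H1 n ltac:(lia)) as [v [Hv Ev]].
  exists (plus (scal (a / f mu ^ n)%C (jvec gamma mu)) v); split.
  + apply near_zero_add with m; [easy| |easy|easy].
    rewrite Cmod_div, Cmod_pow by (now apply Cpow_nz).
    specialize (H2 n ltac:(lia)); rewrite pow_inv in H2.
    unfold Rdiv; lra.
  + rewrite (lc_plus _ HTn), (lc_scal _ HTn), Ev, (iter_eigenvector r T (f mu) _ n HT (Hf mu)).
    f_equal; apply Hr_ext; intros z.
    change (a / f mu ^ n * (f mu ^ n * (jvec gamma mu : Hr r) z)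
      = a * (jvec gamma mu : Hr r) z)%C.
    field; now apply Cpow_nz.
Qed.

(** The product of the periods of the finitely many terms is a period of their sum. *)
Lemma eigenspan_periodic (r : nat) (gamma : nat -> R) (T : Hr r -> Hr r) (f : C -> C)
  (u : Hr r) : lin_cont T ->
  (forall mu, T (jvec gamma mu) = scal (f mu) (jvec gamma mu)) ->
  eigenspan gamma (fun mu => root_of_unity (f mu)) u ->
  exists n, (1 <= n)%nat /\ Nat.iter n T u = u.
Proof.
intros HT Hf Hu; induction Hu as [|a mu u [m [Hm Em]] Hu [n [Hn En]]].
- exists 1%nat; split; [easy|]; apply (lc_zero _ _ HT).
- exists (m * n)%nat; split; [nia|].
  assert (HTn := lin_cont_iter r T (m * n) HT).
  rewrite (lc_plus _ HTn), (lc_scal _ HTn), (iter_mult_fixed T u n m En).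
  rewrite (Nat.mul_comm m n), (iter_mult_fixed T _ m n); [easy|].
  rewrite (iter_eigenvector r T (f mu) _ m HT (Hf mu)), Em; apply scal_C1.
Qed.

Theorem theorem5p3 (r : nat) (gamma : nat -> R) (L : Hr r -> Hr r)
  (hr : (2 <= r)%nat)
  (hgamma : forall k : nat, (1 <= k <= r - 1)%nat ->
     - 1 + INR k / INR r <= gamma k)
  (hL : convolution_operator r gamma L)
  (hL_not_scalar : ~ exists c : C, forall u : Hr r, L u = scal c u) :
  chaotic nbhs_Hr L.
Proof.
assert (W : weights_ok r gamma) by (split; [easy|]; intros n; now apply bessel_weight_ge).
assert (HL : lin_cont L).
{ apply continuous_op_lin_cont; [easy|apply hL|apply hL|apply hL]. }
assert (Eig := fun mu => convolution_eigenvector r gamma L mu W hL).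
assert (Hf := symbol_centire r gamma L W HL).
assert (Nf := symbol_nonconstant r gamma L W hL HL hL_not_scalar).
split.
- apply transitive_hypercyclic; [easy|easy|]; intros u v rho e Hrho He.
  destruct (acc_point_Cmod_lt_1 _ Hf Nf) as [a Ha].
  destruct (acc_point_Cmod_gt_1 _ Hf Nf) as [b Hb].
  destruct (eigenspan_dense r gamma _ a W Ha u rho (e / 2)) as [x [Sx Nx]]; [easy|lra|].
  destruct (eigenspan_dense r gamma _ b W Hb v rho (e / 2)) as [y [Sy Ny]]; [easy|lra|].
  destruct (eigenspan_iter_small r gamma L _ x W HL Eig Sx rho (e / 2)) as [N1 H1]; [lra|lra|].
  destruct (eigenspan_small_preimage r gamma L _ y W HL Eig Sy rho (e / 2)) as [N2 H2];
    [lra|lra|].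
  destruct (H2 (N1 + N2)%nat ltac:(lia)) as [w [Nw Ew]].
  specialize (H1 (N1 + N2)%nat ltac:(lia)).
  (* Godefroy-Shapiro argument: [w] is small and is mapped onto [y], close to [v], while the iterate
     of [x] is already small. So [x + w] starts near [u] and arrives near [v]. *)
  exists (plus x w), (N1 + N2)%nat; replace e with (e / 2 + e / 2) by field; split.
  + rewrite <- (plus_zero_r u); apply near_plus; [lra|easy|easy].
  + rewrite (lc_plus _ (lin_cont_iter r L (N1 + N2) HL)), Ew.
    rewrite <- (plus_zero_l v); apply near_plus; [lra|easy|easy].
- intros u P HP; apply nbhs_Hr_near in HP; [|easy].
  destruct HP as [rho [e [Hrho [He H]]]].
  destruct (acc_point_root_of_unity _ Hf Nf) as [a Ha].
  destruct (eigenspan_dense r gamma _ a W Ha u rho e Hrho He) as [y [Sy Ny]].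
  exists y; split; [|now apply H].
  now apply (eigenspan_periodic r gamma L _ y HL Eig).
Qed.
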